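(* Let $d\ge1$ and $\nu>0$, and consider on $\mathbb T^d$ the equation $$\partial_t h=\nabla\cdot\bigl((|\nabla h|^2-1)\nabla h\bigr)-\nu\Delta^2h .$$ There exists a nonempty family $\mathcal A$ of smooth initial data on $\mathbb T^d$ such that the following holds: (1) For any $h_0\in\mathcal A$, $\int_{\mathbb T^d}h_0(x)\,dx=0$ and $\|\nabla h_0\|_\infty<1$. (2) For any $h_0\in\mathcal A$, there exists $t_0>0$ (depending on $h_0$) such that the solution $h$ with initial data $h_0$ satisfies $$\|\nabla h(t_0,\cdot)\|_\infty>1 .$$
   Context: $\mathbb T^d=\mathbb R^d/2\pi\mathbb Z^d$; functions are real-valued; $\|\nabla h\|_\infty$ is the $L^\infty(\mathbb T^d)$ norm of the Euclidean length $|\nabla h|$. The solution with initial data $h_0$ is the unique mild solution $h(t)=e^{-\nu t\Delta^2}h_0+\int_0^t\nabla\cdot e^{-\nu(t-s)\Delta^2}((|\nabla h|^2-1)\nabla h)(s)\,ds$, where $e^{-\nu t\Delta^2}$ is the Fourier multiplier $e^{-\nu t|k|^4}$, with $h\in C_t^0H_x^{d/2}$, $t^{1/4}\nabla h\in C_t^0C_x^0$, $t^{1/4}h\in C_t^0H_x^{d/2+1}$ on each $[0,T]$ with $T$ less than its maximal lifespan $T_*\in(0,\infty]$; it is smooth for smooth data. The assertion about $h(t_0,\cdot)$ includes that $t_0<T_*$. *)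

(* Defs.v *)
From HB Require Import structures.
From mathcomp Require Import all_boot all_order all_algebra.
From mathcomp Require Import complex.
From mathcomp Require Import all_classical all_reals all_analysis.

Set Implicit Arguments.
Unset Strict Implicit.
Unset Printing Implicit Defensive.

Import Order.TTheory GRing.Theory Num.Theory.
Import numFieldNormedType.Exports.

Local Open Scope classical_set_scope.
Local Open Scope ring_scope.

(* Lebesgue measure on T^d, realised on the fundamental box [0, 2pi]^d.       *)

Section circle_measure.
Variable R : realType.

Let circle_fin :
  ((@lebesgue_measure R) `[0%R, (2 * pi)%R]%classic < +oo)%E.
Proof. by rewrite lebesgue_measure_itv/=; case: ifP => _; rewrite ltry. Qed.

Definition circle_measure : set (measurableTypeR R) -> \bar R :=
  @mfrestr _ (measurableTypeR R) R `[0%R, (2 * pi)%R]%classic lebesgue_measure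
    (measurable_itv `[0%R, (2 * pi)%R]) circle_fin.

HB.instance Definition _ := FiniteMeasure.on circle_measure.

End circle_measure.

Section cons_measure.
Variables (R : realType) (n : nat).
Variables (m1 : {finite_measure set (measurableTypeR R) -> \bar R})
          (m2 : {finite_measure set (n.-tuple (measurableTypeR R)) -> \bar R}).

Let tcons (p : measurableTypeR R * n.-tuple (measurableTypeR R))
    : n.+1.-tuple (measurableTypeR R) := [the n.+1.-tuple _ of p.1 :: p.2].

Definition cons_measure : set (n.+1.-tuple (measurableTypeR R)) -> \bar R :=
  pushforward (m1 \x m2)%E tcons.

Let measurable_tcons : measurable_fun setT tcons.
Proof. exact: measurable_cons. Qed.

Let cons_measure0 : cons_measure set0 = 0%E.
Proof. by rewrite /cons_measure /pushforward preimage_set0 measure0. Qed.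

Let cons_measure_ge0 A : (0 <= cons_measure A)%E.
Proof. exact: measure_ge0. Qed.

Let cons_measure_sigma_additive : semi_sigma_additive cons_measure.
Proof.
exact: (@measure_semi_sigma_additive _ _ _
  (measure_function_pushforward__canonical__measure_function_Measure
     (m1 \x m2)%E measurable_tcons)).
Qed.

HB.instance Definition _ := isMeasure.Build _ _ _ cons_measure
  cons_measure0 cons_measure_ge0 cons_measure_sigma_additive.

Let cons_measure_fin : fin_num_fun cons_measure.
Proof.
apply: lty_fin_num_fun; rewrite [ltLHS](_ : _ = (m1 \x m2)%E (setT `*` setT)).
  rewrite product_measure1E//.
  by rewrite lte_mul_pinfty ?fin_num_measure// ltey_eq fin_num_measure.
by rewrite setXTT.
Qed.

HB.instance Definition _ :=
  Measure_isFinite.Build _ _ _ cons_measure cons_measure_fin.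

End cons_measure.

Fixpoint torus_measure (R : realType) (d : nat)
    : {finite_measure set (d.-tuple (measurableTypeR R)) -> \bar R} :=
  if d is n.+1 then cons_measure (@circle_measure R) (torus_measure R n)
  else \d_([tuple]).

(* Functions on T^d are 2pi-periodic functions on R^d = 'rV[R]_d.             *)

Section torus.
Variables (R : realType) (d : nat).
Local Notation E := 'rV[R]_d.

Definition basis_vec (j : 'I_d) : E := delta_mx ord0 j.

Definition row_of_tuple (y : d.-tuple (measurableTypeR R)) : E :=
  \row_j (tnth y j : R).

Definition torus_periodic (f : E -> R) : Prop :=
  forall j : 'I_d, periodic f ((2 * pi) *: basis_vec j).

Definition torus_integral (f : E -> R) : R :=
  \int[torus_measure R d]_y f (row_of_tuple y).

Definition eucl_norm (v : E) : R := Num.sqrt (\sum_j v ord0 j ^+ 2).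

Definition partial (j : 'I_d) (f : E -> R) (x : E) : R := 'D_(basis_vec j) f x.

Definition gradient (f : E -> R) (x : E) : E := \row_j partial j f x.

Definition divergence (F : 'I_d -> E -> R) (x : E) : R :=
  \sum_j partial j (F j) x.

Definition has_partials (f : E -> R) : Prop :=
  forall (x : E) (j : 'I_d), derivable f x (basis_vec j).

Definition C1 (f : E -> R) : Prop :=
  [/\ continuous f, has_partials f & forall j, continuous (partial j f)].

Definition smooth (f : E -> R) : Prop :=
  forall s : seq 'I_d, C1 (foldr partial f s).

Definition grad_Linfty (f : E -> R) : \bar R :=
  Lnorm (torus_measure R d) +oo%E
    (fun y => (eucl_norm (gradient f (row_of_tuple y)))%:E).

Definition sup_norm (F : E -> E) : \bar R :=
  ereal_sup [set (eucl_norm (F x))%:E | x in [set: E]].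

Definition freq_sq (k : 'rV[int]_d) : R := \sum_j (k ord0 j)%:~R ^+ 2.

Definition freq_dot (k : 'rV[int]_d) (x : E) : R :=
  \sum_j (k ord0 j)%:~R * x ord0 j.

Definition expi (t : R) : R[i] := (cos t +i* sin t)%C.

(* (2pi)^-d * \int_(T^d) f(y) e^(- i k.y) dy *)
Definition fourier_coef (f : E -> R) (k : 'rV[int]_d) : R[i] :=
  (((2 * pi) ^- d *
      torus_integral (fun y => f y * complex.Re (expi (- freq_dot k y))))
   +i* ((2 * pi) ^- d *
      torus_integral (fun y => f y * complex.Im (expi (- freq_dot k y)))))%C.

Definition freq_cube (N : nat) : set 'rV[int]_d :=
  [set k | forall j, (`|k ord0 j| <= N%:Z)%R].

(* The operator with symbol m. For m real and even and f real-valued the      *)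
(* Fourier series is real, so taking real parts loses nothing.                *)
Definition fourier_multiplier (m : 'rV[int]_d -> R) (f : E -> R) (x : E) : R :=
  limn (fun N : nat => \sum_(k \in freq_cube N)
    complex.Re ((m k)%:C%C * fourier_coef f k * expi (freq_dot k x))).

(* e^(- nu t Delta^2) *)
Definition bilap_semigroup (nu t : R) : (E -> R) -> E -> R :=
  fourier_multiplier (fun k => expR (- (nu * t * freq_sq k ^+ 2))).

(* The components of (|grad u|^2 - 1) grad u. *)
Definition flux (u : E -> R) (j : 'I_d) (x : E) : R :=
  (eucl_norm (gradient u x) ^+ 2 - 1) * partial j u x.

Definition sobolev_norm (s : R) (f : E -> R) : \bar R :=
  ((\esum_(k in [set: 'rV[int]_d])
     ((1 + freq_sq k) `^ s *
      (complex.Re (fourier_coef f k) ^+ 2 +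
       complex.Im (fourier_coef f k) ^+ 2))%:E) `^ 2^-1)%E.

Definition continuous_in_sobolev (s T : R) (u : R -> E -> R) : Prop :=
  forall t, t \in `[0, T] ->
    (sobolev_norm s (u t) < +oo)%E /\
    (fun r => sobolev_norm s (u r \- u t)) @ within `[0, T]%classic (nbhs t)
      --> 0%E.

Definition continuous_in_C0 (T : R) (F : R -> E -> E) : Prop :=
  forall t, t \in `[0, T] ->
    continuous (F t) /\
    (fun r => sup_norm (F r \- F t)) @ within `[0, T]%classic (nbhs t)
      --> 0%E.

(* Mild solutions on [0, T] with smooth data h0. Since 0 `^ 4^-1 = 0, the two *)
(* weighted conditions contain the decay of the weighted norms as t --> 0+.   *)
Definition mild_solution (nu : R) (h0 : E -> R) (T : R) (h : R -> E -> R)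
    : Prop :=
  [/\ forall t, t \in `[0, T] -> torus_periodic (h t) /\ C1 (h t),
      continuous_in_sobolev (d%:R / 2) T h,
      continuous_in_C0 T (fun t x => t `^ 4^-1 *: gradient (h t) x),
      continuous_in_sobolev (d%:R / 2 + 1) T (fun t x => t `^ 4^-1 * h t x) &
      h 0 = h0 /\
      forall t x, t \in `]0, T] ->
        h t x = bilap_semigroup nu t h0 x +
          \int[lebesgue_measure]_(s in `[0, t])
            divergence (fun j => bilap_semigroup nu (t - s) (flux (h s) j)) x].

(* -oo if there is no solution at all. *)
Definition lifespan (nu : R) (h0 : E -> R) : \bar R :=
  ereal_sup [set T%:E | T in
    [set T : R | 0 < T /\ exists h, mild_solution nu h0 T h]].

(* The values of h at and beyond the lifespan are irrelevant. *)
Definition maximal_solution (nu : R) (h0 : E -> R) (h : R -> E -> R) : Prop :=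
  forall T : R, 0 < T -> (T%:E < lifespan nu h0)%E -> mild_solution nu h0 T h.

End torus.

(* Main.v *)
From HB Require Import structures.
Require Import Defs.
From mathcomp Require Import all_boot all_order all_algebra.
From mathcomp Require Import complex ring lra zify.
From mathcomp Require Import all_classical all_reals all_analysis.
From mathcomp Require Import measurable_realfun ess_sup_inf.

(** Why gradients grow. The data depend on one variable only and have slope
    (10/9) (cos y - cos (3 y) / 9) with y = N x_(i0). The third mode flattens the
    crests of the first, so the slope has maximum 80/81 although the first mode
    alone has amplitude 10/9. The bilaplacian damps the third mode 81 times faster
    than the first: at time 1 / (27 nu N^4) the two factors are exp (-1/27) and
    exp (-3), the flattening is gone while the first mode has hardly moved, and the
    linear flow has slope larger than 1.05 at the origin. The second-order part of
    the equation only contributes a relative amount of order 1 / (nu N^2), so for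
    large N the solution stays within 1/100 of the linear flow ([global_solution]).

    Existence. The slope v of the solution is a cosine series on the frequencies
    N l e_(i0), with coefficients u_k solving u_k' = - nu |k|^4 u_k - |k|^2 F_k,
    where F_k is the coefficient of v^3 - v. Coefficients bounded by a multiple of
    (1 + l^2)^-(d+1) form an algebra ([cbound_mul]) with constants independent of N,
    and solving the linear equation gains 1 / (nu |k|^2) <= 1 / (nu N^2). For large
    N the fixed point map is therefore a contraction uniformly on all of [0, +oo[
    ([picard_solution]), and the resulting function is a mild solution on every
    interval ([line_sol_mild]); in particular its lifespan is infinite.

    Uniqueness. The assertion is about every maximal solution, so any mild solution
    h must be shown to coincide with the one just built ([mild_unique]). A mild
    solution is only C^1 in space, with slope of size t^(-1/4), so everything is
    done on Fourier coefficients. Fubini's theorem in the Duhamel formula, where the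
    L^1 norm of div e^(-(t-s) Delta^2) F is at most of order (t-s)^(-1/4) s^(-3/4),
    gives the coefficients as integrals ([mean_duhamel]), and hence an ordinary
    differential equation for each of them ([is_derive_mild_cos],
    [is_derive_mild_sin]). The difference w of two solutions is measured by the mean
    of w times its n-th Fejer mean: this is a finite sum of squares of coefficients,
    which may be differentiated, and it tends to the mean of w^2. In its derivative
    the map p |-> |p|^2 p is monotone, which leaves + |grad w|^2; each mode satisfies
    - 2 nu |k|^4 + 2 |k|^2 <= 1 / (2 nu), so Gronwall's inequality applies up to an
    error that vanishes as n grows, uniformly on [t1, T]. Finally t1 tends to 0, where
    both solutions converge to the data in a Sobolev norm.

    For continuous periodic functions the essential supremum is the supremum
    ([le_grad_Linfty]), which turns the value of the slope at the origin into the
    claim about the L^oo norm. *)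

Set Implicit Arguments.
Unset Strict Implicit.
Unset Printing Implicit Defensive.

Import Order.TTheory GRing.Theory Num.Theory.
Import numFieldNormedType.Exports.

Local Open Scope classical_set_scope.
Local Open Scope ring_scope.

(** * Measurability and integrals of characters on the torus *)

Lemma continuous_sumr (R : realType) (T : topologicalType) (I : Type) (r : seq I)
    (P : pred I) (F : I -> T -> R) :
  (forall i, P i -> continuous (F i)) -> continuous (fun x => \sum_(i <- r | P i) F i x).
Proof.
move=> cF; elim: r => [|i r IH].
  by under eq_fun do rewrite big_nil; exact: cst_continuous.
under eq_fun do rewrite big_cons.
by case Pi: (P i) => // x; apply: continuousD; [exact: cF|exact: IH].
Qed.

Section Measurability.
Variables (R : realType) (d : nat).
Local Notation E := 'rV[R]_d.
Local Notation Tup := (d.-tuple (measurableTypeR R)).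

Definition grid_round (n : nat) (y : Tup) : E :=
  \row_j ((Num.floor ((tnth y j : R) * n.+1%:R))%:~R / n.+1%:R).

Lemma grid_round_cvg (y : Tup) : grid_round ^~ y @ \oo --> row_of_tuple y.
Proof.
apply/cvgrPdist_lt => e e0.
have [n0 hn0] : exists n0 : nat, e^-1 < n0%:R.
  by exists (Num.trunc e^-1).+1; rewrite truncnS_gt.
near=> n.
have hn : n.+1%:R^-1 < e.
  rewrite invf_plt ?posrE//; apply: lt_trans hn0 _; rewrite ltr_nat ltnS.
  by near: n; exists n0.
rewrite /Num.norm/= mx_normrE; apply/bigmax_ltP; split => // -[i j] _ /=.
rewrite !mxE; set a := (X in Num.floor (X * _)).
have [h1 h2] : (Num.floor (a * n.+1%:R))%:~R <= a * n.+1%:R /\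
   a * n.+1%:R < (Num.floor (a * n.+1%:R))%:~R + 1 :> R.
  by split; [exact: floor_le|rewrite -[X in _ + X](mulr1z 1) -intrD floorD1_gt].
have n0' : 0 < n.+1%:R :> R by [].
rewrite ger0_norm; last by rewrite subr_ge0 ler_pdivrMr.
apply: le_lt_trans hn.
by rewrite lerBlDr -[X in X + _]mul1r -mulrDl ler_pdivlMr// addrC ltW.
Unshelve. all: by end_near. Qed.

(** The product sigma-algebra is generated by coordinates, whereas continuity refers to
    the norm topology. Rounding the point to the grid of mesh 1 / (n + 1) makes [f] a
    countable combination of measurable cells, and these functions converge to [f]. *)
Lemma measurable_row_of_tuple (f : E -> R) : continuous f ->
  measurable_fun [set: Tup] (f \o @row_of_tuple R d).
Proof.
move=> cf.
apply: (@measurable_fun_cvg _ _ _ setT (fun n => f \o grid_round n)); last first.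
  by move=> y _; apply: continuous_cvg; [exact: cf|exact: grid_round_cvg].
move=> n _ B mB; rewrite setTI.
pose g (z : 'rV[int]_d) : E := \row_j ((z ord0 j)%:~R / n.+1%:R).
pose cell (z : 'rV[int]_d) : set Tup :=
  \bigcap_(j in [set: 'I_d]) [set y : Tup |
    Num.floor ((tnth y j : R) * n.+1%:R) = z ord0 j].
rewrite [X in measurable X](_ : _ =
  \bigcup_(z in [set: 'rV[int]_d]) (if f (g z) \in B then cell z else set0)).
  apply: countable_bigcupT_measurable => [|z]; first exact: countableP.
  case: ifP => // _; apply: fin_bigcap_measurable; [exact: finite_finset|move=> j _].
  have mj := @measurable_tnth _ (measurableTypeR R) d j.
  rewrite [X in measurable X](_ : _ = setT `&` (@tnth _ _ ^~ j) @^-1`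
     `[(z ord0 j)%:~R / n.+1%:R, ((z ord0 j)%:~R + 1) / n.+1%:R[%classic).
    exact: mj.
  rewrite setTI; apply/seteqP; split => y /=.
    move=> <-; rewrite in_itv/= ler_pdivrMr// floor_le/= ltr_pdivlMr//.
    by rewrite -[X in _ + X](mulr1z 1) -intrD floorD1_gt.
  rewrite in_itv/= ler_pdivrMr// ltr_pdivlMr// => h.
  by apply/floor_def; rewrite intrD mulr1z.
apply/seteqP; split => y /=.
  move=> By; exists (\row_j Num.floor ((tnth y j : R) * n.+1%:R)) => //.
  rewrite (_ : g _ = grid_round n y) ?mem_set//; last first.
    by apply/rowP => j; rewrite !mxE.
  by move=> j _ /=; rewrite mxE.
move=> [z _]; case: ifPn => // /set_mem Bz cz.
rewrite (_ : grid_round n y = g z)//.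
by apply/rowP => j; rewrite !mxE cz.
Qed.

End Measurability.

Section CharacterIntegrals.
Variable R : realType.

Lemma circle_integral (f : R -> R) : continuous f ->
  (\int[@circle_measure R]_y (f y)%:E =
   \int[lebesgue_measure]_(y in `[0%R, (2 * pi)%R]) (f y)%:E)%E.
Proof.
move=> cf; set D := `[0%R, (2 * pi)%R]%classic.
have mD : measurable (D : set (measurableTypeR R)) by exact: measurable_itv.
have mf : measurable_fun [set: measurableTypeR R] (EFin \o f).
  by apply/measurable_EFinP; exact: continuous_measurable_fun.
have D0 : circle_measure (~` D : set (measurableTypeR R)) = 0%E.
  by rewrite /circle_measure /mfrestr /mrestr setICl measure0.
rewrite -(setvU D) integral_setU//; last 3 first.
- exact: measurableC.
- by rewrite setvU.
- by apply/disj_setPLR.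
rewrite [X in (X + _)%E](null_set_integral (measurableC mD) _ D0); last first.
  exact: measurable_funTS.
rewrite add0e; apply: eq_measure_integral => A mA AD.
rewrite -[LHS]/(lebesgue_measure (A `&` D)).
by rewrite setIidl.
Qed.

Lemma integral_segment_ftc (f F : R -> R) (a b : R) : a < b -> continuous f ->
  (forall x : R, is_derive x (1 : R) F (f x)) ->
  (\int[lebesgue_measure]_(y in `[a, b]) (f y)%:E = (F b - F a)%:E)%E.
Proof.
move=> ab cf dF; rewrite (@continuous_FTC2 R f F)// ?EFinB//.
- exact: continuous_subspaceT.
- apply: (@derivable_oo_continuousW _ _ a b) => //.
  have cF : continuous F.
    by move=> x; apply/differentiable_continuous/derivable1_diffP; apply: ex_derive.
  split; first by move=> x _; apply: ex_derive.
    exact/cvg_at_right_filter/cF.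
  exact/cvg_at_left_filter/cF.
- by move=> x _; rewrite derive1E derive_val.
Qed.

Lemma is_derive_sin_affine (a b x : R) :
  is_derive x (1 : R) (fun y => sin (a * y + b)) (a * cos (a * x + b)).
Proof.
have h : is_derive x (1 : R) (fun y => a * y + b) a.
  have := @is_deriveD _ _ _ (fun y : R => a * y) (cst b) x 1 _ _ (@is_deriveZ _ _ _ (@id R) a x 1 _ (is_derive_id _ _)) (is_derive_cst _ _ _).
  by rewrite addr0 /GRing.scale/= mulr1.
have := @is_derive1_comp _ sin (fun y => a * y + b) x _ _ (is_derive_sin _) h.
by rewrite mulrC.
Qed.

Lemma is_derive_cos_affine (a b x : R) :
  is_derive x (1 : R) (fun y => cos (a * y + b)) (- (a * sin (a * x + b))).
Proof.
have h : is_derive x (1 : R) (fun y => a * y + b) a.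
  have := @is_deriveD _ _ _ (fun y : R => a * y) (cst b) x 1 _ _ (@is_deriveZ _ _ _ (@id R) a x 1 _ (is_derive_id _ _)) (is_derive_cst _ _ _).
  by rewrite addr0 /GRing.scale/= mulr1.
have := @is_derive1_comp _ cos (fun y => a * y + b) x _ _ (is_derive_cos _) h.
by rewrite mulrC mulrN.
Qed.

Lemma continuous_cos_affine (a b : R) : continuous (fun y : R => cos (a * y + b)).
Proof.
move=> x; apply/differentiable_continuous/derivable1_diffP.
by have := is_derive_cos_affine a b x => h; exact: ex_derive.
Qed.

Lemma integral_cos_circle (a : int) (b : R) :
  (\int[@circle_measure R]_y (cos (a%:~R * y + b))%:E =
   ((if a == 0 then 2 * pi * cos b else 0))%:E)%E.
Proof.
rewrite circle_integral; last exact: continuous_cos_affine.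
have pi2 : 0 < 2 * pi :> R by rewrite mulr_gt0// pi_gt0.
case: ifPn => [/eqP ->|a0].
  under eq_integral do rewrite mul0r add0r.
  have mI : measurable (`[0%R, (2 * pi)%R]%classic : set (measurableTypeR R)).
    exact: measurable_itv.
  have lI : lebesgue_measure (`[0%R, (2 * pi)%R]%classic : set (measurableTypeR R))
      = (2 * pi)%:E.
    by rewrite lebesgue_measure_itv/= lte_fin pi2 oppr0 adde0.
  transitivity ((cos b)%:E * (2 * pi)%:E)%E; last by rewrite -EFinM mulrC.
  by rewrite -lI -integral_cst.
have aR : a%:~R != 0 :> R by rewrite intr_eq0.
pose F (y : R) := (a%:~R)^-1 * sin (a%:~R * y + b).
have dF (x : R) : is_derive x (1 : R) F (cos (a%:~R * x + b)).
  have := @is_deriveZ _ _ _ _ (a%:~R^-1) x 1 _ (is_derive_sin_affine a%:~R b x).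
  by rewrite /GRing.scale/= mulKf.
rewrite (@integral_segment_ftc _ F)//{dF}/F; last exact: continuous_cos_affine.
congr (_%:E); rewrite mulr0 add0r -mulrBr.
have -> : a%:~R * (2 * pi) + b = b + a%:~R * (pi *+ 2) :> R.
  by rewrite addrC mulr_natl.
suff -> : sin (b + a%:~R * (pi *+ 2)) = sin b by rewrite subrr mulr0.
have pos (n : nat) c : sin (c + n%:R * (pi *+ 2)) = sin c :> R.
  by rewrite mulr_natl; exact: (periodicn (@sinD2pi R)).
case: (a) => n; first exact: pos.
by rewrite NegzE mulrNz mulNr -(pos n.+1 (b - _)) subrK.
Qed.

Lemma continuous_cos_dot d (k : 'I_d -> int) (b : R) :
  continuous (fun x : 'rV[R]_d => cos (\sum_j (k j)%:~R * x ord0 j + b)).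
Proof.
move=> x; apply: (@continuous_comp _ _ _
  (fun x : 'rV[R]_d => \sum_j (k j)%:~R * x ord0 j + b) cos).
  apply: continuousD; last exact: cst_continuous.
  apply: continuous_sumr => j _ y.
  by apply: continuousM; [exact: cst_continuous|exact: coord_continuous].
exact: continuous_cos.
Qed.

Lemma measurable_cos_torus d (k : 'I_d -> int) (b : R) :
  measurable_fun [set: d.-tuple (measurableTypeR R)]
    (fun y => cos (\sum_j (k j)%:~R * (tnth y j : R) + b)).
Proof.
rewrite (_ : (fun _ => _) = (fun x : 'rV[R]_d =>
  cos (\sum_j (k j)%:~R * x ord0 j + b)) \o @row_of_tuple R d).
  by apply: measurable_row_of_tuple; exact: continuous_cos_dot.
apply/funext => y /=; congr (cos (_ + _)).
by apply: eq_bigr => j _; rewrite mxE.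
Qed.

(** By induction on the dimension: integrating out the first variable multiplies the
    remaining cosine by 2 pi if its frequency vanishes and kills it otherwise. *)
Lemma integral_cos_torus d (k : 'I_d -> int) (b : R) :
  (\int[torus_measure R d]_y
      (cos (\sum_j (k j)%:~R * (tnth y j : R) + b))%:E =
   ((if [forall j, k j == 0] then (2 * pi) ^+ d * cos b else 0))%:E)%E.
Proof.
elim: d => [|d IH] in k b *.
  rewrite -[LHS]/(\int[\d_([tuple] : 0.-tuple (measurableTypeR R))]_y
      (cos (\sum_j (k j)%:~R * (tnth y j : R) + b))%:E)%E.
  rewrite integral_dirac//; last first.
    by apply/measurable_EFinP; exact: measurable_cos_torus.
  rewrite diracT mul1e big_ord0 add0r.
  by case: ifPn => [_|/forallPn[[]//]]; rewrite expr0 mul1r.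
pose tc (p : measurableTypeR R * d.-tuple (measurableTypeR R)) :
  d.+1.-tuple (measurableTypeR R) := [the d.+1.-tuple _ of p.1 :: p.2].
have mtc : measurable_fun setT tc by exact: measurable_cons.
pose f (y : d.+1.-tuple (measurableTypeR R)) : R :=
  cos (\sum_j (k j)%:~R * (tnth y j : R) + b).
have mf : measurable_fun setT (EFin \o f).
  by apply/measurable_EFinP; exact: measurable_cos_torus.
have ftc (p : measurableTypeR R * d.-tuple (measurableTypeR R)) :
    f (tc p) = cos (\sum_j (k (lift ord0 j))%:~R * (tnth p.2 j : R) + ((k ord0)%:~R * p.1 + b)).
  rewrite /f big_ord_recl/= [X in cos (X + _)]addrC -addrA; congr (cos (_ + _)).
  by apply: eq_bigr => j _; congr (_ * _); rewrite /tc tnthS.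
have mftc : measurable_fun setT (EFin \o (f \o tc)).
  exact: (measurableT_comp mf mtc).
have iftc : (@circle_measure R \x torus_measure R d)%E.-integrable setT (EFin \o (f \o tc)).
  apply: measurable_bounded_integrable => //.
  - rewrite [ltLHS](_ : _ = (@circle_measure R \x torus_measure R d)%E (setT `*` setT)); last by rewrite setXTT.
    rewrite product_measure1E//.
    by rewrite lte_mul_pinfty ?fin_num_measure// ltey_eq fin_num_measure.
  - exact/measurable_EFinP.
  - exists 1; split => // M M1 p _ /=; apply: le_trans (ltW M1).
    by rewrite ler_norml cos_geN1 cos_le1.
rewrite -[LHS]/(\int[pushforward (@circle_measure R \x torus_measure R d)%E tc]_y (f y)%:E)%E.
rewrite integral_pushforward// preimage_setT.
rewrite -(integral12_prod_meas1 iftc)/=.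
transitivity (\int[@circle_measure R]_x (if [forall j, k (lift ord0 j) == 0] then
  (2 * pi) ^+ d * cos ((k ord0)%:~R * x + b) else 0)%:E)%E.
  apply: eq_integral => x _; rewrite -IH; apply: eq_integral => y _.
  by congr (_%:E); exact: ftc.
have -> : [forall j, k j == 0] = (k ord0 == 0) && [forall j, k (lift ord0 j) == 0].
  apply/forallP/andP => [h|[h0 /forallP h] j]; first by split => //; apply/forallP => j.
  by case: (unliftP ord0 j) => [i ->|->].
case: [forall j, _]; rewrite ?andbT ?andbF; last exact: integral0.
rewrite -[X in X = _]/(\int[@circle_measure R]_x (((2 * pi) ^+ d)%:E * (cos ((k ord0)%:~R * x + b))%:E))%E.
rewrite integralZl//=.
  rewrite integral_cos_circle -EFinM; congr (_%:E).
  by case: ifP => _; rewrite ?mulr0// exprSr; ring.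
apply: measurable_bounded_integrable => //.
- by rewrite ltey_eq fin_num_measure.
- by apply: continuous_measurable_fun; exact: continuous_cos_affine.
- exists 1; split => // M M1 p _ /=; apply: le_trans (ltW M1).
  by rewrite ler_norml cos_geN1 cos_le1.
Qed.

End CharacterIntegrals.

(** * Continuous periodic functions and their means *)

Section TorusFunctions.
Variables (R : realType) (d : nat).
Local Notation E := 'rV[R]_d.

Definition ctorus (f : E -> R) := continuous f /\ torus_periodic f.

Lemma torus_periodic_shift (f : E -> R) (m : 'I_d -> int) (x : E) :
  torus_periodic f -> f (x + \row_j (2 * pi * (m j)%:~R)) = f x.
Proof.
move=> pf.
have step (j : 'I_d) (n : int) (y : E) :
    f (y + (2 * pi * n%:~R) *: delta_mx ord0 j) = f y.
  have nat_step (i : nat) z : f (z + (2 * pi * i%:R) *: delta_mx ord0 j) = f z.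
    by rewrite mulr_natr -scalerMnl; exact: (periodicn (pf j)).
  case: n => n; first exact: nat_step.
  by rewrite NegzE mulrNz mulrN scaleNr -[LHS](nat_step n.+1) subrK.
rewrite [X in x + X]row_sum_delta.
elim: (index_enum _) => [|j r IH]; first by rewrite big_nil addr0.
by rewrite big_cons mxE [X in x + X]addrC addrA step IH.
Qed.

(** Every point is a period away from the compact box [-pi, pi]^d, so continuous periodic
    functions inherit boundedness and uniform continuity from that box. *)
Lemma box_representative (x : E) :
  exists m : 'I_d -> int, forall j,
    -pi <= (x + \row_j (2 * pi * (m j)%:~R)) ord0 j <= pi.
Proof.
have pi2 : 0 < 2 * pi :> R by rewrite mulr_gt0// pi_gt0.
exists (fun j => - Num.floor ((x ord0 j + pi) / (2 * pi))) => j.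
rewrite !mxE; set a := (_ / _).
have h1 : (Num.floor a)%:~R <= a by exact: floor_le.
have h2 : a < (Num.floor a)%:~R + 1 by rewrite -[X in _ + X](mulr1z 1) -intrD floorD1_gt.
have ax : a * (2 * pi) = x ord0 j + pi by rewrite divfK// gt_eqF.
have k1 : (Num.floor a)%:~R * (2 * pi) <= a * (2 * pi) by rewrite ler_pM2r.
have k2 : a * (2 * pi) < ((Num.floor a)%:~R + 1) * (2 * pi) by rewrite ltr_pM2r.
rewrite mulrNz mulrN; apply/andP; split; lra.
Qed.

Definition pi_box : set E := [set v | forall j, `[-pi, pi]%classic (v ord0 j)].

Lemma compact_pi_box : compact pi_box.
Proof. by apply: (@rV_compact R d (fun=> `[-pi, pi]%classic)) => j; exact: segment_compact. Qed.

Lemma ctorus_bounded f : ctorus f -> exists M : R, forall x, `|f x| <= M.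
Proof.
move=> [cf pf].
have := compact_bounded (continuous_compact (continuous_subspaceT cf) compact_pi_box).
move=> [M [_ hM]]; exists (`|M| + 1) => x.
have [m hm] := box_representative x.
rewrite -(torus_periodic_shift m x pf).
have M1 : M < `|M| + 1 by rewrite ltr_pwDr// ler_norm.
apply: (hM _ M1); exists (x + \row_j (2 * pi * (m j)%:~R)) => //.
Qed.

Lemma ctorus_cst c : ctorus (cst c).
Proof. by split; [exact: cst_continuous|move=> j u]. Qed.

Lemma ctorusD f g : ctorus f -> ctorus g -> ctorus (fun x => f x + g x).
Proof.
move=> [cf pf] [cg pg]; split; first by move=> x; apply: continuousD; [exact: cf|exact: cg].
by move=> j u; rewrite pf pg.
Qed.

Lemma ctorusM f g : ctorus f -> ctorus g -> ctorus (fun x => f x * g x).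
Proof.
move=> [cf pf] [cg pg]; split; first by move=> x; apply: continuousM; [exact: cf|exact: cg].
by move=> j u; rewrite pf pg.
Qed.

Lemma ctorusN f : ctorus f -> ctorus (fun x => - f x).
Proof.
move=> [cf pf]; split; first by move=> x; apply: continuousN; exact: cf.
by move=> j u; rewrite pf.
Qed.

Lemma ctorusB f g : ctorus f -> ctorus g -> ctorus (fun x => f x - g x).
Proof. by move=> cf cg; apply: (ctorusD cf); exact: ctorusN. Qed.

Lemma ctorusZ c f : ctorus f -> ctorus (fun x => c * f x).
Proof. by move=> cf; apply: ctorusM => //; exact: ctorus_cst. Qed.

Lemma ctorusX f n : ctorus f -> ctorus (fun x => f x ^+ n).
Proof.
move=> cf; elim: n => [|n IH].
  by under eq_fun do rewrite expr0; exact: ctorus_cst.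
by under eq_fun do rewrite exprS; exact: ctorusM.
Qed.

Lemma ctorus_norm f : ctorus f -> ctorus (fun x => `|f x|).
Proof.
move=> [cf pf]; split; last by move=> j u; rewrite pf.
by move=> x; apply: (continuous_comp (cf x)); exact: norm_continuous.
Qed.

Lemma ctorus_sum (I : Type) (r : seq I) (P : pred I) (F : I -> E -> R) :
  (forall i, P i -> ctorus (F i)) -> ctorus (fun x => \sum_(i <- r | P i) F i x).
Proof.
move=> cF; split; first by apply: continuous_sumr => i /cF[].
by move=> j u; apply: eq_bigr => i /cF[_ ->].
Qed.

Lemma cosD2pin (a : R) (n : int) : cos (a + n%:~R * (2 * pi)) = cos a.
Proof.
have pos (m : nat) c : cos (c + m%:R * (2 * pi)) = cos c :> R.
  by rewrite ![_ * _]mulr_natl; exact: (periodicn (@cosD2pi R)).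
case: n => n; first exact: pos.
by rewrite NegzE mulrNz mulNr -(pos n.+1 (a - _)) subrK.
Qed.

Lemma freq_dotE k (x : E) : freq_dot k x = \sum_j (k ord0 j)%:~R * x ord0 j.
Proof. by []. Qed.

Lemma freq_dotD k (x y : E) : freq_dot k (x + y) = freq_dot k x + freq_dot k y.
Proof. by rewrite /freq_dot -big_split; apply: eq_bigr => j _; rewrite mxE mulrDr. Qed.

Lemma freq_dotZ k c (x : E) : freq_dot k (c *: x) = c * freq_dot k x.
Proof. by rewrite /freq_dot mulr_sumr; apply: eq_bigr => j _; rewrite mxE mulrCA. Qed.

Lemma freq_dot_basis (k : 'rV[int]_d) (j : 'I_d) : freq_dot k (basis_vec R j) = (k ord0 j)%:~R.
Proof.
rewrite /freq_dot (bigD1 j)//= big1 ?addr0 => [|i ij].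
  by rewrite !mxE !eqxx mulr1.
by rewrite !mxE eqxx/= (negbTE ij) mulr0.
Qed.

Lemma ctorus_cos k (b : R) : ctorus (fun x => cos (freq_dot k x + b)).
Proof.
split; first by have := @continuous_cos_dot R d (fun j => k ord0 j) b.
move=> j u; by rewrite freq_dotD freq_dotZ freq_dot_basis addrAC [2 * pi * _]mulrC cosD2pin.
Qed.

Lemma ctorus_unif_continuous f : ctorus f -> forall e : R, 0 < e ->
  exists2 del : R, 0 < del & forall x y : E,
    (forall j, `|x ord0 j - y ord0 j| < del) -> `|f x - f y| < e.
Proof.
move=> [cf pf] e e0.
have /compact_near_coveringP nc := compact_pi_box.
have := nc R (0^'+) (fun (del : R) (x : E) => forall y : E,
    (forall j, `|x ord0 j - y ord0 j| < del) -> `|f x - f y| < e).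
have h : forall x, pi_box x -> \forall x' \near x & i \near 0^'+,
    (fun (del : R) (x : E) => forall y : E,
    (forall j, `|x ord0 j - y ord0 j| < del) -> `|f x - f y| < e) i x'.
  move=> x _.
  have /cvgrPdist_lt/(_ (e / 2)) := cf x.
  rewrite divr_gt0// => /(_ isT)/nbhs_ballP[r /= r0 hr].
  exists (ball x (r / 2), [set del | del < r / 2]).
    split => /=; first by apply: nbhsx_ballx; rewrite divr_gt0.
    by apply: nbhs_right_lt; rewrite divr_gt0.
  move=> [x' del] /= [[_ bx] dr] y xy.
  have h1 : `|f x - f x'| < e / 2.
    apply: hr; split => // i j; apply: lt_trans (bx i j) _.
    by rewrite ltr_pdivrMr// ltr_pMr// ltr1n.
  have h2 : `|f x - f y| < e / 2.
    apply: hr; split => // i j; rewrite !ord1.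
    have := bx ord0 j; have := xy j; rewrite /ball/=.
    have := ler_distD (x' ord0 j) (x ord0 j) (y ord0 j); lra.
  have := ler_distD (f x) (f x') (f y); rewrite [`|f x' - f x|]distrC; lra.
move=> /(_ _ h){h}hnear.
have [del [del0 hdel]] : exists del : R, 0 < del /\ forall x, pi_box x -> forall y : E,
    (forall j, `|x ord0 j - y ord0 j| < del) -> `|f x - f y| < e.
  near (0 : R)^'+ => del; exists del; split => //.
  by near: del.
exists del => // x y xy.
have [m hm] := box_representative x.
rewrite -(torus_periodic_shift m x pf) -(torus_periodic_shift m y pf).
apply: hdel => [j|j]; first by rewrite /= in_itv/=; exact: hm.
by have := xy j; rewrite !mxE opprD addrACA subrr addr0.
Unshelve. all: by end_near. Qed.

(** The modulus of continuity is expressed by [1 - cos], which is periodic and is the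
    quantity that the Fejer kernel integrates to exactly [1 / n]: see [fejer_error]. Where
    the points are far apart modulo periods the second term dominates [2 sup |f|]. *)
Lemma ctorus_modulus f : ctorus f -> forall e : R, 0 < e ->
  exists2 C : R, 0 <= C & forall x y : E,
    `|f x - f y| <= e + C * \sum_j (1 - cos (x ord0 j - y ord0 j)).
Proof.
move=> ctf e e0; have [cf pf] := ctf.
have [M hM] := ctorus_bounded ctf.
have [del0 del00 hdel0] := ctorus_unif_continuous ctf e0.
pose del := Num.min del0 1.
have del_gt0 : 0 < del by rewrite lt_min del00 ltr01.
have hdel (x y : E) : (forall j, `|x ord0 j - y ord0 j| < del) -> `|f x - f y| < e.
  by move=> h; apply: hdel0 => j; apply: lt_le_trans (h j) _; rewrite ge_min lexx.
have del_pi : del < pi by apply: le_lt_trans (_ : 1 < _); [rewrite ge_min lexx orbT|have := pi_ge2 R; lra].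
have cdel : 0 < 1 - cos del.
  rewrite subr_gt0 -(@cos0 R) ltr_cos// in_itv/= ?lexx ?pi_ge0//.
  by rewrite (ltW del_gt0) (ltW del_pi).
have M0 : 0 <= M by apply: le_trans (hM 0).
exists (2 * M / (1 - cos del)); first by rewrite divr_ge0 ?mulr_ge0// ltW.
move=> x y.
have [m hm] := box_representative (x - y).
have fyE := torus_periodic_shift (fun j => - m j) y pf.
rewrite -fyE; set y' := y + _.
have xy' j : (x - y + \row_j (2 * pi * (m j)%:~R)) ord0 j = x ord0 j - y' ord0 j.
  by rewrite !mxE mulrNz mulrN opprD opprK addrA.
have cE j : cos (x ord0 j - y ord0 j) = cos (x ord0 j - y' ord0 j).
  by rewrite -xy' !mxE [2 * pi * _]mulrC cosD2pin.
have s0 : 0 <= \sum_j (1 - cos (x ord0 j - y ord0 j)).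
  by apply: sumr_ge0 => j _; rewrite subr_ge0 cos_le1.
have [small|] := pselect (forall j, `|x ord0 j - y' ord0 j| < del).
  apply: le_trans (ltW (hdel _ _ small)) _; rewrite lerDl mulr_ge0//.
  by rewrite divr_ge0 ?mulr_ge0// ltW.
move=> /existsNP[j /negP]; rewrite -leNgt => hj.
have fle : `|f x - f y'| <= 2 * M.
  by have := ler_normB (f x) (f y'); have := hM x; have := hM y'; lra.
apply: le_trans fle _; apply: le_trans (_ : 2 * M / (1 - cos del) * (1 - cos (x ord0 j - y ord0 j)) <= _).
  rewrite -mulrA ler_peMr ?mulr_ge0// mulrC ler_pdivlMr// mul1r lerB//.
  rewrite cE -cos_norm; have := hm j; rewrite xy' => /andP[h1 h2].
  have hpi : `|x ord0 j - y' ord0 j| <= pi by rewrite ler_norml h1.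
  have [->//|ne] := eqVneq (`|x ord0 j - y' ord0 j|) del.
  rewrite ltW// ltr_cos ?in_itv/= ?(ltW del_gt0) ?(ltW del_pi) ?normr_ge0//.
  by rewrite lt_neqAle eq_sym ne.
apply: le_trans (_ : _ <= 2 * M / (1 - cos del) * \sum_j (1 - cos (x ord0 j - y ord0 j))) _; last by rewrite lerDr ltW.
apply: ler_wpM2l; first by rewrite divr_ge0 ?mulr_ge0// ltW.
rewrite (bigD1 j)//= lerDl; apply: sumr_ge0 => i _; by rewrite subr_ge0 cos_le1.
Qed.

Definition mean (f : E -> R) : R := (2 * pi) ^- d * torus_integral f.

Let pi2d : 0 < (2 * pi) ^+ d :> R.
Proof. by rewrite exprn_gt0// mulr_gt0// pi_gt0. Qed.

Lemma integrable_ctorus f : ctorus f ->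
  (torus_measure R d).-integrable setT (EFin \o (fun y => f (row_of_tuple y))).
Proof.
move=> ctf; apply: measurable_bounded_integrable => //.
- by rewrite ltey_eq fin_num_measure.
- by apply: (measurable_row_of_tuple (f := f)); case: ctf.
- have [M hM] := ctorus_bounded ctf.
  by exists M; split; [exact: num_real|] => M' MM' y _; apply: le_trans (hM _) (ltW MM').
Qed.

Lemma meanD f g : ctorus f -> ctorus g ->
  mean (fun x => f x + g x) = mean f + mean g.
Proof.
by move=> cf cg; rewrite /mean -mulrDr -RintegralD//; exact: integrable_ctorus.
Qed.

Lemma meanZ c f : ctorus f -> mean (fun x => c * f x) = c * mean f.
Proof.
move=> cf; rewrite /mean mulrCA; congr (_ * _).
by rewrite -RintegralZl//; exact: integrable_ctorus.
Qed.

Lemma meanN f : ctorus f -> mean (fun x => - f x) = - mean f.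
Proof.
by move=> cf; rewrite -[RHS]mulN1r -meanZ//; congr mean; apply/funext => x; rewrite mulN1r.
Qed.

Lemma meanB f g : ctorus f -> ctorus g ->
  mean (fun x => f x - g x) = mean f - mean g.
Proof. by move=> cf cg; rewrite -meanN// -meanD//; exact: ctorusN. Qed.

Lemma mean_cos (k : 'rV[int]_d) (b : R) :
  mean (fun x => cos (freq_dot k x + b)) = if k == 0 then cos b else 0.
Proof.
rewrite /mean /torus_integral /Rintegral.
have -> : (k == 0) = [forall j, k ord0 j == 0].
  apply/eqP/forallP => [-> j|h]; first by rewrite mxE.
  by apply/rowP => j; rewrite mxE; exact/eqP.
have := integral_cos_torus (fun j => k ord0 j) b.
have fdE (y : d.-tuple (measurableTypeR R)) :
    freq_dot k (row_of_tuple y) = \sum_j (k ord0 j)%:~R * (tnth y j : R).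
  by apply: eq_bigr => j _; rewrite mxE.
under [in X in _ -> X]eq_integral do rewrite fdE.
move=> ->; case: ifP => _ /=; last by rewrite mulr0.
by rewrite mulKf// gt_eqF.
Qed.

Lemma mean_cst c : mean (fun=> c) = c.
Proof.
transitivity (mean (fun x : E => c * cos (freq_dot 0 x + 0))).
  congr mean; apply/funext => x; rewrite /freq_dot big1 ?addr0 ?cos0 ?mulr1// => j _.
  by rewrite mxE mul0r.
by rewrite meanZ ?mean_cos ?eqxx ?cos0 ?mulr1//; exact: ctorus_cos.
Qed.

Lemma mean_sum (I : Type) (r : seq I) (P : pred I) (F : I -> E -> R) :
  (forall i, P i -> ctorus (F i)) ->
  mean (fun x => \sum_(i <- r | P i) F i x) = \sum_(i <- r | P i) mean (F i).
Proof.
move=> cF; elim: r => [|i r IH].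
  by rewrite big_nil; under eq_fun do rewrite big_nil; exact: mean_cst.
rewrite big_cons; under eq_fun do rewrite big_cons.
case Pi : (P i) => //; rewrite meanD ?IH//; first exact: cF.
exact: ctorus_sum.
Qed.

Lemma le_mean f g : ctorus f -> ctorus g -> (forall x, f x <= g x) -> mean f <= mean g.
Proof.
move=> cf cg fg; rewrite ler_pM2l ?invr_gt0//.
by apply: le_Rintegral => //; exact: integrable_ctorus.
Qed.

Lemma mean_ge0 f : ctorus f -> (forall x, 0 <= f x) -> 0 <= mean f.
Proof. by move=> cf f0; rewrite -[leLHS](mean_cst 0); apply: le_mean => //; exact: ctorus_cst. Qed.

Lemma normr_mean_le f M : ctorus f -> (forall x, `|f x| <= M) -> `|mean f| <= M.
Proof.
move=> cf hM.
have h1 : mean (fun=> - M) <= mean f.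
  by apply: le_mean => // [|x]; [exact: ctorus_cst|have := hM x; rewrite ler_norml => /andP[]].
have h2 : mean f <= mean (fun=> M).
  by apply: le_mean => // [|x]; [exact: ctorus_cst|have := hM x; rewrite ler_norml => /andP[]].
by rewrite ler_norml -(mean_cst (- M)) h1 -[leRHS]mean_cst h2.
Qed.

End TorusFunctions.

(** * Fejer means *)

Section Fejer.
Variables (R : realType) (d : nat).
Local Notation E := 'rV[R]_d.
Local Notation ctorus := (@ctorus R d).

Definition cos_coef (f : E -> R) (k : 'rV[int]_d) : R :=
  mean (fun x => f x * cos (freq_dot k x)).
Definition sin_coef (f : E -> R) (k : 'rV[int]_d) : R :=
  mean (fun x => f x * sin (freq_dot k x)).

Lemma ctorus_cos0 k : ctorus (fun x => cos (freq_dot k x)).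
Proof. by have := ctorus_cos k (0 : R); under eq_fun do rewrite addr0. Qed.

Lemma cos_subpihalf (a : R) : cos (a - pi / 2) = sin a.
Proof. by rewrite cosB cos_pihalf sin_pihalf mulr0 add0r mulr1. Qed.

Lemma ctorus_sin k : ctorus (fun x => sin (freq_dot k x)).
Proof.
by have := ctorus_cos k (- (pi / 2) : R); under eq_fun do rewrite cos_subpihalf.
Qed.

Lemma freq_dotB k (x y : E) : freq_dot k (x - y) = freq_dot k x - freq_dot k y.
Proof. by rewrite freq_dotD -[- y]scaleN1r freq_dotZ mulN1r. Qed.

Lemma freq_dotBl k l (x : E) : freq_dot (k - l) x = freq_dot k x - freq_dot l x.
Proof.
rewrite /freq_dot -sumrB; apply: eq_bigr => j _.
by rewrite !mxE rmorphB/= mulrBl.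
Qed.

Lemma freq_dotDl k l (x : E) : freq_dot (k + l) x = freq_dot k x + freq_dot l x.
Proof.
rewrite /freq_dot -big_split; apply: eq_bigr => j _.
by rewrite !mxE rmorphD/= mulrDl.
Qed.

Definition grid n := {ffun 'I_d -> 'I_n}.
Definition grid_freq n (a : grid n) : 'rV[int]_d := \row_j (a j : nat)%:Z.

Definition gridN n : R := (n ^ d)%N%:R.

(** The sum over pairs of points of a grid is the Fejer mean: its kernel is the squared
    modulus of a sum of exponentials, hence nonnegative, and the pairing of [f] with its
    own mean is a sum of squares of coefficients. *)
Definition fejer n (f : E -> R) (x : E) : R :=
  (gridN n)^-1 * \sum_(a : grid n) \sum_(b : grid n)
    (cos_coef f (grid_freq a - grid_freq b) * cos (freq_dot (grid_freq a - grid_freq b) x) +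
     sin_coef f (grid_freq a - grid_freq b) * sin (freq_dot (grid_freq a - grid_freq b) x)).

Definition fejer_kernel n (z : E) : R :=
  (gridN n)^-1 * \sum_(a : grid n) \sum_(b : grid n)
    cos (freq_dot (grid_freq a - grid_freq b) z).

Lemma gridN_gt0 n : 0 < gridN n.+1.
Proof. by rewrite ltr0n expn_gt0. Qed.

Lemma card_grid n : #|grid n| = (n ^ d)%N.
Proof. by rewrite card_ffun !card_ord. Qed.

Lemma fejer_kernel_ge0 n z : 0 <= fejer_kernel n z.
Proof.
rewrite mulr_ge0 ?invr_ge0 ?ler0n//.
rewrite (_ : \sum_a _ = (\sum_(a : grid n) cos (freq_dot (grid_freq a) z)) ^+ 2 +
  (\sum_(a : grid n) sin (freq_dot (grid_freq a) z)) ^+ 2); first by rewrite addr_ge0 ?sqr_ge0.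
rewrite !expr2 !mulr_suml -big_split; apply: eq_bigr => a _.
rewrite !mulr_sumr -big_split; apply: eq_bigr => b _ /=.
by rewrite freq_dotBl cosB.
Qed.

Lemma ctorus_reflect k (x : E) b : ctorus (fun y => cos (freq_dot k (x - y) + b)).
Proof.
have := ctorus_cos k (- (freq_dot k x) - b); congr ctorus; apply/funext => y.
rewrite -cosN; congr cos.
by rewrite freq_dotB; ring.
Qed.

Lemma ctorus_reflect0 k (x : E) : ctorus (fun y => cos (freq_dot k (x - y))).
Proof. by have := ctorus_reflect k x 0; under eq_fun do rewrite addr0. Qed.

Lemma mean_reflect k (x : E) : mean (fun y => cos (freq_dot k (x - y))) = (k == 0)%:R.
Proof.
have -> : (fun y => cos (freq_dot k (x - y))) = (fun y => cos (freq_dot k y + - freq_dot k x)).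
  apply/funext => y; rewrite -cosN; congr cos.
  by rewrite freq_dotB; ring.
rewrite mean_cos; case: eqP => // ->.
rewrite (_ : freq_dot 0 x = 0) ?oppr0 ?cos0//.
by rewrite /freq_dot big1// => j _; rewrite mxE mul0r.
Qed.

Lemma ctorus_fejer_kernel n x : ctorus (fun y => fejer_kernel n (x - y)).
Proof.
apply: ctorusZ; apply: ctorus_sum => a _; apply: ctorus_sum => b _.
exact: ctorus_reflect0.
Qed.

Lemma grid_freq_inj n : injective (@grid_freq n).
Proof.
move=> a b /rowP ab; apply/ffunP => j; have := ab j; rewrite !mxE => -[].
exact: val_inj.
Qed.

Lemma mean_fejer_kernel n x : mean (fun y => fejer_kernel n.+1 (x - y)) = 1.
Proof.
rewrite meanZ; last by apply: ctorus_sum => a _; apply: ctorus_sum => b _; exact: ctorus_reflect0.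
rewrite mean_sum; last by move=> a _; apply: ctorus_sum => b _; exact: ctorus_reflect0.
rewrite (eq_bigr (fun=> 1)) => [|a _].
  by rewrite sumr_const card_grid mulVf// gt_eqF// gridN_gt0.
rewrite mean_sum => [|b _]; last exact: ctorus_reflect0.
rewrite (bigD1 a)//= mean_reflect subrr eqxx big1 ?addr0// => b ba.
rewrite mean_reflect subr_eq0; case: eqP => // /grid_freq_inj ab.
by rewrite ab eqxx in ba.
Qed.

Lemma fejerE n f x : ctorus f ->
  fejer n f x = mean (fun y => f y * fejer_kernel n (x - y)).
Proof.
move=> cf.
transitivity (mean (fun y => (gridN n)^-1 * \sum_(a : grid n) \sum_(b : grid n)
    (f y * cos (freq_dot (grid_freq a - grid_freq b) (x - y))))); last first.
  congr mean; apply/funext => y; rewrite mulrCA; congr (_ * _).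
  by rewrite mulr_sumr; apply: eq_bigr => a _; rewrite mulr_sumr.
have ct k : ctorus (fun y => f y * cos (freq_dot k (x - y))).
  by apply: ctorusM => //; exact: ctorus_reflect0.
rewrite meanZ; last by apply: ctorus_sum => a _; apply: ctorus_sum => b _.
congr (_ * _); rewrite mean_sum => [|a _]; last by apply: ctorus_sum.
apply: eq_bigr => a _; rewrite mean_sum//; apply: eq_bigr => b _.
set k := grid_freq a - _.
rewrite /cos_coef /sin_coef mulrC [X in _ + X]mulrC -!meanZ; last 2 first.
- by apply: ctorusM => //; exact: ctorus_sin.
- by apply: ctorusM => //; exact: ctorus_cos0.
rewrite -meanD; last 2 first.
- by apply: ctorusZ; apply: ctorusM => //; exact: ctorus_cos0.
- by apply: ctorusZ; apply: ctorusM => //; exact: ctorus_sin.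
congr mean; apply/funext => y.
by rewrite freq_dotB cosB; ring.
Qed.

Definition unit_freq (j : 'I_d) : 'rV[int]_d := delta_mx ord0 j.

(** Multiplying the kernel by [cos] shifts one frequency by one unit; the mean then counts
    the pairs of grid points that differ by that unit, a fraction [n / (n + 1)] of all. *)
Lemma mean_cos_fejer_kernel n (x : E) j :
  mean (fun y => cos (x ord0 j - y ord0 j) * fejer_kernel n.+1 (x - y)) = 1 - n.+1%:R^-1.
Proof.
have dotu (z : E) : freq_dot (unit_freq j) z = z ord0 j.
  rewrite /freq_dot (bigD1 j)//= big1 ?addr0 => [|i ij].
    by rewrite !mxE !eqxx mul1r.
  by rewrite !mxE eqxx (negbTE ij) mul0r.
transitivity (mean (fun y => (gridN n.+1)^-1 * \sum_(a : grid n.+1) \sum_(b : grid n.+1)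
    (2^-1 * cos (freq_dot (grid_freq a - grid_freq b + unit_freq j) (x - y)) +
     2^-1 * cos (freq_dot (grid_freq a - grid_freq b - unit_freq j) (x - y))))).
  congr mean; apply/funext => y; rewrite mulrCA; congr (_ * _).
  rewrite mulr_sumr; apply: eq_bigr => a _; rewrite mulr_sumr; apply: eq_bigr => b _.
  have -> : x ord0 j - y ord0 j = freq_dot (unit_freq j) (x - y) by rewrite dotu !mxE.
  move: (grid_freq a - grid_freq b) => k.
  by rewrite freq_dotDl freq_dotBl cosD cosB; field.
have ct k : ctorus (fun y => 2^-1 * cos (freq_dot k (x - y))).
  by apply: ctorusZ; exact: ctorus_reflect0.
rewrite meanZ; last first.
  by apply: ctorus_sum => a _; apply: ctorus_sum => b _; exact: ctorusD.
rewrite mean_sum => [|a _]; last by apply: ctorus_sum => b _; exact: ctorusD.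
pose cnt : R := \sum_(a : grid n.+1) \sum_(b : grid n.+1)
   (grid_freq a == grid_freq b + unit_freq j)%:R.
transitivity ((gridN n.+1)^-1 * cnt).
  congr (_ * _).
  transitivity (\sum_(a : grid n.+1) \sum_(b : grid n.+1)
     (2^-1 * (grid_freq b == grid_freq a + unit_freq j)%:R +
      2^-1 * (grid_freq a == grid_freq b + unit_freq j)%:R) : R).
    apply: eq_bigr => a _; rewrite mean_sum => [|b _]; last exact: ctorusD.
    apply: eq_bigr => b _; rewrite meanD// !meanZ; try exact: ctorus_reflect0.
    rewrite !mean_reflect; congr (_ * _%:R + _ * _%:R).
      by rewrite addrAC subr_eq0 eq_sym.
    by rewrite -addrA -opprD subr_eq0.
  have -> : cnt = 2^-1 * (\sum_(a : grid n.+1) \sum_(b : grid n.+1)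
      (grid_freq b == grid_freq a + unit_freq j)%:R) + 2^-1 * cnt.
    by rewrite [X in 2^-1 * X + _]exchange_big/= -/cnt; field.
  rewrite /cnt !mulr_sumr -big_split; apply: eq_bigr => a _.
  by rewrite !mulr_sumr -big_split.
(* for each b with b_j < n there is exactly one a *)
(* the pair is determined by b, and exists unless b is already maximal in direction j *)
have -> : cnt = \sum_(b : grid n.+1) \prod_(i : 'I_d)
    (if i == j then ((b i : nat) < n)%N%:R else 1).
  rewrite /cnt exchange_big; apply: eq_bigr => b _ /=.
  rewrite [RHS](bigD1 j)//= eqxx [X in _ = _ * X]big1 ?mulr1; last by move=> i /negbTE ->.
  have [bn|bn] := ltnP (b j) n.
    pose a : grid n.+1 := [ffun i => if i == j then inord (b j).+1 else b i].
    have aE : grid_freq a = grid_freq b + unit_freq j.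
      apply/rowP => i; rewrite !mxE eqxx ffunE; case: eqVneq => [->|ij].
        by rewrite inordK ?ltnS// -addn1 PoszD.
      by rewrite addr0.
    rewrite (bigD1 a)//= aE eqxx big1 ?addr0// => c ca.
    rewrite -aE; case: eqP => // /grid_freq_inj h.
    by rewrite h eqxx in ca.
  rewrite big1// => a _; case: eqP => // /rowP/(_ j); rewrite !mxE !eqxx => h.
  have : Posz (a j) = Posz (b j).+1 by rewrite h -[(b j).+1]addn1 PoszD.
  by case=> ajb; have := ltn_ord (a j); rewrite ajb ltnS ltnNge bn.
rewrite -(bigA_distr_bigA (fun i (m : 'I_n.+1) => if i == j then ((m : nat) < n)%N%:R else 1 : R)).
rewrite (bigD1 j)//= eqxx.
rewrite [X in _ * (_ * X)](eq_bigr (fun=> n.+1%:R)); last first.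
  move=> i /negbTE ->; by rewrite sumr_const card_ord.
rewrite prodr_const.
have -> : \sum_(m < n.+1) ((m : nat) < n)%N%:R = n%:R :> R.
  rewrite big_ord_recr/= ltnn addr0 (eq_bigr (fun=> 1)) ?sumr_const ?card_ord// => m _.
  by rewrite ltn_ord.
have -> : #|[pred i | i != j]| = d.-1.
  by rewrite cardC1 card_ord.
have d0 : (0 < d)%N by exact: leq_ltn_trans (ltn_ord j).
rewrite /gridN -{1}(prednK d0) expnS natrM natrX.
have h0 : n.+1%:R != 0 :> R by rewrite pnatr_eq0.
have h2 : n.+1%:R ^+ d.-1 != 0 :> R by rewrite expf_neq0.
move: (n.+1%:R ^+ d.-1) h2 => P h2; rewrite -natr1 in h0 *.
by field; rewrite h0 h2.
Qed.

(** Positivity of the kernel lets the bound on [f x - f y] be integrated against it. The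
    hypothesis is kept separate from continuity so that one modulus can serve a whole
    family of functions, as in [tcont_fejer]. *)
Lemma fejer_error n f (e C : R) : ctorus f -> 0 <= C ->
  (forall x y, `|f x - f y| <= e + C * \sum_j (1 - cos (x ord0 j - y ord0 j))) ->
  forall x, `|f x - fejer n.+1 f x| <= e + C * d%:R / n.+1%:R.
Proof.
move=> cf C0 hf x.
have cK := ctorus_fejer_kernel n.+1 x.
have cfx : ctorus (fun y => f x - f y) by apply: ctorusB => //; exact: ctorus_cst.
have ccos j : ctorus (fun y => cos (x ord0 j - y ord0 j)).
  have := ctorus_reflect0 (unit_freq j) x; congr ctorus; apply/funext => y; congr cos.
  rewrite /freq_dot (bigD1 j)//= big1 ?addr0 => [|i ij].
    by rewrite !mxE !eqxx mul1r.
  by rewrite !mxE eqxx (negbTE ij) mul0r.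
have -> : f x - fejer n.+1 f x = mean (fun y => (f x - f y) * fejer_kernel n.+1 (x - y)).
  rewrite fejerE// -[X in X - _]mulr1 -(mean_fejer_kernel n x) -meanZ// -meanB//; last 2 first.
  - exact: ctorusZ.
  - exact: ctorusM.
  by congr mean; apply/funext => y; rewrite mulrBl.
have cb : ctorus (fun y => (e + C * \sum_j (1 - cos (x ord0 j - y ord0 j))) * fejer_kernel n.+1 (x - y)).
  apply: ctorusM => //; apply: ctorusD; first exact: ctorus_cst.
  apply: ctorusZ; apply: ctorus_sum => j _; apply: ctorusB => //; exact: ctorus_cst.
have cl : ctorus (fun y => (f x - f y) * fejer_kernel n.+1 (x - y)) by exact: ctorusM.
have mb : mean (fun y => (e + C * \sum_j (1 - cos (x ord0 j - y ord0 j))) * fejer_kernel n.+1 (x - y))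
   = e + C * d%:R / n.+1%:R.
  transitivity (mean (fun y => e * fejer_kernel n.+1 (x - y) +
     C * \sum_j (fejer_kernel n.+1 (x - y) - cos (x ord0 j - y ord0 j) * fejer_kernel n.+1 (x - y)))).
    congr mean; apply/funext => y; rewrite mulrDl -mulrA; congr (_ + _ * _).
    by rewrite mulr_suml; apply: eq_bigr => j _; rewrite mulrBl mul1r.
  have cj j : ctorus (fun y => fejer_kernel n.+1 (x - y) - cos (x ord0 j - y ord0 j) * fejer_kernel n.+1 (x - y)).
    by apply: ctorusB => //; exact: ctorusM.
  rewrite meanD; last 2 first.
  - exact: ctorusZ.
  - by apply: ctorusZ; exact: ctorus_sum.
  rewrite (meanZ _ cK) meanZ; last exact: ctorus_sum.
  rewrite mean_fejer_kernel mulr1 mean_sum// (eq_bigr (fun=> n.+1%:R^-1)) => [|j _].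
    by rewrite sumr_const card_ord -[_ *+ d]mulr_natl mulrA.
  rewrite meanB//; last exact: ctorusM.
  by rewrite mean_fejer_kernel mean_cos_fejer_kernel; ring.
rewrite -mb ler_norml; apply/andP; split.
  rewrite -meanN//; apply: le_mean => // [|y]; first exact: ctorusN.
  rewrite -mulNr ler_wpM2r ?fejer_kernel_ge0//.
  by have := hf x y; rewrite ler_norml => /andP[].
apply: le_mean => // y; rewrite ler_wpM2r ?fejer_kernel_ge0//.
by have := hf x y; rewrite ler_norml => /andP[].
Qed.

Lemma fejer_dense f : ctorus f -> forall e : R, 0 < e ->
  exists n, forall x, `|f x - fejer n.+1 f x| <= e.
Proof.
move=> cf e e0.
have [C C0 hC] := ctorus_modulus cf (divr_gt0 e0 (ltr0n _ 2)).
have [n hn] : exists n : nat, C * d%:R / (e / 2) < n%:R.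
  by exists (Num.trunc (C * d%:R / (e / 2))).+1; rewrite truncnS_gt.
exists n => x; apply: le_trans (fejer_error n cf C0 hC x) _.
rewrite [leRHS](splitr e) lerD2l ler_pdivrMr// [leRHS]mulrC -ler_pdivrMr ?divr_gt0//.
by apply: le_trans (ltW hn) _; rewrite ler_nat.
Qed.

Lemma ctorus_fejer n f : ctorus (fejer n f).
Proof.
apply: ctorusZ; apply: ctorus_sum => a _; apply: ctorus_sum => b _.
by apply: ctorusD; apply: ctorusZ; [exact: ctorus_cos0|exact: ctorus_sin].
Qed.

Lemma mean_mul_fejer n f g : ctorus f -> ctorus g ->
  mean (fun x => g x * fejer n f x) = (gridN n)^-1 *
   \sum_(a : grid n) \sum_(b : grid n)
    (cos_coef f (grid_freq a - grid_freq b) * cos_coef g (grid_freq a - grid_freq b) +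
     sin_coef f (grid_freq a - grid_freq b) * sin_coef g (grid_freq a - grid_freq b)).
Proof.
move=> cf cg.
have cc k : ctorus (fun x => cos_coef f k * (g x * cos (freq_dot k x))).
  by apply: ctorusZ; apply: ctorusM => //; exact: ctorus_cos0.
have cs k : ctorus (fun x => sin_coef f k * (g x * sin (freq_dot k x))).
  by apply: ctorusZ; apply: ctorusM => //; exact: ctorus_sin.
transitivity (mean (fun x => (gridN n)^-1 * \sum_(a : grid n) \sum_(b : grid n)
   (cos_coef f (grid_freq a - grid_freq b) * (g x * cos (freq_dot (grid_freq a - grid_freq b) x)) +
    sin_coef f (grid_freq a - grid_freq b) * (g x * sin (freq_dot (grid_freq a - grid_freq b) x))))).
  congr mean; apply/funext => x; rewrite mulrCA; congr (_ * _).
  rewrite mulr_sumr; apply: eq_bigr => a _; rewrite mulr_sumr; apply: eq_bigr => b _.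
  by ring.
rewrite meanZ; last by apply: ctorus_sum => a _; apply: ctorus_sum => b _; exact: ctorusD.
congr (_ * _); rewrite mean_sum => [|a _]; last by apply: ctorus_sum => b _; exact: ctorusD.
apply: eq_bigr => a _; rewrite mean_sum => [|b _]; last exact: ctorusD.
apply: eq_bigr => b _; rewrite meanD// !meanZ//; apply: ctorusM => //.
  exact: ctorus_sin.
exact: ctorus_cos0.
Qed.

Lemma ctorus_translate f z : ctorus f -> ctorus (fun x => f (x + z)).
Proof.
move=> [cf pf]; split; last by move=> j u; rewrite addrAC pf.
have cz : continuous (fun x : E => x + z).
  by move=> w; apply: continuousD; [exact: cvg_id|exact: cst_continuous].
by move=> x; exact: (continuous_comp (cz x) (cf (x + z))).
Qed.

Lemma mean_cos_translate k (b : R) (z : E) :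
  mean (fun x => cos (freq_dot k (x + z) + b)) = mean (fun x => cos (freq_dot k x + b)).
Proof.
under eq_fun do rewrite freq_dotD -addrA.
rewrite !mean_cos; case: eqP => // ->.
by rewrite /freq_dot big1 ?add0r// => j _; rewrite mxE mul0r.
Qed.

(** True for characters by direct computation, hence for Fejer means, which are dense. *)
Lemma mean_translate f z : ctorus f -> mean (fun x => f (x + z)) = mean f.
Proof.
move=> cf; apply/eqP; rewrite -subr_eq0 -normr_le0; apply/ler_addgt0Pl => e e0.
rewrite addr0.
have [n hn] := fejer_dense cf (divr_gt0 e0 (ltr0n _ 2)).
pose g := fejer n.+1 f.
have cg : ctorus g by exact: ctorus_fejer.
have gz : mean (fun x => g (x + z)) = mean g.
  have cct k (w : E) : ctorus (fun x => cos_coef f k * cos (freq_dot k (x + w))).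
    by apply: ctorusZ; exact: (ctorus_translate w (ctorus_cos0 k)).
  have cst k (w : E) : ctorus (fun x => sin_coef f k * sin (freq_dot k (x + w))).
    by apply: ctorusZ; exact: (ctorus_translate w (ctorus_sin k)).
  have gE w : mean (fun x => g (x + w)) = (gridN n.+1)^-1 * \sum_(a : grid n.+1) \sum_(b : grid n.+1)
    (cos_coef f (grid_freq a - grid_freq b) * mean (fun x => cos (freq_dot (grid_freq a - grid_freq b) (x + w))) +
     sin_coef f (grid_freq a - grid_freq b) * mean (fun x => sin (freq_dot (grid_freq a - grid_freq b) (x + w)))).
    rewrite /g /fejer meanZ; last by apply: ctorus_sum => a _; apply: ctorus_sum => b _; exact: ctorusD.
    congr (_ * _); rewrite mean_sum => [|a _]; last by apply: ctorus_sum => b _; exact: ctorusD.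
    apply: eq_bigr => a _; rewrite mean_sum => [|b _]; last exact: ctorusD.
    apply: eq_bigr => b _; rewrite meanD// !meanZ//.
      exact: (ctorus_translate w (ctorus_sin _)).
    exact: (ctorus_translate w (ctorus_cos0 _)).
  have -> : mean g = mean (fun x => g (x + 0)) by under eq_fun do rewrite addr0.
  rewrite !gE; congr (_ * _); apply: eq_bigr => a _; apply: eq_bigr => b _.
  move: (_ - _) => k; congr (_ * _ + _ * _).
    have h w : mean (fun x : E => cos (freq_dot k (x + w))) = mean (fun x : E => cos (freq_dot k x)).
      transitivity (mean (fun x : E => cos (freq_dot k (x + w) + 0))).
        by congr mean; apply/funext => x; rewrite addr0.
      by rewrite mean_cos_translate; congr mean; apply/funext => x; rewrite addr0.
    by rewrite !h.
  have h w : mean (fun x : E => sin (freq_dot k (x + w))) = mean (fun x : E => sin (freq_dot k x)).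
    transitivity (mean (fun x : E => cos (freq_dot k (x + w) - pi / 2))).
      by congr mean; apply/funext => x; rewrite cos_subpihalf.
    by rewrite mean_cos_translate; congr mean; apply/funext => x; rewrite cos_subpihalf.
  by rewrite !h.
have h1 : `|mean (fun x => f (x + z)) - mean (fun x => g (x + z))| <= e / 2.
  rewrite -meanB; [|exact: ctorus_translate|exact: ctorus_translate].
  apply: normr_mean_le => [|x]; last exact: hn.
  by apply: ctorusB; exact: ctorus_translate.
have h2 : `|mean f - mean g| <= e / 2.
  rewrite -meanB//; apply: normr_mean_le => [|x]; last exact: hn.
  exact: ctorusB.
rewrite gz in h1; have := ler_distD (mean g) (mean (fun x => f (x + z))) (mean f).
rewrite [`|mean g - _|]distrC => h3; lra.
Qed.

End Fejer.

(** * Partial derivatives and integration by parts *)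

Section Partials.
Variables (R : realType) (d : nat).
Local Notation E := 'rV[R]_d.
Local Notation ctorus := (@ctorus R d).

Lemma line_quotient (f : E -> R) (x v : E) (t : R) :
  (fun h : R => h^-1 *: (((fun s : R => f (x + s *: v)) \o shift t) (h *: (1 : R)) - f (x + t *: v))) =
  (fun h : R => h^-1 *: ((f \o shift (x + t *: v)) (h *: v) - f (x + t *: v))).
Proof.
apply/funext => h /=; congr (_ *: (f _ - _)).
by rewrite [h *: 1]mulr1 scalerDl addrCA addrC.
Qed.

Lemma is_derive_line (f : E -> R) (x v : E) (t D : R) :
  is_derive (x + t *: v) v f D -> is_derive t (1 : R) (fun s : R => f (x + s *: v)) D.
Proof.
move=> [df vf]; apply: DeriveDef.
  by rewrite /derivable line_quotient.
by rewrite /derive line_quotient.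
Qed.

Lemma line_is_derive (f : E -> R) (x v : E) (D : R) :
  is_derive (0 : R) (1 : R) (fun s : R => f (x + s *: v)) D -> is_derive x v f D.
Proof.
have x0 : x = x + (0 : R) *: v by rewrite scale0r addr0.
move=> [df vf]; apply: DeriveDef.
  by rewrite x0 /derivable -line_quotient.
by rewrite x0 /derive -line_quotient.
Qed.

Lemma is_derive_partial (f : E -> R) j (x : E) : has_partials f ->
  is_derive x (basis_vec R j) f (partial j f x).
Proof. by move=> hf; apply: derivableP; exact: hf. Qed.

Lemma partial_periodic (f : E -> R) j : torus_periodic f -> torus_periodic (partial j f).
Proof.
move=> pf i u; rewrite /partial /derive.
set p := (2 * pi) *: _.
suff -> : (fun h : R => h^-1 *: ((f \o shift (u + p)) (h *: basis_vec R j) - f (u + p))) =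
  (fun h : R => h^-1 *: ((f \o shift u) (h *: basis_vec R j) - f u)) by [].
by apply/funext => h /=; rewrite addrA !pf.
Qed.

Lemma C1_ctorus (f : E -> R) : torus_periodic f -> C1 f ->
  ctorus f /\ forall j, ctorus (partial j f).
Proof.
move=> pf [cf _ cpf]; split; first by split.
by move=> j; split; [exact: cpf|exact: partial_periodic].
Qed.

Lemma partial_mvt (f : E -> R) j (x : E) (h : R) : has_partials f -> 0 < h ->
  exists2 c, 0 < c < h & f (x + h *: basis_vec R j) - f x = h * partial j f (x + c *: basis_vec R j).
Proof.
move=> hf h0; pose v := basis_vec R j.
have dl t : is_derive t (1 : R) (fun s : R => f (x + s *: v)) (partial j f (x + t *: v)).
  by apply: is_derive_line; exact: is_derive_partial.
have [|c] := @MVT R (fun s : R => f (x + s *: v)) (fun t => partial j f (x + t *: v)) 0 h h0 (fun t _ => dl t).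
  apply: continuous_subspaceT => t.
  by apply/differentiable_continuous/derivable1_diffP; have := dl t => ?; exact: ex_derive.
rewrite in_itv/= => ch; rewrite scale0r addr0 subr0 => hE.
by exists c => //; rewrite hE mulrC.
Qed.

(** The difference quotient has mean zero by translation invariance and is uniformly
    close to the derivative by the mean value theorem. *)
Lemma mean_partial (f : E -> R) j : torus_periodic f -> C1 f -> mean (partial j f) = 0.
Proof.
move=> pf c1f; have [ctf /(_ j) ctp] := C1_ctorus pf c1f.
have [_ hf _] := c1f.
apply/eqP; rewrite -normr_le0; apply/ler_addgt0Pl => e e0; rewrite addr0.
have [del del0 hdel] := ctorus_unif_continuous ctp e0.
pose h := del / 2; have h0 : 0 < h by rewrite divr_gt0.
pose q x := h^-1 * (f (x + h *: basis_vec R j) - f x).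
have cq : ctorus q by apply: ctorusZ; apply: ctorusB => //; exact: ctorus_translate.
have mq : mean q = 0.
  rewrite meanZ; last by apply: ctorusB => //; exact: ctorus_translate.
  rewrite meanB//; last exact: ctorus_translate.
  by rewrite mean_translate// subrr mulr0.
rewrite -[mean _]subr0 -mq -meanB//; apply: normr_mean_le; first exact: ctorusB.
move=> x; have [c /andP[c0 ch] hc] := partial_mvt j x hf h0.
rewrite /q hc mulKf ?gt_eqF// ltW//; apply: hdel => i.
rewrite !mxE opprD addrA subrr sub0r normrN; case: (i == j); rewrite ?mulr1 ?mulr0 ?normr0//.
by rewrite gtr0_norm// (lt_trans ch)// /h ltr_pdivrMr// ltr_pMr// ltr1n.
Qed.

Lemma is_derive_cos_dot (k : 'rV[int]_d) (b : R) j (x : E) :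
  is_derive x (basis_vec R j) (fun x => cos (freq_dot k x + b))
   (- ((k ord0 j)%:~R * sin (freq_dot k x + b))).
Proof.
apply: line_is_derive.
have -> : (fun s : R => cos (freq_dot k (x + s *: basis_vec R j) + b)) =
    (fun s : R => cos ((k ord0 j)%:~R * s + (freq_dot k x + b))).
  apply/funext => s; rewrite freq_dotD freq_dotZ freq_dot_basis; congr cos; ring.
by have := is_derive_cos_affine (k ord0 j)%:~R (freq_dot k x + b) (0 : R); rewrite mulr0 add0r.
Qed.

Lemma mean_by_parts (f : E -> R) j k b : torus_periodic f -> C1 f ->
  mean (fun x => partial j f x * cos (freq_dot k x + b)) =
  (k ord0 j)%:~R * mean (fun x => f x * sin (freq_dot k x + b)).
Proof.
move=> pf c1f; have [cf hf cpf] := c1f.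
have [ctf ctp] := C1_ctorus pf c1f.
have csin : ctorus (fun x => sin (freq_dot k x + b)).
  have := ctorus_cos k (b - pi / 2); congr ctorus; apply/funext => x.
  by rewrite addrA cos_subpihalf.
have ccos := ctorus_cos k b.
pose g x := f x * cos (freq_dot k x + b).
have dg i x : is_derive x (basis_vec R i) g
    (partial i f x * cos (freq_dot k x + b) - (k ord0 i)%:~R * (f x * sin (freq_dot k x + b))).
  have := is_deriveM (is_derive_partial i x hf) (is_derive_cos_dot k b i x).
  by congr is_derive; rewrite /GRing.scale/=; ring.
have pg i : partial i g = fun x => partial i f x * cos (freq_dot k x + b) -
    (k ord0 i)%:~R * (f x * sin (freq_dot k x + b)).
  by apply/funext => x; have [_] := dg i x.
have ct i : ctorus (fun x => partial i f x * cos (freq_dot k x + b)).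
  exact: ctorusM.
have ct2 i : ctorus (fun x => (k ord0 i)%:~R * (f x * sin (freq_dot k x + b))).
  by apply: ctorusZ; exact: ctorusM.
have ctg : ctorus g by exact: ctorusM.
have c1g : C1 g.
  split; [by case: ctg|by move=> x i; have [] := dg i x|move=> i].
  by rewrite pg; have [] := ctorusB (ct i) (ct2 i).
have := @mean_partial g j ctg.2 c1g; rewrite pg meanB// => /subr0_eq ->.
by rewrite meanZ//; exact: ctorusM.
Qed.

Lemma cos_coef_partial (f : E -> R) j k : torus_periodic f -> C1 f ->
  cos_coef (partial j f) k = (k ord0 j)%:~R * sin_coef f k.
Proof.
move=> pf c1f; have := mean_by_parts j k 0 pf c1f.
by under eq_fun do rewrite addr0; under [X in _ = _ * mean X -> _]eq_fun do rewrite addr0.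
Qed.

Lemma sin_coef_partial (f : E -> R) j k : torus_periodic f -> C1 f ->
  sin_coef (partial j f) k = - ((k ord0 j)%:~R * cos_coef f k).
Proof.
move=> pf c1f; have := mean_by_parts j k (- (pi / 2)) pf c1f.
under eq_fun do rewrite cos_subpihalf.
under [X in _ = _ * mean X -> _]eq_fun do rewrite sinB sin_pihalf cos_pihalf mulr0 sub0r mulr1 mulrN.
rewrite meanN ?mulrN//; apply: ctorusM; last exact: ctorus_cos0.
by have [] := C1_ctorus pf c1f.
Qed.

End Partials.

(** * Absolutely convergent sums over frequencies *)

Section CubeSums.
Variables (R : realType) (d : nat).
Local Notation K := 'rV[int]_d.
Implicit Types (F G : K -> R).

Definition cube_pt N (a : grid d (2 * N).+1) : K := grid_freq a - const_mx N%:Z.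

Lemma cube_pt_inj N : injective (@cube_pt N).
Proof. by move=> a b /addIr /grid_freq_inj. Qed.

Lemma freq_cubeE N : @freq_cube d N = [set` map (@cube_pt N) (enum (grid d (2 * N).+1))].
Proof.
apply/seteqP; split => k /=; last first.
  move=> /mapP[a _ ->] j; rewrite !mxE ler_norml.
  have := ltn_ord (a j); move: (nat_of_ord (a j)) => m hm; apply/andP; split; lia.
move=> hk; apply/mapP; exists [ffun j => inord `|(k ord0 j + N%:Z)%R|%N]; first by rewrite mem_enum.
apply/rowP => j; rewrite !mxE ffunE; have := hk j; move: (k ord0 j) => z; rewrite ler_norml => /andP[h1 h2].
rewrite inordK; lia.
Qed.

Lemma finite_freq_cube N : finite_set (@freq_cube d N).
Proof. by rewrite freq_cubeE; exact: finite_seq. Qed.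

Definition csum N F : R := \sum_(k \in freq_cube N) F k.

Lemma csumE N F : csum N F = \sum_(a : grid d (2 * N).+1) F (cube_pt a).
Proof.
rewrite /csum freq_cubeE -fsbig_seq; last by rewrite map_inj_uniq ?enum_uniq//; exact: cube_pt_inj.
by rewrite big_map big_enum.
Qed.

Lemma csum_le N F G : (forall k, F k <= G k) -> csum N F <= csum N G.
Proof. by move=> FG; rewrite !csumE; apply: ler_sum. Qed.

Lemma csum_ge0 N F : (forall k, 0 <= F k) -> 0 <= csum N F.
Proof. by move=> F0; rewrite csumE sumr_ge0. Qed.

Lemma csumD N F G : csum N (fun k => F k + G k) = csum N F + csum N G.
Proof. by rewrite !csumE big_split. Qed.

Lemma csumZ N c F : csum N (fun k => c * F k) = c * csum N F.
Proof. by rewrite !csumE mulr_sumr. Qed.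

Lemma csum_norm N F : `|csum N F| <= csum N (fun k => `|F k|).
Proof. by rewrite !csumE ler_norm_sum. Qed.

Lemma freq_cube_sub N M : (N <= M)%N -> @freq_cube d N `<=` @freq_cube d M.
Proof. by move=> NM k hk j; apply: le_trans (hk j) _; rewrite lez_nat. Qed.

Lemma csum_set_le (A : set K) N F : (forall k, 0 <= F k) ->
  A `<=` freq_cube N -> \sum_(k \in A) F k <= csum N F.
Proof.
have fN := finite_freq_cube N.
move=> F0 AN; rewrite /csum (@fsbigID _ _ _ _ A (freq_cube N))//.
rewrite (_ : freq_cube N `&` A = A); last by apply/setIidPr.
by rewrite lerDl fsumr_ge0.
Qed.

Lemma csum_mono N M F : (forall k, 0 <= F k) -> (N <= M)%N -> csum N F <= csum M F.
Proof. by move=> F0 NM; apply: csum_set_le => //; exact: freq_cube_sub. Qed.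

Lemma csum_diff_le N M F G : (forall k, `|F k| <= G k) -> (N <= M)%N ->
  `|csum M F - csum N F| <= csum M G - csum N G.
Proof.
move=> FG NM.
have E (H : K -> R) : csum M H - csum N H = \sum_(k \in freq_cube M `&` ~` freq_cube N) H k.
  have fM := finite_freq_cube M.
  rewrite /csum (@fsbigID _ _ _ _ (freq_cube N) (freq_cube M))//.
  rewrite (_ : freq_cube M `&` freq_cube N = freq_cube N); last first.
    by apply/setIidPr; exact: freq_cube_sub.
  by rewrite [X in X - _]addrC addrK.
have fin : finite_set (freq_cube M `&` ~` @freq_cube d N).
  by apply: sub_finite_set (finite_freq_cube M) => k [].
rewrite !E !fsbig_finite//; apply: le_trans (ler_norm_sum _ _ _) _.
by apply: ler_sum.
Qed.

Lemma freq_in_cube (k : K) : freq_cube (\max_j `|k ord0 j|%N) k.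
Proof.
move=> j; rewrite -abszE lez_nat.
exact: (leq_bigmax j).
Qed.

Lemma finite_in_cube (A : set K) : finite_set A -> exists N, A `<=` freq_cube N.
Proof.
move=> /finite_seqP[s ->]; elim: s => [|k s [N hN]]; first by exists 0%N => k.
exists (maxn N (\max_j `|k ord0 j|%N)) => l /=; rewrite inE => /predU1P[->|/hN hl].
  by apply: freq_cube_sub (freq_in_cube k); rewrite leq_maxr.
by apply: freq_cube_sub hl; rewrite leq_maxl.
Qed.

Definition csummable F := exists M, forall N, csum N (fun k => `|F k|) <= M.

Lemma csummable_le F G : csummable G -> (forall k, `|F k| <= G k) -> csummable F.
Proof.
move=> [M hM] FG; exists M => N; apply: le_trans (hM N).
by apply: csum_le => k; apply: le_trans (FG k) (ler_norm _).
Qed.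

Lemma csummableZ c F : csummable F -> csummable (fun k => c * F k).
Proof.
move=> [M hM]; exists (`|c| * M) => N.
under [X in csum _ X]eq_fun do rewrite normrM.
by rewrite csumZ ler_wpM2l.
Qed.

Lemma csummableD F G : csummable F -> csummable G -> csummable (fun k => F k + G k).
Proof.
move=> [M hM] [M' hM']; exists (M + M') => N; apply: le_trans (lerD (hM N) (hM' N)).
by rewrite -csumD; apply: csum_le => k; exact: ler_normD.
Qed.

Lemma csummableB F G : csummable F -> csummable G -> csummable (fun k => F k - G k).
Proof.
move=> sF /(csummableZ (-1)) /(csummableD sF) [M hM]; exists M => N.
by apply: le_trans (hM N); apply: csum_le => k; rewrite mulN1r.
Qed.

Definition climit F : R := limn (fun N => csum N F).

Lemma csum_nneg_cvg F : (forall k, 0 <= F k) -> (exists M, forall N, csum N F <= M) ->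
  cvgn (fun N => csum N F).
Proof.
move=> F0 [M hM]; apply: nondecreasing_is_cvgn.
  by move=> N N' NN; exact: csum_mono.
by exists M => _ [N _ <-].
Qed.

Lemma csummable_cvg F : csummable F -> (fun N => csum N F) @ \oo --> climit F.
Proof.
move=> [M hM].
have c1 : cvgn (fun N => csum N (fun k => `|F k|)) by apply: csum_nneg_cvg => //; exists M.
have c2 : cvgn (fun N => csum N (fun k => F k + `|F k|)).
  apply: csum_nneg_cvg => [k|]; first by have := ler_norm (- F k); rewrite normrN; lra.
  exists (M + M) => N; rewrite csumD; apply: lerD => //.
  by apply: le_trans (hM N); apply: csum_le => k; exact: ler_norm.
have -> : (fun N => csum N F) = (fun N => csum N (fun k => F k + `|F k|) - csum N (fun k => `|F k|)).
  by apply/funext => N; rewrite csumD addrK.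
suff : cvgn (fun N => csum N (fun k => F k + `|F k|) - csum N (fun k => `|F k|)).
  move=> cv; rewrite /climit; have -> // : (fun N => csum N F) = (fun N => csum N (fun k => F k + `|F k|) - csum N (fun k => `|F k|)).
  by apply/funext => N; rewrite csumD addrK.
exact: is_cvgB.
Qed.

Lemma climitD F G : csummable F -> csummable G ->
  climit (fun k => F k + G k) = climit F + climit G.
Proof.
move=> sF sG; apply: cvg_lim => //.
under eq_fun do rewrite csumD.
by apply: cvgD; exact: csummable_cvg.
Qed.

Lemma climitZ c F : csummable F -> climit (fun k => c * F k) = c * climit F.
Proof.
move=> sF; apply: cvg_lim => //.
under eq_fun do rewrite csumZ.
by apply: cvgMr; exact: csummable_cvg.
Qed.

Lemma climitB F G : csummable F -> csummable G ->
  climit (fun k => F k - G k) = climit F - climit G.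
Proof.
move=> sF sG; have := climitD sF (csummableZ (-1) sG).
rewrite climitZ// mulN1r => <-; congr climit; apply/funext => k; by rewrite mulN1r.
Qed.

Lemma climit_norm_le F M : (forall N, csum N (fun k => `|F k|) <= M) -> `|climit F| <= M.
Proof.
move=> hM; have sF : csummable F by exists M.
have c : `|csum N F| @[N --> \oo] --> `|climit F|.
  by apply: cvg_norm; exact: csummable_cvg.
rewrite -(cvg_lim _ c)//; apply: limr_le; first exact: cvgP c.
by apply: nearW => N; apply: le_trans (csum_norm _ _) (hM N).
Qed.

Lemma climit_tail F G N : csummable G -> (forall k, `|F k| <= G k) ->
  `|climit F - csum N F| <= climit G - csum N G.
Proof.
move=> sG FG; have sF := csummable_le sG FG.
have c1 : `|csum M F - csum N F| @[M --> \oo] --> `|climit F - csum N F|.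
  by apply: cvg_norm; apply: cvgB; [exact: csummable_cvg|exact: cvg_cst].
have c2 : csum M G - csum N G @[M --> \oo] --> climit G - csum N G.
  by apply: cvgB; [exact: csummable_cvg|exact: cvg_cst].
rewrite -(cvg_lim _ c1)// -(cvg_lim _ c2)//; apply: ler_lim.
- exact: cvgP c1.
- exact: cvgP c2.
- by near=> M; apply: csum_diff_le => //; near: M; exists N.
Unshelve. all: by end_near. Qed.

(** The rank beyond which tails are small depends on the majorant only; all exchanges of
    limits below rest on this. *)
Lemma climit_uniform G : csummable G -> forall e : R, 0 < e -> exists N0, forall N, (N0 <= N)%N ->
  forall F, (forall k, `|F k| <= G k) -> `|climit F - csum N F| <= e.
Proof.
move=> sG e e0; have /cvgrPdist_le/(_ e e0)[N0 _ hN0] := csummable_cvg sG.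
exists N0 => N N0N F FG; apply: le_trans (climit_tail N sG FG) _.
exact: le_trans (ler_norm _) (hN0 _ N0N).
Qed.

Lemma csum_split N (g : int -> R) :
  csum N (fun k => \prod_j g (k ord0 j)) =
  (\sum_(m < (2 * N).+1) g ((m : nat)%:Z - N%:Z)) ^+ d.
Proof.
rewrite csumE -[in RHS](card_ord d) -prodr_const.
rewrite (bigA_distr_bigA (fun (i : 'I_d) (m : 'I_(2 * N).+1) => g ((m : nat)%:Z - N%:Z))).
by apply: eq_bigr => a _; apply: eq_bigr => j _; rewrite !mxE.
Qed.

Lemma sum_inv_sq n : \sum_(m < n) (1 + m.+1%:R ^+ 2)^-1 <= 2 - 2 / n.+1%:R :> R.
Proof.
elim: n => [|n IH]; first by rewrite big_ord0 divr1 subrr.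
rewrite big_ord_recr/=.
suff h : (1 + n.+1%:R ^+ 2)^-1 <= 2 / n.+1%:R - 2 / n.+2%:R :> R.
  by apply: le_trans (lerD IH h) _; rewrite addrA subrK.
have -> : n.+2%:R = n.+1%:R + 1 :> R by rewrite -natr1.
have : 1 <= n.+1%:R :> R by rewrite ler1n.
move: (n.+1%:R : R) => x x1.
have -> : 2 / x - 2 / (x + 1) = (x * (x + 1) / 2)^-1 by field; apply/andP; split; apply/eqP; lra.
have h1 : 0 < x * (x + 1) / 2 by rewrite divr_gt0 ?mulr_gt0//; lra.
have h2 : 0 < 1 + x ^+ 2 by rewrite ltr_pwDl ?sqr_ge0.
by rewrite lef_pV2 ?posrE//; nra.
Qed.

Lemma sum_inv_sq_sym N :
  \sum_(m < (2 * N).+1) (1 + ((m : nat)%:Z - N%:Z)%:~R ^+ 2)^-1 <= 5 :> R.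
Proof.
pose g (z : int) : R := (1 + z%:~R ^+ 2)^-1.
rewrite -(big_mkord xpredT (fun m => g (m%:Z - N%:Z))) (@big_cat_nat _ _ _ N)/=; [|lia..].
rewrite [X in X + _](_ : _ = \sum_(m < N) (1 + m.+1%:R ^+ 2)^-1); last first.
  rewrite big_nat_rev/= add0n big_mkord; apply: eq_bigr => m _; rewrite /g.
  have -> : ((N - m.+1)%N%:Z - N%:Z) = - (m.+1)%:Z by have := ltn_ord m; lia.
  by rewrite mulrNz sqrrN.
rewrite -[X in \sum_(X <= _ < _) _]add0n big_addn (_ : ((2 * N).+1 - N)%N = N.+1); last by lia.
rewrite big_mkord big_ord_recl/= [X in _ + (X + _)](_ : _ = 1); last first.
  by rewrite /g add0n subrr expr0n addr0 invr1.
rewrite [X in _ + (_ + X)](_ : _ = \sum_(m < N) (1 + m.+1%:R ^+ 2)^-1); last first.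
  apply: eq_bigr => m _; rewrite /g /bump/= add1n PoszD addrK.
  by [].
have h := sum_inv_sq N; have N0 : 0 < N.+1%:R^-1 :> R by rewrite invr_gt0.
apply: le_trans (lerD h (lerD (lexx 1) h)) _.
by move: (N.+1%:R^-1) N0 => y y0; lra.
Qed.

(** A product majorant of the isotropic weights: its sum over a cube factors into
    one-dimensional sums. *)
Definition wprod (k : K) : R := \prod_j (1 + (k ord0 j)%:~R ^+ 2)^-1.

Lemma wprod_ge0 k : 0 <= wprod k.
Proof. by apply: prodr_ge0 => j _; rewrite invr_ge0 addr_ge0 ?sqr_ge0. Qed.

Lemma csum_wprod N : csum N wprod <= 5 ^+ d.
Proof.
rewrite (csum_split N (fun z => (1 + z%:~R ^+ 2)^-1)) lerXn2r ?nnegrE ?sum_inv_sq_sym//.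
by apply: sumr_ge0 => m _; rewrite invr_ge0 addr_ge0 ?sqr_ge0.
Qed.

Lemma csummable_wprod : csummable wprod.
Proof.
exists (5 ^+ d) => N; apply: le_trans (csum_wprod N).
by apply: csum_le => k; rewrite ger0_norm// wprod_ge0.
Qed.

Lemma freq_sq_ge0 (k : K) : 0 <= freq_sq R k.
Proof. by apply: sumr_ge0 => j _; exact: sqr_ge0. Qed.

Lemma wprod_ge (k : K) : (1 + freq_sq R k) ^- d <= wprod k.
Proof.
have q0 := freq_sq_ge0 k.
rewrite /wprod prodfV lef_pV2 ?posrE; last 2 first.
- by rewrite exprn_gt0//; lra.
- by apply: prodr_gt0 => j _; rewrite ltr_wpDr ?sqr_ge0.
have -> : (1 + freq_sq R k) ^+ d = \prod_(j < d) (1 + freq_sq R k).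
  by rewrite prodr_const card_ord.
apply: ler_prod => j _.
rewrite addr_ge0 ?sqr_ge0//= lerD2l /freq_sq (bigD1 j)//= lerDl.
by apply: sumr_ge0 => i _; exact: sqr_ge0.
Qed.

Definition weight m (k : K) : R := (1 + freq_sq R k) ^- m.

Lemma weight_gt0 m k : 0 < weight m k.
Proof. by rewrite invr_gt0 exprn_gt0// ltr_pwDl ?freq_sq_ge0. Qed.

Lemma weight_le_wprod m k : (d <= m)%N -> weight m k <= wprod k.
Proof.
move=> dm; apply: le_trans (wprod_ge k).
have q1 : 1 <= 1 + freq_sq R k by rewrite lerDl freq_sq_ge0.
rewrite lef_pV2 ?posrE ?exprn_gt0//; try lra.
exact: ler_weXn2l.
Qed.

Lemma csummable_weight m : (d <= m)%N -> csummable (weight m).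
Proof.
move=> dm; apply: csummable_le csummable_wprod _ => k.
by rewrite ger0_norm; [exact: weight_le_wprod|exact/ltW/weight_gt0].
Qed.

End CubeSums.

(** * Trigonometric series *)

Section TrigSeries.
Variables (R : realType) (d : nat).
Local Notation E := 'rV[R]_d.
Local Notation K := 'rV[int]_d.
Local Notation ctorus := (@ctorus R d).
Implicit Types (A B G : K -> R).

Lemma sin_lipschitz (a b : R) : `|sin a - sin b| <= `|a - b|.
Proof.
wlog ab : a b / b < a => [h|].
  have [->|ne] := eqVneq a b; first by rewrite !subrr normr0.
  have [|ba] := ltP b a; first exact: h.
  by rewrite distrC [leRHS]distrC; apply: h; rewrite lt_neqAle ne.
have [|c _ ->] := @MVT R sin cos b a ab (fun x _ => is_derive_sin x).
  by apply: continuous_subspaceT => x; exact: continuous_sin.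
by rewrite normrM ler_piMl// ler_norml cos_geN1 cos_le1.
Qed.

Lemma sin_addpihalf (a : R) : sin (a + pi / 2) = cos a.
Proof. by rewrite sinD cos_pihalf sin_pihalf mulr0 add0r mulr1. Qed.

Lemma cos_addpihalf (a : R) : cos (a + pi / 2) = - sin a.
Proof. by rewrite cosD cos_pihalf sin_pihalf mulr0 sub0r mulr1. Qed.

Lemma cos_lipschitz (a b : R) : `|cos a - cos b| <= `|a - b|.
Proof.
rewrite -!sin_addpihalf; apply: le_trans (sin_lipschitz _ _) _.
by rewrite opprD addrACA subrr addr0.
Qed.

Lemma sin_taylor (a h : R) : `|sin (a + h) - sin a - h * cos a| <= h ^+ 2.
Proof.
have key (b l : R) : 0 < l -> `|sin (b + l) - sin b - l * cos b| <= l ^+ 2 /\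
    `|sin (b + l) - sin b - l * cos (b + l)| <= l ^+ 2.
  move=> l0; have bl : b < b + l by rewrite ltrDl.
  have [|c] := @MVT R sin cos b (b + l) bl (fun x _ => is_derive_sin x).
    by apply: continuous_subspaceT => x; exact: continuous_sin.
  rewrite in_itv/= => /andP[c1 c2] ->; rewrite [b + l - b]addrAC subrr add0r mulrC -!mulrBr !normrM gtr0_norm//.
  split; rewrite expr2 ler_pM2l//; apply: le_trans (cos_lipschitz _ _) _.
    by rewrite gtr0_norm; lra.
  by rewrite ler0_norm; lra.
have [h0|h0|->] := ltgtP h 0; last first.
- by rewrite addr0 subrr mul0r subr0 normr0 sqr_ge0.
- by have [] := key a h h0.
- have [] := key (a + h) (- h); first by rewrite oppr_gt0.
  rewrite addrK sqrrN => _; rewrite -normrN; congr (`|_| <= _); ring.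
Qed.

Lemma cos_taylor (a h : R) : `|cos (a + h) - cos a + h * sin a| <= h ^+ 2.
Proof.
have := sin_taylor (a + pi / 2) h.
by rewrite [a + _ + h]addrAC !sin_addpihalf cos_addpihalf mulrN opprK.
Qed.

(** A quadratic Taylor remainder suffices for differentiability and is stable under
    summation, which avoids any theorem on termwise differentiation. *)
Lemma is_derive_quadratic (phi : R -> R) (D C : R) :
  (forall s, `|phi s - phi 0 - s * D| <= C * s ^+ 2) -> is_derive (0 : R) (1 : R) phi D.
Proof.
move=> h.
have C0 : 0 <= C by apply: le_trans (normr_ge0 _) (le_trans (h 1) _); rewrite expr1n mulr1.
have cv : (fun s : R => s^-1 *: ((phi \o shift 0) (s *: 1) - phi 0)) @ 0^' --> D.
  apply/cvgrPdist_le => e e0.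
  have C1 : 0 < C + 1 by lra.
  have ec : (0 : R) < e / (C + 1) by exact: divr_gt0.
  near=> s.
  have s0 : s != 0 by near: s; exact: nbhs_dnbhs_neq.
  rewrite /= addr0 [s *: 1]mulr1 /GRing.scale/= distrC.
  have -> : s^-1 * (phi s - phi 0) - D = s^-1 * (phi s - phi 0 - s * D).
    by rewrite [RHS]mulrBr mulKf.
  rewrite normrM normfV mulrC ler_pdivrMr ?normr_gt0//.
  apply: le_trans (h s) _; rewrite -real_normK ?num_real// expr2 mulrA ler_wpM2r//.
  have : `|s| < e / (C + 1) by near: s; exact: dnbhs0_lt.
  rewrite ltr_pdivlMr// => hs; apply: le_trans (ltW hs).
  by rewrite mulrC ler_wpM2l//; lra.
apply: DeriveDef; first exact: cvgP cv.
exact: cvg_lim cv.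
Unshelve. all: by end_near. Qed.

Lemma ctorus_uniform_limit (f : E -> R) :
  (forall e : R, 0 < e -> exists2 g, ctorus g & forall x, `|f x - g x| <= e) -> ctorus f.
Proof.
move=> h; split.
  move=> x; apply/(@cvgrPdist_le R _ _ (nbhs x)) => e e0.
  have [g [cg _] hg] := h (e / 3) (divr_gt0 e0 (ltr0n _ 3)).
  have /cvgrPdist_le/(_ (e / 3) (divr_gt0 e0 (ltr0n _ 3))) := cg x.
  apply: filterS => y gxy; have := hg x; have := hg y.
  have := ler_distD (g x) (f x) (f y); have := ler_distD (g y) (g x) (f y).
  rewrite [`|f y - g y|]distrC; lra.
move=> j u; apply/eqP; rewrite -subr_eq0 -normr_le0; apply/ler_addgt0Pl => e e0.
rewrite addr0; have [g [_ pg] hg] := h (e / 2) (divr_gt0 e0 (ltr0n _ 2)).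
have := hg (u + (2 * pi) *: basis_vec R j); have := hg u; rewrite pg.
set y := f (u + _); have := ler_distD (g u) y (f u); rewrite [`|g u - _|]distrC; lra.
Qed.

Definition trig_term A B (x : E) (k : K) : R :=
  A k * cos (freq_dot k x) + B k * sin (freq_dot k x).

Definition trig_series A B (x : E) : R := climit (trig_term A B x).

Lemma ctorus_trig_term A B k : ctorus (fun x => trig_term A B x k).
Proof. by apply: ctorusD; apply: ctorusZ; [exact: ctorus_cos0|exact: ctorus_sin]. Qed.

Lemma ctorus_csum N (F : K -> E -> R) : (forall k, ctorus (F k)) ->
  ctorus (fun x => csum N (fun k => F k x)).
Proof.
move=> cF; under eq_fun do rewrite csumE.
by apply: ctorus_sum.
Qed.

Lemma mean_csum N (F : K -> E -> R) : (forall k, ctorus (F k)) ->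
  mean (fun x => csum N (fun k => F k x)) = csum N (fun k => mean (F k)).
Proof.
move=> cF; under eq_fun do rewrite csumE.
by rewrite mean_sum// csumE.
Qed.

Lemma trig_term_le A B G x k : (forall k, `|A k| <= G k) -> (forall k, `|B k| <= G k) ->
  `|trig_term A B x k| <= 2 * G k.
Proof.
move=> hA hB; apply: le_trans (ler_normD _ _) _; rewrite mulr_natl mulr2n lerD//.
  rewrite normrM; apply: le_trans (hA k); rewrite ler_piMr//.
  by rewrite ler_norml cos_geN1 cos_le1.
rewrite normrM; apply: le_trans (hB k); rewrite ler_piMr//.
by rewrite ler_norml sin_geN1 sin_le1.
Qed.

Section Summable.
Variables (A B G : K -> R).
Hypotheses (sG : csummable G) (hA : forall k, `|A k| <= G k) (hB : forall k, `|B k| <= G k).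

Lemma csummable_trig x : csummable (trig_term A B x).
Proof. by apply: csummable_le (csummableZ 2 sG) _ => k; exact: trig_term_le. Qed.

Lemma trig_series_uniform (e : R) : 0 < e -> exists N0, forall N, (N0 <= N)%N ->
  forall x, `|trig_series A B x - csum N (trig_term A B x)| <= e.
Proof.
move=> e0; have [N0 hN0] := climit_uniform (csummableZ 2 sG) e0.
by exists N0 => N NN x; apply: hN0 => // k; exact: trig_term_le.
Qed.

Lemma ctorus_trig_series : ctorus (trig_series A B).
Proof.
apply: ctorus_uniform_limit => e /trig_series_uniform[N /(_ N (leqnn _)) hN].
exists (fun x => csum N (trig_term A B x)) => //.
by apply: ctorus_csum => k; exact: ctorus_trig_term.
Qed.

Lemma mean_mul_trig_series (g : E -> R) : ctorus g ->
  mean (fun x => g x * trig_series A B x) =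
  climit (fun k => A k * cos_coef g k + B k * sin_coef g k).
Proof.
move=> cg; have [M hM] := ctorus_bounded cg.
have M0 : 0 <= M by apply: le_trans (hM 0).
have cT := ctorus_trig_series.
have hk k : mean (fun x => g x * trig_term A B x k) = A k * cos_coef g k + B k * sin_coef g k.
  rewrite /cos_coef /sin_coef -!meanZ -?meanD.
  - by congr mean; apply/funext => x; rewrite /trig_term; ring.
  - by apply: ctorusZ; apply: ctorusM => //; exact: ctorus_cos0.
  - by apply: ctorusZ; apply: ctorusM => //; exact: ctorus_sin.
  - by apply: ctorusM => //; exact: ctorus_sin.
  - by apply: ctorusM => //; exact: ctorus_cos0.
have cgt k : ctorus (fun x => g x * trig_term A B x k).
  by apply: ctorusM => //; exact: ctorus_trig_term.
have mN N : csum N (fun k => A k * cos_coef g k + B k * sin_coef g k) =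
    mean (fun x => g x * csum N (trig_term A B x)).
  rewrite (_ : (fun k => _) = (fun k => mean (fun x => g x * trig_term A B x k))); last by apply/funext => k; rewrite hk.
  by rewrite -mean_csum//; congr mean; apply/funext => x; rewrite csumZ.
apply/esym/cvg_lim => //; apply/cvgrPdist_le => e e0.
have [|N0 hN0] := @trig_series_uniform (e / (M + 1)); first by rewrite divr_gt0//; lra.
exists N0 => // N /= /hN0 hN; rewrite mN -meanB; last 2 first.
- exact: ctorusM.
- by apply: ctorusM => //; apply: ctorus_csum => k; exact: ctorus_trig_term.
apply: normr_mean_le => [|x].
  apply: ctorusB; apply: ctorusM => //; apply: ctorus_csum => k; exact: ctorus_trig_term.
rewrite -mulrBr normrM; apply: le_trans (ler_pM _ _ (hM x) (hN x)) _ => //.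
rewrite mulrCA ler_piMr ?(ltW e0)// ler_pdivrMr; lra.
Qed.

End Summable.

Lemma climit_delta (c : K -> R) l : climit (fun k => c k * (k == l)%:R) = c l.
Proof.
have h N : (\max_j `|l ord0 j|%N <= N)%N -> csum N (fun k => c k * (k == l)%:R) = c l.
  move=> lN; rewrite /csum (fsbigD1 l)/=; last 2 first.
  - exact: finite_freq_cube.
  - exact: (freq_cube_sub lN (freq_in_cube l)).
  rewrite eqxx mulr1 fsbig1 ?addr0// => k [_ /eqP kl].
  by rewrite (negbTE kl) mulr0.
apply: cvg_lim => //; apply: cvg_near_cst.
by exists (\max_j `|l ord0 j|%N) => // N /= /h.
Qed.

Lemma csummable_delta (c : K -> R) l : csummable (fun k => c k * (k == l)%:R).
Proof.
exists `|c l| => N; pose N' := maxn N (\max_j `|l ord0 j|%N).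
apply: le_trans (csum_mono (N := N) (M := N') _ _) _ => //; first exact: leq_maxl.
rewrite /csum (fsbigD1 l)/=; last 2 first.
- exact: finite_freq_cube.
- by apply: freq_cube_sub (freq_in_cube l); exact: leq_maxr.
rewrite eqxx mulr1 fsbig1 ?addr0// => k [_ /eqP kl].
by rewrite (negbTE kl) mulr0 normr0.
Qed.

Lemma mean_cos_cos (k l : K) :
  mean (fun x : E => cos (freq_dot k x) * cos (freq_dot l x)) =
  2^-1 * (l == k)%:R + 2^-1 * (l == - k)%:R.
Proof.
transitivity (mean (fun x : E => 2^-1 * cos (freq_dot (k - l) x) + 2^-1 * cos (freq_dot (k + l) x))).
  congr mean; apply/funext => x; rewrite freq_dotBl freq_dotDl cosB cosD; by field.
have ck m : ctorus (fun x => 2^-1 * cos (freq_dot m x)) by apply: ctorusZ; exact: ctorus_cos0.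
have mc m : mean (fun x : E => cos (freq_dot m x)) = (m == 0)%:R.
  have := mean_cos m (0 : R); under eq_fun do rewrite addr0; rewrite cos0 => ->.
  by case: (m == 0).
rewrite meanD// !meanZ ?mc; try exact: ctorus_cos0.
by rewrite subr_eq0 [l == k]eq_sym addrC -[X in _ + X == 0]opprK subr_eq0 [l == _]eq_sym addrC eqr_oppLR.
Qed.

Lemma mean_sin_sin (k l : K) :
  mean (fun x : E => sin (freq_dot k x) * sin (freq_dot l x)) =
  2^-1 * (l == k)%:R - 2^-1 * (l == - k)%:R.
Proof.
transitivity (mean (fun x : E => 2^-1 * cos (freq_dot (k - l) x) - 2^-1 * cos (freq_dot (k + l) x))).
  congr mean; apply/funext => x; rewrite freq_dotBl freq_dotDl cosB cosD; by field.
have ck m : ctorus (fun x => 2^-1 * cos (freq_dot m x)) by apply: ctorusZ; exact: ctorus_cos0.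
have mc m : mean (fun x : E => cos (freq_dot m x)) = (m == 0)%:R.
  have := mean_cos m (0 : R); under eq_fun do rewrite addr0; rewrite cos0 => ->.
  by case: (m == 0).
rewrite meanB// !meanZ ?mc; try exact: ctorus_cos0.
by rewrite subr_eq0 [l == k]eq_sym addrC -[X in _ + X == 0]opprK subr_eq0 [l == _]eq_sym addrC eqr_oppLR.
Qed.

Lemma mean_sin (m : K) : mean (fun x : E => sin (freq_dot m x)) = 0.
Proof.
have := mean_cos m (- (pi / 2) : R); under eq_fun do rewrite cos_subpihalf.
by rewrite cosN cos_pihalf => ->; case: ifP.
Qed.

Lemma mean_sin_cos (k l : K) :
  mean (fun x : E => sin (freq_dot k x) * cos (freq_dot l x)) = 0.
Proof.
transitivity (mean (fun x : E => 2^-1 * sin (freq_dot (k + l) x) + 2^-1 * sin (freq_dot (k - l) x))).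
  congr mean; apply/funext => x; rewrite freq_dotBl freq_dotDl sinB sinD; by field.
have ck m : ctorus (fun x => 2^-1 * sin (freq_dot m x)) by apply: ctorusZ; exact: ctorus_sin.
by rewrite meanD// !meanZ ?mean_sin ?mulr0 ?addr0//; exact: ctorus_sin.
Qed.

Lemma cos_coef_trig_series A B G k : csummable G ->
  (forall k, `|A k| <= G k) -> (forall k, `|B k| <= G k) ->
  cos_coef (trig_series A B) k = 2^-1 * (A k + A (- k)).
Proof.
move=> sG hA hB; rewrite /cos_coef; under eq_fun do rewrite mulrC.
rewrite (mean_mul_trig_series sG hA hB); last exact: ctorus_cos0.
transitivity (climit (fun l => (2^-1 * A l) * (l == k)%:R + (2^-1 * A l) * (l == - k)%:R)).
  congr climit; apply/funext => l; rewrite /cos_coef /sin_coef mean_cos_cos.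
  under [X in _ + _ * mean X]eq_fun do rewrite mulrC.
  by rewrite mean_sin_cos; ring.
by rewrite climitD ?climit_delta ?mulrDr//; exact: csummable_delta.
Qed.

Lemma sin_coef_trig_series A B G k : csummable G ->
  (forall k, `|A k| <= G k) -> (forall k, `|B k| <= G k) ->
  sin_coef (trig_series A B) k = 2^-1 * (B k - B (- k)).
Proof.
move=> sG hA hB; rewrite /sin_coef; under eq_fun do rewrite mulrC.
rewrite (mean_mul_trig_series sG hA hB); last exact: ctorus_sin.
transitivity (climit (fun l => (2^-1 * B l) * (l == k)%:R - (2^-1 * B l) * (l == - k)%:R)).
  congr climit; apply/funext => l; rewrite /cos_coef /sin_coef mean_sin_sin.
  by rewrite mean_sin_cos; ring.
by rewrite climitB ?climit_delta ?mulrBr//; exact: csummable_delta.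
Qed.

Lemma freq_le_sq (k : K) j : (k ord0 j)%:~R ^+ 2 <= freq_sq R k.
Proof. by rewrite /freq_sq (bigD1 j)//= lerDl sumr_ge0// => i _; exact: sqr_ge0. Qed.

Lemma freq_norm_le (k : K) j : `|(k ord0 j)%:~R : R| <= 1 + freq_sq R k.
Proof.
have := freq_le_sq k j; rewrite -real_normK ?num_real//.
have := normr_ge0 ((k ord0 j)%:~R : R); nra.
Qed.

Lemma weight_succ m (k : K) : (1 + freq_sq R k) * weight R m.+1 k = weight R m k.
Proof.
have q1 : 0 < 1 + freq_sq R k by rewrite ltr_pwDl ?freq_sq_ge0.
by rewrite /weight exprS invfM mulVKf// gt_eqF.
Qed.

Lemma is_derive_trig_series A B (M : R) m j x : (d <= m)%N ->
  (forall k, `|A k| <= M * weight R m.+1 k) -> (forall k, `|B k| <= M * weight R m.+1 k) ->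
  is_derive x (basis_vec R j) (trig_series A B)
    (trig_series (fun k => (k ord0 j)%:~R * B k) (fun k => - ((k ord0 j)%:~R * A k)) x).
Proof.
move=> dm hA hB.
have wle (k : K) : weight R m.+1 k <= weight R m k.
  by rewrite -(weight_succ m) ler_peMl ?lerDl ?freq_sq_ge0//; exact/ltW/weight_gt0.
have M0 : 0 <= M.
  by have := le_trans (normr_ge0 _) (hA 0); rewrite pmulr_lge0// weight_gt0.
have sG : csummable (fun k : K => M * weight R m k) by apply: csummableZ; exact: csummable_weight.
have hA' k : `|A k| <= M * weight R m k by apply: le_trans (hA k) _; rewrite ler_wpM2l.
have hB' k : `|B k| <= M * weight R m k by apply: le_trans (hB k) _; rewrite ler_wpM2l.
have hk (C : K -> R) k : `|C k| <= M * weight R m.+1 k ->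
    `|(k ord0 j)%:~R * C k| <= M * weight R m k.
  move=> hC; rewrite normrM -weight_succ mulrCA.
  by apply: ler_pM => //; exact: freq_norm_le.
have hdA (k : K) : `|- ((k ord0 j)%:~R * A k)| <= M * weight R m k by rewrite normrN; exact: hk.
have hdB (k : K) : `|(k ord0 j)%:~R * B k| <= M * weight R m k by exact: hk.
have [S hS] := csummableZ 2 sG.
apply: line_is_derive; apply: (@is_derive_quadratic _ _ S) => s.
have sT y : csummable (trig_term A B y) := csummable_trig sG hA' hB' y.
have sd := csummable_trig sG hdB hdA x.
have ssd := csummableZ s sd.
have sBT := csummableB (sT (x + s *: basis_vec R j)) (sT x).
rewrite scale0r addr0 /trig_series -(climitZ s sd) -(climitB (sT _) (sT x)) -(climitB sBT ssd).
apply: climit_norm_le => N; apply: le_trans (_ : s ^+ 2 * csum N (fun k : K => 2 * (M * weight R m k)) <= _); last first.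
  rewrite mulrC ler_wpM2r ?sqr_ge0//; apply: le_trans (hS N).
  by apply: csum_le => k; exact: ler_norm.
rewrite -csumZ; apply: csum_le => k; rewrite /trig_term.
rewrite freq_dotD freq_dotZ freq_dot_basis.
set a := freq_dot k x; set q : R := (k ord0 j)%:~R.
have -> : A k * cos (a + s * q) + B k * sin (a + s * q) - (A k * cos a + B k * sin a) -
   s * (q * B k * cos a + - (q * A k) * sin a) =
   A k * (cos (a + s * q) - cos a + (s * q) * sin a) + B k * (sin (a + s * q) - sin a - (s * q) * cos a) by ring.
have h1 := cos_taylor a (s * q); have h2 := sin_taylor a (s * q).
apply: le_trans (ler_normD _ _) _; rewrite !normrM.
have q2 : q ^+ 2 * weight R m.+1 k <= weight R m k.
  rewrite -(weight_succ m); apply: ler_wpM2r; first exact/ltW/weight_gt0.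
  by apply: le_trans (freq_le_sq k j) _; rewrite lerDr.
have aux (C : K -> R) (u : R) : `|C k| <= M * weight R m.+1 k -> `|u| <= (s * q) ^+ 2 ->
    `|C k| * `|u| <= s ^+ 2 * (M * weight R m k).
  move=> hC hu; apply: le_trans (ler_pM _ _ hC hu) _ => //.
  rewrite exprMn mulrCA ler_wpM2l ?sqr_ge0// -mulrA ler_wpM2l//.
  by rewrite mulrC.
rewrite [2 * _]mulr_natl mulr2n mulrDr; apply: lerD; exact: aux.
Qed.

(** The real part of the complex coefficient times the exponential is the sum of the
    cosine and sine terms, so all later work is with real series. *)
Lemma fourier_multiplierE (m : K -> R) (f : E -> R) : ctorus f ->
  fourier_multiplier m f = trig_series (fun k => m k * cos_coef f k) (fun k => m k * sin_coef f k).
Proof.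
move=> cf; apply/funext => x; congr (limn _); apply/funext => N.
apply: eq_fsbigr => k _; rewrite /trig_term /fourier_coef /expi/=.
rewrite -[(2 * pi) ^- d * _]/(mean (fun y => f y * cos (- freq_dot k y))).
rewrite -[(2 * pi) ^- d * torus_integral (fun y => f y * sin (- freq_dot k y))]/(mean (fun y => f y * sin (- freq_dot k y))).
have -> : mean (fun y => f y * cos (- freq_dot k y)) = cos_coef f k.
  by congr mean; apply/funext => y; rewrite cosN.
have -> : mean (fun y => f y * sin (- freq_dot k y)) = - sin_coef f k.
  rewrite /sin_coef -meanN; last by apply: ctorusM => //; exact: ctorus_sin.
  by congr mean; apply/funext => y; rewrite sinN mulrN.
by ring.
Qed.

Lemma expR_ge_pow (y : R) m : 0 <= y -> (1 + y / m.+1%:R) ^+ m.+1 <= expR y.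
Proof.
move=> y0; have -> : expR y = expR (y / m.+1%:R) ^+ m.+1.
  by rewrite -expRM_natl -mulr_natl mulrC divfK.
by rewrite lerXn2r ?nnegrE ?expR_ge0 ?addr_ge0 ?divr_ge0// expR_ge1Dx.
Qed.

(** The exponential beats every power, so the semigroup maps bounded coefficients to
    summable ones at positive times. *)
Lemma semigroup_decay (a : R) m : 0 < a -> exists2 C : R, 0 <= C &
  forall k : K, expR (- (a * freq_sq R k ^+ 2)) <= C * weight R m.+1 k.
Proof.
move=> a0; pose c : R := 2 + m.+1%:R / a.
have m0 : 0 < m.+1%:R :> R by [].
have c2 : 2 <= c by rewrite lerDl divr_ge0 ?ltW.
have c0 : 0 < c by apply: lt_le_trans c2.
exists (c ^+ m.+1) => [|k]; first by rewrite exprn_ge0// ltW.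
have q0 := freq_sq_ge0 R k.
have q1 : 0 < 1 + freq_sq R k by apply: ltr_pwDl.
rewrite expRN /weight -[leRHS]invrK invfM invrK -exprVn -exprMn lef_pV2 ?posrE; last 2 first.
- exact: expR_gt0.
- by rewrite exprn_gt0// mulr_gt0// invr_gt0.
apply: le_trans (expR_ge_pow m _); last by rewrite mulr_ge0 ?sqr_ge0// ltW.
have h2 : 0 <= a * freq_sq R k ^+ 2 / m.+1%:R by rewrite divr_ge0// mulr_ge0 ?sqr_ge0// ltW.
rewrite lerXn2r// ?nnegrE; [by rewrite mulr_ge0 ?invr_ge0 ?ltW|by rewrite addr_ge0|].
rewrite mulrC ler_pdivrMr//.
have -> : (1 + a * freq_sq R k ^+ 2 / m.+1%:R) * c = 2 + m.+1%:R / a + 2 * (a * freq_sq R k ^+ 2 / m.+1%:R) + freq_sq R k ^+ 2.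
  rewrite /c; move: (m.+1%:R : R) m0 => y y0.
  by field; rewrite !gt_eqF.
have h1 : 0 <= m.+1%:R / a by rewrite divr_ge0// ltW.
have h3 : freq_sq R k <= 1 + freq_sq R k ^+ 2.
  by move: (freq_sq R k) => q; have := sqr_ge0 (q - 1); nra.
move: h1 h2 h3; set u := m.+1%:R / a; set v := _ / m.+1%:R; move: (freq_sq R k ^+ 2) => w.
by lra.
Qed.

End TrigSeries.

(** * The singular weight in time *)

Lemma continuous_exprn_at (R : realType) (T : topologicalType) (f : T -> R) (x : T) n :
  {for x, continuous f} -> {for x, continuous (fun y => f y ^+ n)}.
Proof.
move=> cf; elim: n => [|n IH].
  have -> : (fun y => f y ^+ 0) = cst 1 by apply/funext => y; rewrite expr0.
  exact: cst_continuous.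
have -> : (fun y => f y ^+ n.+1) = (fun y => f y * f y ^+ n) by apply/funext => y; rewrite exprS.
exact: continuousM.
Qed.

Section Singular.
Variable R : realType.
Local Notation mu := (@lebesgue_measure R).

Definition root4 (s : R) : R := s `^ 4^-1.

Lemma root4_gt0 s : 0 < s -> 0 < root4 s.
Proof. exact: powR_gt0. Qed.

Lemma root4_ge0 s : 0 <= root4 s.
Proof. exact: powR_ge0. Qed.

Lemma root4X s : 0 <= s -> root4 s ^+ 4 = s.
Proof. by move=> s0; rewrite -powR_mulrn ?powR_ge0// -powRrM mulVf ?powRr1. Qed.

Lemma root4_le s r : 0 <= s -> s <= r -> root4 s <= root4 r.
Proof. by move=> s0 sr; apply: ge0_ler_powR; rewrite ?nnegrE ?(le_trans s0 sr). Qed.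

Lemma is_derive_root4 (s : R) : 0 < s ->
  is_derive s (1 : R) root4 (4^-1 * root4 s ^- 3).
Proof.
move=> s0; have := is_derive1_powR 4^-1 s0; congr is_derive; congr (_ * _).
have w0 := root4_gt0 s0.
rewrite powRB ?(gt_eqF s0) ?implybT// powRr1 ?(ltW s0)// -{2}(root4X (ltW s0)) -/(root4 s).
by field; rewrite gt_eqF.
Qed.

Lemma continuous_root4 (s : R) : 0 < s -> {for s, continuous root4}.
Proof.
move=> s0; apply/differentiable_continuous/derivable1_diffP.
by have := is_derive_root4 s0 => ?; exact: ex_derive.
Qed.

(** A nonnegative function with a bounded primitive on the open interval is integrable:
    the integrals over an exhaustion by segments are bounded. The endpoints may be
    singular. *)
Lemma ge0_integral_open_le (f F : R -> R) (a b C : R) : a < b ->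
  (forall s, a < s < b -> is_derive s (1 : R) F (f s)) ->
  (forall s, a < s < b -> {for s, continuous f}) ->
  (forall s, a < s < b -> 0 <= f s) -> (forall s, a < s < b -> `|F s| <= C) ->
  mu.-integrable `]a, b[ (EFin \o f).
Proof.
move=> ab dF cf f0 FC.
have mf : measurable_fun `]a, b[ f.
  apply: open_continuous_measurable_fun; first exact: interval_open.
  by move=> s /set_mem/=; rewrite in_itv/= => /cf.
pose e n : R := (b - a) / n.+3%:R.
have e0 n : 0 < e n by rewrite divr_gt0 ?subr_gt0.
have e2 n : 2 * e n < b - a.
  rewrite /e mulrA ltr_pdivrMr// mulrC ltr_pM2l ?subr_gt0// ltr_nat.
  by [].
pose J n : set (measurableTypeR R) := `[a + e n, b - e n]%classic.
have Jsub n : J n `<=` `]a, b[%classic.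
  rewrite /J => s /=; rewrite !in_itv/= => /andP[h1 h2]; rewrite (lt_le_trans _ h1) ?ltrDl//=.
  by rewrite (le_lt_trans h2)// ltrBlDr ltrDl.
have Jab n s : J n s -> a < s < b by move=> /Jsub/=; rewrite in_itv.
have ndJ : nondecreasing_seq J.
  move=> n m nm; apply/subsetPset; rewrite /J => s /=; rewrite !in_itv/= => /andP[h1 h2].
  have : e m <= e n by rewrite ler_pM2l ?subr_gt0// lef_pV2 ?posrE// ler_nat !ltnS.
  by move=> ?; apply/andP; split; lra.
have UJ : \bigcup_n J n = `]a, b[%classic.
  apply/seteqP; split => [s [n _ /Jsub]//|s /=]; rewrite in_itv/= => /andP[h1 h2].
  pose m := Num.min (s - a) (b - s).
  have m0 : 0 < m by rewrite lt_min !subr_gt0 h1.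
  have [n hn] : exists n : nat, (b - a) / m < n%:R.
    by exists (Num.trunc ((b - a) / m)).+1; rewrite truncnS_gt.
  have em : e n < m.
    rewrite /e ltr_pdivrMr// mulrC -ltr_pdivrMr//; apply: lt_le_trans hn _.
    by rewrite ler_nat; lia.
  exists n => //; rewrite /J /= in_itv/=.
  have : m <= s - a by rewrite ge_min lexx.
  have : m <= b - s by rewrite ge_min lexx orbT.
  by move=> ? ?; apply/andP; split; lra.
apply/integrableP; split; first exact/measurable_EFinP.
have -> : (\int[mu]_(x in `]a, b[) `|(EFin \o f) x| = \int[mu]_(x in `]a, b[) (f x)%:E)%E.
  apply: eq_integral => s /set_mem/=; rewrite in_itv/= => /f0 fs.
  by rewrite ger0_norm.
have cv : (\int[mu]_(x in J n) (f x)%:E)%E @[n --> \oo] --> (\int[mu]_(x in \bigcup_n J n) (f x)%:E)%E.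
  have := @ge0_nondecreasing_set_cvg_integral _ _ R J (EFin \o f) mu ndJ; apply.
  - by move=> n; exact: measurable_itv.
  - by move=> n; apply/measurable_EFinP; apply: measurable_funS mf => //; exact: Jsub.
  - by move=> n s /Jab/f0; rewrite lee_fin.
rewrite -UJ -(cvg_lim _ cv)//.
apply: le_lt_trans (ltry (2 * C)); apply: lime_le; first exact: cvgP cv.
apply: nearW => n.
have ltJ : a + e n < b - e n by have := e2 n; lra.
have inJ s : a + e n <= s <= b - e n -> a < s < b by move=> h; apply: (Jab n); rewrite /J/= in_itv.
rewrite (@continuous_FTC2 R f F)//.
- have h1 : `|F (a + e n)| <= C by apply: FC; apply: inJ; rewrite lexx ltW.
  have h2 : `|F (b - e n)| <= C by apply: FC; apply: inJ; rewrite lexx andbT ltW.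
  rewrite -EFinB lee_fin; move: h1 h2; rewrite !ler_norml => /andP[? ?] /andP[? ?]; lra.
- apply: continuous_in_subspaceT => s /set_mem/=; rewrite in_itv/= => /inJ; exact: cf.
- have cF s : a < s < b -> {for s, continuous F}.
    move=> /dF ?; apply/differentiable_continuous/derivable1_diffP; exact: ex_derive.
  split.
  + move=> s; rewrite in_itv/= => /andP[h1 h2].
    have /dF ? : a < s < b by apply: inJ; rewrite !ltW.
    exact: ex_derive.
  + apply: cvg_at_right_filter; apply: cF; apply: inJ; by rewrite lexx ltW.
  + apply: cvg_at_left_filter; apply: cF; apply: inJ; by rewrite lexx andbT ltW.
- move=> s; rewrite in_itv/= => /andP[h1 h2].
  have /dF ? : a < s < b by apply: inJ; rewrite !ltW.
  by rewrite derive1E derive_val.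
Qed.

(** Integrable majorant of the Duhamel integrand, with its two endpoint singularities of
    order 3/4. *)
Definition sing (t s : R) : R := 1 + root4 s ^- 3 + root4 (t - s) ^- 3.

Lemma is_derive_root4_reflect (t s : R) : s < t ->
  is_derive s (1 : R) (fun s => root4 (t - s)) (- (4^-1 * root4 (t - s) ^- 3)).
Proof.
move=> st; have ts : 0 < t - s by rewrite subr_gt0.
have h : is_derive s (1 : R) (fun s : R => t - s) (-1).
  have := @is_deriveB _ _ _ (cst t) (@id R) s 1 0 1 (is_derive_cst _ _ _) (is_derive_id _ _).
  by rewrite sub0r.
have := @is_derive1_comp _ root4 (fun s => t - s) s _ _ (is_derive_root4 ts) h.
by rewrite mulrN1.
Qed.

Lemma integrable_sing t : 0 < t -> mu.-integrable `]0, t[ (EFin \o sing t).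
Proof.
move=> t0.
pose F s := s + 4 * root4 s - 4 * root4 (t - s).
apply: (@ge0_integral_open_le (sing t) F 0 t (t + 4 * root4 t + 4 * root4 t) t0).
- move=> s /andP[s0 st].
  have h1 := is_deriveZ 4 (is_derive_root4 s0).
  have h2 := is_deriveZ 4 (is_derive_root4_reflect st).
  apply: (is_derive_eq (is_deriveB (is_deriveD (is_derive_id s (1:R)) h1) h2)).
  rewrite /sing /GRing.scale/= mulrN opprK !mulrA mulfV// !mul1r//.
- move=> s /andP[s0 st].
  have c1 : {for s, continuous (fun s => root4 s ^- 3)}.
    apply: continuousV; first by rewrite expf_neq0// gt_eqF// root4_gt0.
    by apply: continuous_exprn_at; exact: continuous_root4.
  have c2 : {for s, continuous (fun s => root4 (t - s) ^- 3)}.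
    have ts : 0 < t - s by rewrite subr_gt0.
    apply: continuousV; first by rewrite expf_neq0// gt_eqF// root4_gt0.
    apply: continuous_exprn_at; apply/differentiable_continuous/derivable1_diffP.
    by have := is_derive_root4_reflect st => ?; exact: ex_derive.
  by apply: continuousD => //; apply: continuousD => //; exact: cst_continuous.
- move=> s /andP[s0 st].
  by rewrite !addr_ge0 ?invr_ge0 ?exprn_ge0 ?root4_ge0.
- move=> s /andP[s0 st].
  have h1 := root4_le (ltW s0) (ltW st).
  have h2 : root4 (t - s) <= root4 t by apply: root4_le; lra.
  have := root4_ge0 s; have := root4_ge0 (t - s).
  by rewrite ler_norml => ? ?; apply/andP; split; rewrite /F; lra.
Qed.

(** One of [s] and [t - s] is at least [t / 2], so the product of the two singularities is
    dominated by their sum. *)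
Lemma sing_ge t s : 0 < s < t ->
  root4 s ^- 3 * (root4 (t - s))^-1 <= ((root4 (t / 2))^-1 + root4 (t / 2) ^- 3) * sing t s.
Proof.
move=> /andP[s0 st].
have a0 : 0 < (root4 s)^-1 by rewrite invr_gt0 root4_gt0.
have b0 : 0 < (root4 (t - s))^-1 by rewrite invr_gt0 root4_gt0// subr_gt0.
have B0 : 0 < (root4 (t / 2))^-1 by rewrite invr_gt0 root4_gt0// divr_gt0//; lra.
have h : (root4 s)^-1 <= (root4 (t / 2))^-1 \/ (root4 (t - s))^-1 <= (root4 (t / 2))^-1.
  have [h|h] := leP (t / 2) s; [left|right]; rewrite lef_pV2 ?posrE ?root4_gt0//; try lra;
  apply: root4_le; lra.
rewrite /sing -!exprVn; move: a0 b0 B0 h.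
set a := (root4 s)^-1; set b := (root4 (t - s))^-1; set B := (root4 (t / 2))^-1.
move=> a0 b0 B0; have a3 : 0 < a ^+ 3 by rewrite exprn_gt0.
have b3 : 0 < b ^+ 3 by rewrite exprn_gt0.
have B3 : 0 < B ^+ 3 by rewrite exprn_gt0.
have b13 : b <= 1 + b ^+ 3.
  have : b <= 1 \/ 1 <= b by case: (leP b 1) => ?; [left|right; rewrite ltW].
  by case=> h1; [lra|have : b * 1 <= b * b ^+ 2 by rewrite ler_pM2l// exprn_ege1//]; rewrite -exprS; lra.
case=> [aB|bB].
  have h3 : a ^+ 3 <= B ^+ 3 by apply: lerXn2r => //; rewrite nnegrE ltW.
  by apply: le_trans (_ : B ^+ 3 * (1 + b ^+ 3) <= _); nra.
by apply: le_trans (_ : a ^+ 3 * B <= _); nra.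
Qed.

End Singular.

(** * Time continuity and bounds for mild solutions *)

Section TimeContinuity.
Variables (R : realType) (d : nat).
Local Notation E := 'rV[R]_d.
Local Notation ctorus := (@ctorus R d).
Implicit Types (u v : R -> E -> R).

(** Uniform convergence in space as time varies, away from time 0: the slopes of a mild
    solution may grow like [t^(-1/4)] there. *)
Definition tcont (T : R) u :=
  (forall t, 0 < t <= T -> ctorus (u t)) /\
  (forall t, 0 < t <= T -> forall e : R, 0 < e -> exists2 del : R, 0 < del &
    forall r, 0 < r <= T -> `|r - t| < del -> forall x, `|u r x - u t x| <= e).

Lemma tcont_time T (g : R -> R) : (forall t, 0 < t <= T -> {for t, continuous g}) ->
  tcont T (fun t _ => g t).
Proof.
move=> cg; split=> [t _|t tT e e0]; first exact: ctorus_cst.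
have /cvgrPdist_le/(_ e e0)/nbhs_ballP[del /= del0 hdel] := cg t tT.
exists del => // r _ rt x; rewrite distrC; apply: hdel.
by rewrite /ball/= distrC.
Qed.

Lemma tcontD T u v : tcont T u -> tcont T v -> tcont T (fun t x => u t x + v t x).
Proof.
move=> [cu hu] [cv hv]; split=> [t tT|t tT e e0].
  by apply: ctorusD; [exact: cu|exact: cv].
have e2 : 0 < e / 2 by rewrite divr_gt0.
have [d1 d10 h1] := hu t tT _ e2; have [d2 d20 h2] := hv t tT _ e2.
exists (Num.min d1 d2) => [|r rT]; first by rewrite lt_min d10.
rewrite lt_min => /andP[r1 r2] x; have := h1 r rT r1 x; have := h2 r rT r2 x.
rewrite opprD addrACA; have := ler_normD (u r x - u t x) (v r x - v t x).
by lra.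
Qed.

Lemma tcontM T u v : tcont T u -> tcont T v -> tcont T (fun t x => u t x * v t x).
Proof.
move=> [cu hu] [cv hv]; split=> [t tT|t tT e e0].
  by apply: ctorusM; [exact: cu|exact: cv].
have [M hM] := ctorus_bounded (cu t tT); have [N hN] := ctorus_bounded (cv t tT).
have M0 : 0 <= M by apply: le_trans (hM 0).
have N0 : 0 <= N by apply: le_trans (hN 0).
pose e1 := Num.min 1 (e / (M + N + 1)).
have MN : 0 < M + N + 1 by lra.
have e10 : 0 < e1 by rewrite lt_min ltr01 divr_gt0.
have e1l : e1 <= 1 by rewrite ge_min lexx.
have e1e : e1 * (M + N + 1) <= e by rewrite -ler_pdivlMr// ge_min lexx orbT.
have [d1 d10 h1] := hu t tT _ e10; have [d2 d20 h2] := hv t tT _ e10.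
exists (Num.min d1 d2) => [|r rT]; first by rewrite lt_min d10.
rewrite lt_min => /andP[r1 r2] x; have k1 := h1 r rT r1 x; have k2 := h2 r rT r2 x.
have -> : u r x * v r x - u t x * v t x = (u r x - u t x) * (v r x - v t x) +
  (u r x - u t x) * v t x + u t x * (v r x - v t x) by ring.
apply: le_trans e1e.
apply: le_trans (ler_normD _ _) _.
apply: le_trans (lerD (ler_normD _ _) (lexx _)) _; rewrite !normrM.
have l1 : `|u r x - u t x| * `|v r x - v t x| <= e1 * 1.
  by apply: ler_pM => //; exact: le_trans e1l.
have l2 : `|u r x - u t x| * `|v t x| <= e1 * N by apply: ler_pM.
have l3 : `|u t x| * `|v r x - v t x| <= M * e1 by apply: ler_pM.
by lra.
Qed.

Lemma tcont_cst T (f : E -> R) : ctorus f -> tcont T (fun=> f).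
Proof.
move=> cf; split=> [//|t _ e e0]; exists 1 => // r _ _ x.
by rewrite subrr normr0 ltW.
Qed.

Lemma tcontB T u v : tcont T u -> tcont T v -> tcont T (fun t x => u t x - v t x).
Proof.
move=> cu cv; have := tcontD cu (tcontM (tcont_cst T (ctorus_cst d (-1 : R))) cv).
congr tcont; apply/funext => t; apply/funext => x.
by rewrite mulN1r.
Qed.

Lemma tcont_sum T (I : Type) (r : seq I) (P : pred I) (F : I -> R -> E -> R) :
  (forall i, P i -> tcont T (F i)) -> tcont T (fun t x => \sum_(i <- r | P i) F i t x).
Proof.
move=> cF; elim: r => [|i r IH].
  have := tcont_cst T (ctorus_cst d (0 : R)); congr tcont.
  by apply/funext => t; apply/funext => x; rewrite big_nil.
case Pi : (P i); last first.
  by move: IH; congr tcont; apply/funext => t; apply/funext => x; rewrite big_cons Pi.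
have := tcontD (cF i Pi) IH; congr tcont.
by apply/funext => t; apply/funext => x; rewrite big_cons Pi.
Qed.

Lemma tcont_mean T u : tcont T u -> forall t, 0 < t < T ->
  {for t, continuous (fun s => mean (u s))}.
Proof.
move=> [cu hu] t /andP[t0 tT]; apply/cvgrPdist_le => e e0.
have tT' : 0 < t <= T by rewrite t0 ltW.
have [del del0 hdel] := hu t tT' e e0.
near=> r.
have rt : `|r - t| < del by near: r; apply/nbhs_ballP; exists del => //= y; rewrite /ball/= distrC.
have rT : 0 < r <= T.
  apply/andP; split; first by near: r; exact: lt_nbhsr.
  by apply: ltW; near: r; exact: lt_nbhsl.
rewrite -meanB; [|exact: cu|exact: cu].
apply: normr_mean_le; first by apply: ctorusB; exact: cu.
by move=> x; rewrite distrC; exact: hdel.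
Unshelve. all: by end_near. Qed.

Lemma eucl_norm_ge (v : E) j : `|v ord0 j| <= eucl_norm v.
Proof.
rewrite -sqrtr_sqr ler_sqrt ?sumr_ge0//; last by move=> i _; exact: sqr_ge0.
by rewrite (bigD1 j)//= lerDl sumr_ge0// => i _; exact: sqr_ge0.
Qed.

Lemma eucl_norm_sq (v : E) : eucl_norm v ^+ 2 = \sum_j v ord0 j ^+ 2.
Proof. by rewrite sqr_sqrtr// sumr_ge0// => j _; exact: sqr_ge0. Qed.

Lemma sup_norm_lt (F : E -> E) (e : R) : (sup_norm F < e%:E)%E -> forall x j, `|F x ord0 j| <= e.
Proof.
move=> h x j; apply: le_trans (eucl_norm_ge _ _) _.
rewrite -lee_fin; apply: le_trans (ltW h); apply: ereal_sup_ubound.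
by exists x.
Qed.

Lemma cvg0e_lt (F : set_system R) {FF : Filter F} (g : R -> \bar R) (e : R) : 0 < e ->
  g @ F --> 0%E -> \forall r \near F, (g r < e%:E)%E.
Proof.
move=> e0 gF.
have n0 : nbhs (0%E : \bar R) [set y | (y < e%:E)%E].
  by apply: open_nbhs_nbhs; split; [exact: open_ereal_lt_ereal|rewrite /= lte_fin].
exact: gF n0.
Qed.

Section Mild.
Variables (nu T : R) (h0 : E -> R) (h : R -> E -> R).
Hypotheses (T0 : 0 < T) (mh : mild_solution nu h0 T h).

Lemma mild_C1 t : 0 <= t <= T -> torus_periodic (h t) /\ C1 (h t).
Proof. by case: mh => hC _ _ _ _ tT; apply: hC; rewrite in_itv. Qed.

Lemma mild_ctorus_partial t j : 0 <= t <= T -> ctorus (partial j (h t)).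
Proof. by move=> /mild_C1[p c]; have [_] := C1_ctorus p c. Qed.

Lemma mild_near t (e : R) : 0 <= t <= T -> 0 < e ->
  \forall r \near within `[0, T]%classic (nbhs t), forall x j,
    `|root4 r * partial j (h r) x - root4 t * partial j (h t) x| <= e.
Proof.
case: mh => _ _ hc0 _ _ tT e0.
have [|_ cv] := hc0 t; first by rewrite in_itv.
have FFw : Filter (within `[0, T]%classic (nbhs t)) by exact: within_filter.
have hn := cvg0e_lt e0 cv.
apply: filterS (hn FFw) => r hr x j.
by have := sup_norm_lt hr x j; rewrite !mxE.
Qed.

(** Compactness of [0, T], since [t^(1/4) grad h] is continuous in time with values in the
    continuous functions. *)
Lemma mild_grad_bound : exists2 M : R, 0 <= M & forall t, 0 <= t <= T -> forall x j,
  `|root4 t * partial j (h t) x| <= M.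
Proof.
have /compact_near_coveringP/near_covering_withinP nc := @segment_compact R 0 T.
have := nc nat \oo (fun n t => forall x j, `|root4 t * partial j (h t) x| <= n%:R).
have hh : forall t, `[0, T]%classic t -> \forall t' \near t & n \near \oo,
    `[0, T]%classic t' -> (fun n t => forall x j, `|root4 t * partial j (h t) x| <= n%:R) n t'.
  move=> t /=; rewrite in_itv/= => tT.
  have hb : exists M : R, forall x j, `|root4 t * partial j (h t) x| <= M.
    have cj j : ctorus (fun x => root4 t * partial j (h t) x).
      by apply: ctorusZ; exact: mild_ctorus_partial.
    have /choice[Mj hMj] j := ctorus_bounded (cj j).
    exists (\sum_j `|Mj j|) => x j; apply: le_trans (hMj j x) _.
    apply: le_trans (ler_norm _) _; rewrite (bigD1 j)//= lerDl; exact: sumr_ge0.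
  have [M hM] := hb.
  exists ([set t' | `[0, T]%classic t' -> forall x j,
     `|root4 t' * partial j (h t') x - root4 t * partial j (h t) x| <= 1],
     [set n : nat | M + 1 <= n%:R]).
    split => /=; first exact: mild_near.
    exists (Num.trunc (M + 1)).+1 => // n /= hn.
    by apply: le_trans (ltW (truncnS_gt _)) _; rewrite ler_nat.
  move=> [t' n] /= [ht' hn] t'T x j; have := ht' t'T x j; have := hM x j.
  have := lerB_dist (root4 t' * partial j (h t') x) (root4 t * partial j (h t) x).
  by lra.
move=> /(_ _ hh)[n _ hn]; exists n%:R => // t tT.
by apply: (hn n) => //=; rewrite in_itv.
Qed.

Lemma mild_tcont_partial j : tcont T (fun t => partial j (h t)).
Proof.
have c1 : tcont T (fun t x => root4 t * partial j (h t) x).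
  split=> [t /andP[t0 tT]|t /andP[t0 tT] e e0].
    by apply: ctorusZ; apply: mild_ctorus_partial; rewrite ltW.
  have /mild_near/(_ e0) : 0 <= t <= T by rewrite ltW.
  rewrite /within/= => /nbhs_ballP[del /= del0 hdel].
  exists del => // r /andP[r0 rT] rt x; apply: hdel; first by rewrite /ball/= distrC.
  by rewrite in_itv/= ltW.
have c2 : tcont T (fun t (_ : E) => (root4 t)^-1).
  apply: tcont_time => t /andP[t0 _].
  apply: continuousV; [by rewrite gt_eqF// root4_gt0|exact: continuous_root4].
have [c3 h3] := tcontM c2 c1; split=> [t /andP[t0 tT]|t tT e e0].
  by apply: mild_ctorus_partial; rewrite ltW.
have [del del0 hdel] := h3 t tT e e0; exists del => // r rT rt x.
have := hdel r rT rt x; have [t0 r0] : 0 < t /\ 0 < r by move: rT tT => /andP[-> _] /andP[-> _].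
by rewrite !mulKf// gt_eqF// root4_gt0.
Qed.

Lemma fluxE (f : E -> R) j x :
  flux f j x = (\sum_i partial i f x ^+ 2 - 1) * partial j f x.
Proof.
by rewrite /flux eucl_norm_sq; congr ((_ - _) * _); apply: eq_bigr => i _; rewrite !mxE.
Qed.

Lemma mild_tcont_flux j : tcont T (fun t => flux (h t) j).
Proof.
have := tcontM (tcontB (@tcont_sum T 'I_d (index_enum 'I_d) xpredT (fun i t x => partial i (h t) x * partial i (h t) x)
   (fun i _ => tcontM (mild_tcont_partial i) (mild_tcont_partial i)))
  (tcont_cst T (ctorus_cst d (1 : R)))) (mild_tcont_partial j).
congr tcont; apply/funext => t; apply/funext => x; rewrite fluxE.
by congr ((_ - _) * _); apply: eq_bigr => i _; rewrite expr2.
Qed.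

(** The flux is cubic in a slope of size [t^(-1/4)]. *)
Lemma mild_flux_bound : exists2 C : R, 0 <= C & forall t, 0 < t <= T -> forall x j,
  `|flux (h t) j x| <= C * root4 t ^- 3.
Proof.
have [M M0 hM] := mild_grad_bound.
exists ((d%:R * M ^+ 2 + (1 + T) ^+ 2) * M); first by rewrite mulr_ge0// addr_ge0 ?sqr_ge0// mulr_ge0// sqr_ge0.
move=> t /andP[t0 tT] x j; have w0 := root4_gt0 t0.
have tT' : 0 <= t <= T by rewrite ltW.
rewrite ler_pdivlMr ?exprn_gt0//.
have wT : root4 t <= 1 + T.
  have := root4X (ltW t0); have [w1|w1] := leP (root4 t) 1; first by lra.
  have : root4 t * 1 <= root4 t * root4 t ^+ 3 by rewrite ler_pM2l// exprn_ege1// ltW.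
  by rewrite mulr1 -exprS; lra.
rewrite fluxE -[X in _ * X]gtr0_norm ?exprn_gt0// -normrM.
have -> : (\sum_i partial i (h t) x ^+ 2 - 1) * partial j (h t) x * root4 t ^+ 3 =
   (\sum_i (root4 t * partial i (h t) x) ^+ 2 - root4 t ^+ 2) * (root4 t * partial j (h t) x).
  under [in RHS]eq_bigr do rewrite exprMn.
  by rewrite -mulr_sumr; ring.
rewrite normrM; apply: ler_pM => //; last exact: hM.
apply: le_trans (ler_normB _ _) _; apply: lerD.
  apply: le_trans (ler_norm_sum _ _ _) _.
  rewrite [leRHS](_ : _ = \sum_(i < d) M ^+ 2); last by rewrite sumr_const card_ord mulr_natl.
  apply: ler_sum => i _; rewrite normrX lerXn2r ?nnegrE//; exact: hM.
rewrite normrX lerXn2r ?nnegrE ?normr_ge0//; first by lra.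
by rewrite gtr0_norm.
Qed.

End Mild.

End TimeContinuity.

(** * The bilaplacian semigroup on Fourier coefficients *)

Section Semigroup.
Variables (R : realType) (d : nat).
Local Notation E := 'rV[R]_d.
Local Notation K := 'rV[int]_d.
Local Notation ctorus := (@ctorus R d).

Definition heat (nu t : R) (k : K) : R := expR (- (nu * t * freq_sq R k ^+ 2)).

Lemma heat_gt0 nu t k : 0 < heat nu t k.
Proof. exact: expR_gt0. Qed.

Lemma cos_coef_le (f : E -> R) M k : ctorus f -> (forall x, `|f x| <= M) -> `|cos_coef f k| <= M.
Proof.
move=> cf hM; apply: normr_mean_le => [|x].
  by apply: ctorusM => //; exact: ctorus_cos0.
rewrite normrM; apply: le_trans (hM x); rewrite ler_piMr//.
by rewrite ler_norml cos_geN1 cos_le1.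
Qed.

Lemma sin_coef_le (f : E -> R) M k : ctorus f -> (forall x, `|f x| <= M) -> `|sin_coef f k| <= M.
Proof.
move=> cf hM; apply: normr_mean_le => [|x].
  by apply: ctorusM => //; exact: ctorus_sin.
rewrite normrM; apply: le_trans (hM x); rewrite ler_piMr//.
by rewrite ler_norml sin_geN1 sin_le1.
Qed.

Lemma freq_dotNl k (x : E) : freq_dot (- k) x = - freq_dot k x.
Proof. by rewrite -[- k]sub0r freq_dotBl [freq_dot 0 x]big1 ?sub0r// => j _; rewrite mxE mul0r. Qed.

Lemma cos_coefN (f : E -> R) k : cos_coef f (- k) = cos_coef f k.
Proof. by congr mean; apply/funext => x; rewrite freq_dotNl cosN. Qed.

Lemma sin_coefN (f : E -> R) k : ctorus f -> sin_coef f (- k) = - sin_coef f k.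
Proof.
move=> cf; rewrite /sin_coef -meanN; last by apply: ctorusM => //; exact: ctorus_sin.
by congr mean; apply/funext => x; rewrite freq_dotNl sinN mulrN.
Qed.

Lemma freq_sqN (k : K) : freq_sq R (- k) = freq_sq R k.
Proof. by apply: eq_bigr => j _; rewrite mxE mulrNz sqrrN. Qed.

Lemma climit_trunc N (F : K -> R) :
  climit (fun k => if k \in freq_cube N then F k else 0) = csum N F /\
  csummable (fun k => if k \in freq_cube N then F k else 0).
Proof.
have h M (G : K -> R) : (N <= M)%N -> csum M (fun k => if k \in freq_cube N then G k else 0) = csum N G.
  move=> NM; have fM := @finite_freq_cube d M.
  rewrite /csum (@fsbigID _ _ _ _ (freq_cube N) (freq_cube M))//=.
  rewrite [X in _ + X]fsbig1 ?addr0; last first.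
    by move=> k [_ /= nk]; rewrite (memNset nk).
  rewrite (_ : freq_cube M `&` freq_cube N = freq_cube N); last first.
    by apply/setIidPr; exact: freq_cube_sub.
  by apply: eq_fsbigr => k ->.
split; first by apply: cvg_lim => //; apply: cvg_near_cst; exists N => // M /= /h.
exists (csum N (fun k => `|F k|)) => M.
apply: le_trans (csum_mono (N := M) (M := maxn M N) _ _) _ => //; first exact: leq_maxl.
rewrite -(h (maxn M N)) ?leq_maxr//; apply: csum_le => k; case: ifP => _ //.
by rewrite normr0.
Qed.

(** Expansion of the nonnegative mean of the square of [f] minus its truncated series. *)
Lemma bessel (f : E -> R) M N : ctorus f -> (forall x, `|f x| <= M) ->
  csum N (fun k => cos_coef f k ^+ 2 + sin_coef f k ^+ 2) <= M ^+ 2.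
Proof.
move=> cf hM.
pose A k := if k \in freq_cube N then cos_coef f k else 0.
pose B k := if k \in freq_cube N then sin_coef f k else 0.
have [_ sA] := climit_trunc N (cos_coef f); have [_ sB] := climit_trunc N (sin_coef f).
pose G k := `|A k| + `|B k|.
have sG : csummable G.
  have [MA hA] := sA; have [MB hB] := sB; exists (MA + MB) => L.
  apply: le_trans (lerD (hA L) (hB L)); rewrite -csumD; apply: csum_le => k.
  by rewrite ger0_norm// addr_ge0.
have hA k : `|A k| <= G k by rewrite lerDl.
have hB k : `|B k| <= G k by rewrite lerDr.
pose P := trig_series A B.
have cP : ctorus P by exact: ctorus_trig_series sG hA hB.
have cube_sym k : (- k \in @freq_cube d N) = (k \in freq_cube N).
  by apply/idP/idP => /set_mem hk; apply/mem_set => j; have := hk j; rewrite mxE normrN.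
have cE k : A k * cos_coef P k = (if k \in freq_cube N then cos_coef f k ^+ 2 else 0).
  rewrite /P (cos_coef_trig_series k sG hA hB) /A cube_sym cos_coefN.
  by case: ifP => _; [field|rewrite mul0r].
have sE k : B k * sin_coef P k = (if k \in freq_cube N then sin_coef f k ^+ 2 else 0).
  rewrite /P (sin_coef_trig_series k sG hA hB) /B cube_sym sin_coefN//.
  by case: ifP => _; [field|rewrite mul0r].
have S1 : mean (fun x => f x * P x) = csum N (fun k => cos_coef f k ^+ 2 + sin_coef f k ^+ 2).
  rewrite (mean_mul_trig_series sG hA hB)//.
  rewrite -(climit_trunc N _).1; congr climit; apply/funext => k.
  by rewrite /A /B; case: ifP => _; [rewrite !expr2|rewrite !mul0r addr0].
have S2 : mean (fun x => P x * P x) = csum N (fun k => cos_coef f k ^+ 2 + sin_coef f k ^+ 2).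
  rewrite (mean_mul_trig_series sG hA hB)//.
  rewrite -(climit_trunc N _).1; congr climit; apply/funext => k.
  by rewrite cE sE; case: ifP => _ //; rewrite addr0.
have : 0 <= mean (fun x => (f x - P x) ^+ 2).
  by apply: mean_ge0 => [|x]; [apply: ctorusX; exact: ctorusB|exact: sqr_ge0].
have -> : mean (fun x => (f x - P x) ^+ 2) = mean (fun x => f x * f x) - 2 * mean (fun x => f x * P x) + mean (fun x => P x * P x).
  rewrite -meanZ; last exact: ctorusM.
  rewrite -meanB; [|exact: ctorusM|by apply: ctorusZ; exact: ctorusM].
  rewrite -meanD; [|by apply: ctorusB; [exact: ctorusM|apply: ctorusZ; exact: ctorusM]|exact: ctorusM].
  by congr mean; apply/funext => x; ring.
rewrite S1 S2 => h.
have : mean (fun x => f x * f x) <= M ^+ 2.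
  apply: le_trans (ler_norm _) _; apply: normr_mean_le => [|x]; first exact: ctorusM.
  by rewrite normrM expr2 ler_pM.
lra.
Qed.

Section Positive.
Variable nu : R.
Hypothesis nu0 : 0 < nu.

(** Optimising [q exp (- 2 c q^2)] over [q]: this is the half-power of smoothing that one
    derivative costs. *)
Lemma heat_decay_mode t k : 0 < t -> freq_sq R k * heat nu t k ^+ 2 <= root4 (nu * t) ^- 2.
Proof.
move=> t0; have nt0 : 0 < nu * t by rewrite mulr_gt0.
have r0 := root4_gt0 nt0; have q0 := freq_sq_ge0 R k.
rewrite -[leRHS]mul1r ler_pdivlMr ?exprn_gt0//.
set z := freq_sq R k * root4 (nu * t) ^+ 2.
have zE : nu * t * freq_sq R k ^+ 2 = z ^+ 2.
  by rewrite -{1}(root4X (ltW nt0)) /z; ring.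
rewrite mulrAC -/z /heat zE expRN exprVn.
rewrite ler_pdivrMr ?exprn_gt0 ?expR_gt0// mul1r.
have e1 := expR_ge1Dx (z ^+ 2).
have z2 := sqr_ge0 z; have z3 := sqr_ge0 (z - 1).
have : 1 <= expR (z ^+ 2) by lra.
move: (expR _) e1 => y e1 y1.
have : y <= y ^+ 2 by rewrite expr2 ler_peMl//; lra.
have : z <= 1 + z ^+ 2 by move: z3; rewrite sqrrB1; nra.
lra.
Qed.

Lemma heat_coef_bound (f : E -> R) M t m : 0 < t -> ctorus f -> (forall x, `|f x| <= M) ->
  exists2 C : R, 0 <= C & (forall k, `|heat nu t k * cos_coef f k| <= C * weight R m.+1 k) /\
     (forall k, `|heat nu t k * sin_coef f k| <= C * weight R m.+1 k).
Proof.
move=> t0 cf hM; have M0 : 0 <= M by apply: le_trans (hM 0).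
have [C C0 hC] := @semigroup_decay R d (nu * t) m (mulr_gt0 nu0 t0).
exists (C * M); first exact: mulr_ge0.
split=> k; rewrite normrM (gtr0_norm (heat_gt0 _ _ _)) mulrAC; apply: ler_pM => //; rewrite ?(ltW (heat_gt0 _ _ _))//.
- exact: hC.
- exact: cos_coef_le.
- exact: hC.
- exact: sin_coef_le.
Qed.

Lemma bilapE (f : E -> R) t : ctorus f ->
  bilap_semigroup nu t f = trig_series (fun k => heat nu t k * cos_coef f k) (fun k => heat nu t k * sin_coef f k).
Proof. exact: fourier_multiplierE. Qed.

Definition dheat t j (f : E -> R) : E -> R :=
  trig_series (fun k => (k ord0 j)%:~R * (heat nu t k * sin_coef f k))
     (fun k => - ((k ord0 j)%:~R * (heat nu t k * cos_coef f k))).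

Lemma partial_bilap (f : E -> R) t j x : 0 < t -> ctorus f ->
  partial j (bilap_semigroup nu t f) x = dheat t j f x.
Proof.
move=> t0 cf; have [M hM] := ctorus_bounded cf.
have [C C0 [hc hs]] := heat_coef_bound d t0 cf hM.
rewrite bilapE//; have [_] := @is_derive_trig_series R d _ _ C d j x (leqnn d) hc hs.
exact.
Qed.

Lemma dheat_coef_bound (f : E -> R) t j : 0 < t -> ctorus f ->
  exists2 C : R, 0 <= C & (forall k : K, `|(k ord0 j)%:~R * (heat nu t k * sin_coef f k)| <= C * weight R d k) /\
     (forall k : K, `|- ((k ord0 j)%:~R * (heat nu t k * cos_coef f k))| <= C * weight R d k).
Proof.
move=> t0 cf; have [M hM] := ctorus_bounded cf.
have [C C0 [hc hs]] := heat_coef_bound d t0 cf hM; exists C => //.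
split=> k; rewrite ?normrN normrM -(weight_succ R d) [leRHS]mulrCA;
  apply: ler_pM; rewrite ?normr_ge0 ?freq_norm_le ?hs ?hc//.
Qed.

Lemma csummable_weight_mul (C : R) : csummable (fun k : K => C * weight R d k).
Proof. by apply: csummableZ; exact: csummable_weight. Qed.

Lemma ctorus_dheat (f : E -> R) t j : 0 < t -> ctorus f -> ctorus (dheat t j f).
Proof.
move=> t0 cf; have [C _ [h1 h2]] := dheat_coef_bound j t0 cf.
exact: ctorus_trig_series (csummable_weight_mul C) h1 h2.
Qed.

Lemma freqN (k : K) j : ((- k) ord0 j)%:~R = - (k ord0 j)%:~R :> R.
Proof. by rewrite mxE mulrNz. Qed.

Lemma cos_coef_dheat (f : E -> R) t j k : 0 < t -> ctorus f ->
  cos_coef (dheat t j f) k = (k ord0 j)%:~R * (heat nu t k * sin_coef f k).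
Proof.
move=> t0 cf; have [C _ [h1 h2]] := dheat_coef_bound j t0 cf.
rewrite (cos_coef_trig_series k (csummable_weight_mul C) h1 h2).
by rewrite freqN sin_coefN// /heat freq_sqN; field.
Qed.

Lemma sin_coef_dheat (f : E -> R) t j k : 0 < t -> ctorus f ->
  sin_coef (dheat t j f) k = - ((k ord0 j)%:~R * (heat nu t k * cos_coef f k)).
Proof.
move=> t0 cf; have [C _ [h1 h2]] := dheat_coef_bound j t0 cf.
rewrite (sin_coef_trig_series k (csummable_weight_mul C) h1 h2).
by rewrite freqN cos_coefN /heat freq_sqN; field.
Qed.

(** The L^1 norm is bounded through the L^2 norm and Bessel's inequality. Summing the
    coefficients in absolute value would give a power of [t] that is not integrable. *)
Lemma mean_dheat_abs (f : E -> R) t j M : 0 < t -> 0 < M -> ctorus f -> (forall x, `|f x| <= M) ->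
  mean (fun x => `|dheat t j f x|) <= M / root4 (nu * t).
Proof.
move=> t0 M0 cf hM; have nt0 : 0 < nu * t by rewrite mulr_gt0.
have r0 := root4_gt0 nt0; set b := M / root4 (nu * t).
have b0 : 0 < b by rewrite divr_gt0.
have cD := ctorus_dheat j t0 cf.
have [C _ [h1 h2]] := dheat_coef_bound j t0 cf.
have D2 : mean (fun x => dheat t j f x * dheat t j f x) <= b ^+ 2.
  rewrite {2}/dheat (mean_mul_trig_series (csummable_weight_mul C) h1 h2)//.
  apply: le_trans (ler_norm _) _; apply: climit_norm_le => N.
  apply: le_trans (_ : root4 (nu * t) ^- 2 * csum N (fun k => cos_coef f k ^+ 2 + sin_coef f k ^+ 2) <= _); last first.
    rewrite /b expr_div_n mulrC; apply: ler_wpM2r; last exact: bessel.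
    by rewrite invr_ge0 exprn_ge0// ltW.
  rewrite -csumZ; apply: csum_le => k; rewrite cos_coef_dheat// sin_coef_dheat//.
  set a := (k ord0 j)%:~R; set e := heat nu t k; set s := sin_coef f k; set c := cos_coef f k.
  have -> : a * (e * s) * (a * (e * s)) + - (a * (e * c)) * - (a * (e * c)) = (a ^+ 2 * e ^+ 2) * (c ^+ 2 + s ^+ 2) by ring.
  rewrite ger0_norm; last first.
    by apply: mulr_ge0; [apply: mulr_ge0; exact: sqr_ge0|apply: addr_ge0; exact: sqr_ge0].
  rewrite ler_wpM2r ?addr_ge0 ?sqr_ge0//; apply: le_trans (heat_decay_mode k t0).
  by rewrite ler_wpM2r ?sqr_ge0//; exact: freq_le_sq.
have cDD : ctorus (fun x => dheat t j f x * dheat t j f x) by exact: ctorusM.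
(* |y| <= y^2 / (2 b) + b / 2, with b the bound on the L^2 norm *)
apply: le_trans (_ : mean (fun x => (2 * b)^-1 * (dheat t j f x * dheat t j f x) + b / 2) <= _).
  apply: le_mean => [||x]; first exact: ctorus_norm.
    by apply: ctorusD; [exact: ctorusZ|exact: ctorus_cst].
  rewrite -[X in _ * X]/(_ ^+ 2) -[X in _ * X + _]real_normK ?num_real//.
  move: (`|dheat t j f x|) => y; rewrite mulrC.
  rewrite -subr_ge0; have -> : y ^+ 2 / (2 * b) + b / 2 - y = (y - b) ^+ 2 / (2 * b) by field; rewrite gt_eqF.
  by rewrite divr_ge0 ?sqr_ge0// mulr_ge0// ltW.
rewrite meanD; [|exact: ctorusZ|exact: ctorus_cst].
rewrite meanZ// mean_cst.
have : (2 * b)^-1 * mean (fun x => dheat t j f x * dheat t j f x) <= (2 * b)^-1 * b ^+ 2.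
  by rewrite ler_wpM2l// invr_ge0 mulr_ge0// ltW.
have -> : (2 * b)^-1 * b ^+ 2 = b / 2 by field; rewrite gt_eqF.
by lra.
Qed.

End Positive.
End Semigroup.

(** * Fubini's theorem for the Duhamel integral *)

Section DuhamelFubini.
Variables (R : realType) (d : nat).
Local Notation E := 'rV[R]_d.
Local Notation K := 'rV[int]_d.
Local Notation ctorus := (@ctorus R d).
Local Notation mu := (@lebesgue_measure R).
Local Notation Tup := (d.-tuple (measurableTypeR R)).

Lemma measurable_sumr dd (X : measurableType dd) (D : set X) (I : Type) (r : seq I) (P : pred I) (F : I -> X -> R) :
  (forall i, P i -> measurable_fun D (F i)) ->
  measurable_fun D (fun x => \sum_(i <- r | P i) F i x).
Proof.
move=> mF; elim: r => [|i r IH].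
  by under eq_fun do rewrite big_nil; exact: measurable_cst.
under eq_fun do rewrite big_cons.
by case Pi : (P i) => //; apply: measurable_funD => //; exact: mF.
Qed.

Variables (nu t C : R) (F : 'I_d -> R -> E -> R).
Hypotheses (nu0 : 0 < nu) (t0 : 0 < t) (C0 : 0 < C).
Hypotheses (cF : forall j, tcont t (F j))
  (hF : forall j s, 0 < s < t -> forall x, `|F j s x| <= C * root4 s ^- 3).

Let I0t (s : R) := 0 < s < t.

Definition duhamel (s : R) (x : E) : R := \sum_j dheat nu (t - s) j (F j s) x.

(** Extended by zero outside ]0, t[ so that joint measurability holds on a full product
    space. *)
Definition dheat_cut j (s : R) (x : E) : R :=
  if I0t s then dheat nu (t - s) j (F j s) x else 0.

Let sub_st s : I0t s -> 0 < t - s.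
Proof. by move=> /andP[_ st]; rewrite subr_gt0. Qed.

Let ctF j s : I0t s -> ctorus (F j s).
Proof. by move=> /andP[s0 st]; apply: (cF j).1; rewrite s0 ltW. Qed.

Lemma continuous_heat (k : K) (s : R) : {for s, continuous (fun s => heat nu (t - s) k)}.
Proof.
apply: (@continuous_comp _ _ _ (fun s => - (nu * (t - s) * freq_sq R k ^+ 2)) expR); last exact: continuous_expR.
apply: continuousN; apply: continuousM; last exact: cst_continuous.
apply: continuousM; first exact: cst_continuous.
by apply: continuousB; [exact: cst_continuous|exact: cvg_id].
Qed.

Lemma measurable_cut (a : R -> R) : (forall s, I0t s -> {for s, continuous a}) ->
  measurable_fun [set: measurableTypeR R] (fun s => if I0t s then a s else 0).
Proof.
move=> ca.
have mI : measurable (`]0, t[%classic : set (measurableTypeR R)) by exact: measurable_itv.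
have ma : measurable_fun `]0, t[ a.
  apply: open_continuous_measurable_fun; first exact: interval_open.
  by move=> s /set_mem/=; rewrite in_itv/= => /ca.
have := (measurable_restrictT a mI).1 ma; congr measurable_fun.
apply/funext => s; rewrite /patch/=.
have -> : (s \in `]0, t[%classic) = I0t s by rewrite mem_setE in_itv.
by [].
Qed.

Lemma continuous_coef j (g : E -> R) s : ctorus g -> I0t s ->
  {for s, continuous (fun s => mean (fun x => F j s x * g x))}.
Proof. move=> cg st; have := tcont_mean (tcontM (cF j) (tcont_cst t cg)); exact. Qed.

(** A pointwise limit of partial sums, each of which is a sum of products of a function of
    time and a function of space. *)
Lemma measurable_dheat_cut j :
  measurable_fun [set: measurableTypeR R * Tup] (fun p => dheat_cut j p.1 (row_of_tuple p.2)).
Proof.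
pose a (k : K) s := if I0t s then (k ord0 j)%:~R * (heat nu (t - s) k * sin_coef (F j s) k) else 0.
pose b (k : K) s := if I0t s then - ((k ord0 j)%:~R * (heat nu (t - s) k * cos_coef (F j s) k)) else 0.
have ma k : measurable_fun [set: measurableTypeR R] (a k).
  apply: measurable_cut => s st; apply: continuousM; first exact: cst_continuous.
  by apply: continuousM; [exact: continuous_heat|apply: continuous_coef => //; exact: ctorus_sin].
have mb k : measurable_fun [set: measurableTypeR R] (b k).
  apply: measurable_cut => s st; apply: continuousN; apply: continuousM; first exact: cst_continuous.
  by apply: continuousM; [exact: continuous_heat|apply: continuous_coef => //; exact: ctorus_cos0].
apply: (@measurable_fun_cvg _ _ _ setT (fun N p => csum N (fun k =>
   a k p.1 * cos (freq_dot k (row_of_tuple p.2)) + b k p.1 * sin (freq_dot k (row_of_tuple p.2))))).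
  move=> N; under eq_fun do rewrite csumE.
  apply: measurable_sumr => c _; apply: measurable_funD.
    apply: measurable_funM.
      by apply: (measurableT_comp (ma _)); exact: measurable_fst.
    apply: (@measurableT_comp _ _ _ _ _ _ (fun y : Tup => cos (freq_dot (cube_pt c) (row_of_tuple y)))); last exact: measurable_snd.
    by apply: (measurable_row_of_tuple (f := fun x => cos (freq_dot (cube_pt c) x))); have [] := @ctorus_cos0 R d (cube_pt c).
  apply: measurable_funM.
    by apply: (measurableT_comp (mb _)); exact: measurable_fst.
  apply: (@measurableT_comp _ _ _ _ _ _ (fun y : Tup => sin (freq_dot (cube_pt c) (row_of_tuple y)))); last exact: measurable_snd.
  by apply: (measurable_row_of_tuple (f := fun x => sin (freq_dot (cube_pt c) x))); have [] := @ctorus_sin R d (cube_pt c).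
move=> [s y] _ /=; rewrite /dheat_cut /a /b; case: ifPn => st.
  have [M _ [h1 h2]] := dheat_coef_bound nu0 j (sub_st st) (ctF j st).
  exact: csummable_cvg (csummable_trig (csummable_weight_mul d M) h1 h2 _).
apply: cvg_near_cst; apply: nearW => N; rewrite csumE big1// => c _.
by rewrite !mul0r addr0.
Qed.

Definition duhamel_cut (s : R) (x : E) : R := \sum_j dheat_cut j s x.

Lemma duhamel_cutE s x : duhamel_cut s x = if I0t s then duhamel s x else 0.
Proof. by rewrite /duhamel_cut /dheat_cut; case: ifP => // _; rewrite big1. Qed.

Lemma ctorus_duhamel s : I0t s -> ctorus (duhamel s).
Proof. by move=> st; apply: ctorus_sum => j _; apply: ctorus_dheat => //; [exact: sub_st|exact: ctF]. Qed.

Lemma ctorus_duhamel_cut s : ctorus (duhamel_cut s).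
Proof.
have -> : duhamel_cut s = if I0t s then duhamel s else cst 0.
  by apply/funext => x; rewrite duhamel_cutE; case: ifP.
by case: ifPn => [/ctorus_duhamel//|_]; exact: ctorus_cst.
Qed.

Definition duhamel_const : R :=
  d%:R * (C / root4 nu * ((root4 (t / 2))^-1 + root4 (t / 2) ^- 3)).

Lemma mean_duhamel_cut_le s :
  mean (fun x => `|duhamel_cut s x|) <= if I0t s then duhamel_const * sing t s else 0.
Proof.
case: ifPn => st; last first.
  rewrite (_ : (fun x => _) = cst 0) ?mean_cst//; apply/funext => x.
  by rewrite duhamel_cutE (negbTE st) normr0.
have cD j : ctorus (dheat nu (t - s) j (F j s)) by apply: ctorus_dheat => //; [exact: sub_st|exact: ctF].
apply: le_trans (_ : mean (fun x => \sum_j `|dheat nu (t - s) j (F j s) x|) <= _).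
  apply: le_mean => [||x]; first exact/ctorus_norm/ctorus_duhamel_cut.
    by apply: ctorus_sum => j _; exact: ctorus_norm.
  by rewrite duhamel_cutE st; exact: ler_norm_sum.
rewrite mean_sum => [|j _]; last exact: ctorus_norm.
have -> : duhamel_const * sing t s = \sum_(j < d) (C / root4 nu * ((root4 (t / 2))^-1 + root4 (t / 2) ^- 3) * sing t s).
  by rewrite sumr_const card_ord -[RHS]mulr_natl mulrA.
apply: ler_sum => j _.
have s0 : 0 < s by case/andP: st.
have M0 : 0 < C * root4 s ^- 3 by rewrite mulr_gt0// invr_gt0 exprn_gt0// root4_gt0.
apply: le_trans (mean_dheat_abs nu0 j (sub_st st) M0 (ctF j st) (hF j st)) _.
have -> : root4 (nu * (t - s)) = root4 nu * root4 (t - s).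
  by apply: powRM; rewrite ltW// sub_st.
have -> : C / root4 s ^+ 3 / (root4 nu * root4 (t - s)) =
    C / root4 nu * (root4 s ^- 3 * (root4 (t - s))^-1).
  rewrite [(root4 nu * _)^-1]invfM.
  by move: (root4 s ^- 3) (root4 nu)^-1 (root4 (t - s))^-1 => u v w; rewrite -!mulrA; congr (_ * _); rewrite !mulrA (mulrC u).
rewrite -(mulrA (C / root4 nu)).
apply: ler_wpM2l; first by rewrite divr_ge0 ?root4_ge0// ltW.
exact: sing_ge.
Qed.

Let f (g : E -> R) (p : measurableTypeR R * Tup) : \bar R :=
  (duhamel_cut p.1 (row_of_tuple p.2) * g (row_of_tuple p.2))%:E.

Let mf g : ctorus g -> measurable_fun [set: measurableTypeR R * Tup] (f g).
Proof.
move=> cg; apply/measurable_EFinP; apply: measurable_funM.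
  by apply: measurable_sumr => j _; exact: measurable_dheat_cut.
apply: (@measurableT_comp _ _ _ _ _ _ (fun y : Tup => g (row_of_tuple y))); last exact: measurable_snd.
by apply: (measurable_row_of_tuple (f := g)); case: cg.
Qed.

Let mass : R := (2 * pi) ^+ d.
Let mass0 : 0 < mass.
Proof. by rewrite exprn_gt0// mulr_gt0// pi_gt0. Qed.

Lemma integral_torus (u : E -> R) : ctorus u ->
  (\int[torus_measure R d]_y (u (row_of_tuple y))%:E = (mass * mean u)%:E)%E.
Proof.
move=> cu; rewrite /mean mulVKf ?gt_eqF// /torus_integral /Rintegral fineK//.
by apply: integrable_fin_num => //; exact: integrable_ctorus.
Qed.

Let mI : measurable (`]0, t[%classic : set (measurableTypeR R)).
Proof. exact: measurable_itv. Qed.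

Lemma integral_cut (v : R -> \bar R) :
  (\int[mu]_s (if I0t s then v s else 0) = \int[mu]_(s in `]0%R, t[) v s)%E.
Proof.
rewrite [RHS]integral_mkcond; apply: eq_integral => s _; rewrite /patch.
by have -> : (s \in `]0, t[%classic) = I0t s by rewrite mem_setE in_itv.
Qed.

Let int_f g : ctorus g -> (mu \x torus_measure R d)%E.-integrable setT (f g).
Proof.
move=> cg; have [Mg hMg] := ctorus_bounded cg.
have Mg0 : 0 <= Mg by apply: le_trans (hMg 0).
apply/(integrable12ltyP _ _ (mf cg)).
set k := mass * Mg * duhamel_const.
have fin : (\int[mu]_(s in `]0%R, t[) (k * sing t s)%:E < +oo)%E.
  have /integrableP[mk] := integrableZl mI k (integrable_sing t0).
  by apply: le_lt_trans; apply: le_trans (lee_abs _) (le_abse_integral mu mI mk).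
apply: le_lt_trans fin; rewrite -integral_cut.
have fE s : (\int[torus_measure R d]_y `|f g (s, y)| = (mass * mean (fun x => `|duhamel_cut s x * g x|))%:E)%E.
  rewrite -(integral_torus (u := fun x => `|duhamel_cut s x * g x|)).
    by apply: eq_integral.
  by apply: ctorus_norm; apply: ctorusM => //; exact: ctorus_duhamel_cut.
apply: ge0_le_integral => //.
- by move=> s _; exact: integral_ge0.
- apply: (measurable_fun_fubini_tonelli_F (m2 := torus_measure R d) (fun p => `|f g p|%E)) => //.
  by apply: measurableT_comp => //; exact: mf.
- have /measurable_int mk := integrableZl mI k (integrable_sing t0).
  have := (measurable_restrictT _ mI).1 mk; congr measurable_fun.
  apply/funext => s; rewrite /patch.
  by have -> : (s \in `]0, t[%classic) = I0t s by rewrite mem_setE in_itv.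
- move=> s _; rewrite fE.
  have -> : (if I0t s then (k * sing t s)%:E else 0)%E = (mass * (Mg * (if I0t s then duhamel_const * sing t s else 0)))%:E.
    by case: ifP => _; rewrite ?mulr0// /k !mulrA.
  rewrite lee_fin; apply: ler_wpM2l; first exact: ltW.
  apply: le_trans (_ : mean (fun x => Mg * `|duhamel_cut s x|) <= _).
    apply: le_mean => [||x].
    + by apply: ctorus_norm; apply: ctorusM => //; exact: ctorus_duhamel_cut.
    + by apply: ctorusZ; apply: ctorus_norm; exact: ctorus_duhamel_cut.
    + by rewrite normrM mulrC ler_wpM2r.
  rewrite meanZ; last by apply: ctorus_norm; exact: ctorus_duhamel_cut.
  by apply: ler_wpM2l => //; exact: mean_duhamel_cut_le.
Qed.

Let inner_f g s : ctorus g -> (\int[torus_measure R d]_y f g (s, y) =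
  if I0t s then (mass * mean (fun x => duhamel s x * g x))%:E else 0)%E.
Proof.
move=> cg; rewrite (integral_torus (u := fun x => duhamel_cut s x * g x)); last first.
  by apply: ctorusM => //; exact: ctorus_duhamel_cut.
case: ifPn => st; last first.
  rewrite (_ : (fun x => _) = cst 0) ?mean_cst ?mulr0//; apply/funext => x.
  by rewrite duhamel_cutE (negbTE st) mul0r.
by congr (_ * mean _)%:E; apply/funext => x; rewrite duhamel_cutE st.
Qed.

Lemma integrable_cut (v : R -> \bar R) :
  mu.-integrable setT (fun s => if I0t s then v s else 0%E) -> mu.-integrable `]0, t[ v.
Proof.
move=> h; apply/(integrable_mkcond _ mI); move: h; congr (mu.-integrable _ _).
apply/funext => s; rewrite /patch.
by have -> : (s \in `]0, t[%classic) = I0t s by rewrite mem_setE in_itv.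
Qed.

Lemma integrable_mean_duhamel g : ctorus g ->
  mu.-integrable `]0, t[ (fun s => (mean (fun x => duhamel s x * g x))%:E).
Proof.
move=> cg; have := integrable_fubini_F (int_f cg).
have -> : fubini_F (torus_measure R d) (f g) =
    (fun s => if I0t s then (mass * mean (fun x => (duhamel s x * g x)%R))%:E else 0)%E.
  by apply/funext => s; rewrite /fubini_F inner_f.
move=> /integrable_cut h; have := integrableZl mI mass^-1 h.
congr (mu.-integrable _ _); apply/funext => s.
by rewrite -EFinM mulKf// gt_eqF.
Qed.

Let one_ctorus : ctorus (fun=> 1).
Proof. exact: ctorus_cst. Qed.

(** Testing the Duhamel integral against [g] commutes with the time integral. Fubini's
    theorem applies because the mean of the absolute value of the integrand is dominated
    by the integrable weight [sing]. *)
Lemma mean_duhamel (g I : E -> R) : ctorus g -> ctorus I ->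
  (forall x, I x = \int[mu]_(s in `]0, t[) duhamel s x) ->
  mean (fun x => I x * g x) = \int[mu]_(s in `]0, t[) mean (fun x => duhamel s x * g x).
Proof.
move=> cg cI hI.
have cIg : ctorus (fun x => I x * g x) by exact: ctorusM.
have FB := Fubini (int_f cg).
have im := integrable_mean_duhamel cg.
have L : (\int[mu]_s \int[torus_measure R d]_y f g (s, y) =
    (mass * \int[mu]_(s in `]0, t[) mean (fun x => (duhamel s x * g x)%R))%:E)%E.
  under eq_integral do rewrite inner_f//.
  rewrite integral_cut EFinM /Rintegral fineK; last exact: integrable_fin_num.
  rewrite -integralZl//; apply: eq_integral => s _; by rewrite EFinM.
have RR : (\int[torus_measure R d]_y \int[mu]_s f g (s, y) = (mass * mean (fun x => (I x * g x)%R))%:E)%E.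
  rewrite -(integral_torus cIg); apply: ae_eq_integral => //.
  - exact: measurable_fubini_G (int_f cg).
  - apply/measurable_EFinP.
    by apply: (measurable_row_of_tuple (f := fun x => I x * g x)); case: cIg.
  - have := ae_integrable2 (int_f one_ctorus); apply: filterS => y i1 _.
    set x := row_of_tuple y.
    have iD : mu.-integrable `]0, t[ (fun s => (duhamel s x)%:E).
      apply: integrable_cut; move: i1; congr (mu.-integrable _ _).
      by apply/funext => s; rewrite /f/= mulr1 duhamel_cutE; case: ifP.
    transitivity (\int[mu]_(s in `]0%R, t[) ((duhamel s x)%:E * (g x)%:E))%E.
      rewrite -integral_cut; apply: eq_integral => s _.
      by rewrite /f/= duhamel_cutE; case: ifP => _; rewrite ?mul0r.
    rewrite integralZr// EFinM hI /Rintegral fineK//.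
    exact: integrable_fin_num.
move: FB; rewrite L RR => -[/esym e].
by apply: (mulfI (x := mass)) e; rewrite gt_eqF.
Qed.

End DuhamelFubini.

(** * Ordinary differential equations for the Fourier coefficients *)

Lemma continuous_sumr_at (R : realType) (T : topologicalType) (I : Type) (r : seq I)
    (P : pred I) (F : I -> T -> R) (x : T) :
  (forall i, P i -> {for x, continuous (F i)}) ->
  {for x, continuous (fun y => \sum_(i <- r | P i) F i y)}.
Proof.
move=> cF; elim: r => [|i r IH].
  by under [X in {for x, continuous X}]eq_fun do rewrite big_nil; exact: cst_continuous.
under [X in {for x, continuous X}]eq_fun do rewrite big_cons.
by case Pi : (P i) => //; apply: continuousD => //; exact: cF.
Qed.

Section VariationOfConstants.
Variable R : realType.
Local Notation mu := (@lebesgue_measure R).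

(** After multiplication by [exp (lam t)] the formula is a primitive of a function
    continuous on ]0, T[ and integrable at 0. *)
Lemma variation_of_constants (lam c0 T : R) (N c : R -> R) :
  (forall t, 0 < t < T -> {for t, continuous N}) ->
  (forall t, 0 < t < T -> mu.-integrable `]0, t[ (fun s => (expR (- (lam * (t - s))) * N s)%:E)) ->
  (forall t, 0 < t < T -> c t = expR (- (lam * t)) * c0 +
     \int[mu]_(s in `]0, t[) (expR (- (lam * (t - s))) * N s)) ->
  forall t, 0 < t < T -> is_derive t (1 : R) c (- (lam * c t) + N t).
Proof.
move=> cN iN hc t tT; pose f s := expR (lam * s) * N s.
pose F y := \int[mu]_(s in `]0, y]) f s.
have fE y s : f s = expR (lam * y) * (expR (- (lam * (y - s))) * N s).
  by rewrite mulrA -expRD; congr (expR _ * _); ring.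
have intf y : 0 < y < T -> mu.-integrable `]0, y[ (fun s => (f s)%:E).
  have mI : measurable (`]0, y[%classic : set (measurableTypeR R)) by exact: measurable_itv.
  move=> yT; have := integrableZl mI (expR (lam * y)) (iN y yT).
  by congr (mu.-integrable _ _); apply/funext => s; rewrite (fE y).
have cE y : 0 < y < T -> c y = expR (- (lam * y)) * (c0 + F y).
  move=> yT; rewrite hc// mulrDr; congr (_ + _).
  rewrite /F -Rintegral_itv_bndo_bndc; last exact: intf.
  rewrite -RintegralZl//; last exact: intf.
  apply: eq_Rintegral => s _; rewrite (fE y) mulrA -expRD.
  by rewrite addNr expR0 mul1r.
have [t0 tlt] : 0 < t /\ t < T by apply/andP.
have cf : {for t, continuous f}.
  apply: continuousM; last exact: cN.
  apply: (@continuous_comp _ _ _ (fun s => lam * s) expR); last exact: continuous_expR.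
  by apply: continuousM; [exact: cst_continuous|exact: cvg_id].
have dF : is_derive t (1 : R) F (f t).
  have [|||//|dF1 dF2] := @continuous_FTC1 R f (BRight 0) t ((t + T) / 2).
  - by lra.
  - apply: (@integrableS _ (measurableTypeR R) R mu `]0, ((t + T) / 2 + T) / 2[ `]0, (t + T) / 2]) => //.
    + by apply: subset_itvl; rewrite bnd_simp; lra.
    + by apply: intf; apply/andP; split; lra.
  - exact: t0.
  have dF2' : 'D_1 F t = f t by rewrite -derive1E; exact: dF2.
  exact: DeriveDef dF1 dF2'.
have dE : is_derive t (1 : R) (fun y => expR (- (lam * y)) * (c0 + F y))
    (- (lam * c t) + N t).
  have d0 : is_derive t (1 : R) (fun y => - lam * y) (- lam).
    have := @is_deriveZ _ _ _ (@id R) (- lam) t 1 _ (is_derive_id _ _).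
    by rewrite /GRing.scale/= mulr1.
  have d1 := @is_derive1_comp _ expR (fun y => - lam * y) t _ _ (is_derive_expR _) d0.
  have d2 : is_derive t (1 : R) (fun y => c0 + F y) (f t).
    by have := @is_deriveD _ _ _ (cst c0) F t 1 _ _ (is_derive_cst _ _ _) dF; rewrite add0r.
  have := @is_deriveM _ _ _ _ t 1 _ _ d1 d2.
  rewrite /GRing.scale/= (_ : (fun y => expR (- (lam * y)) * (c0 + F y)) =
    ((expR \o (fun y => - lam * y)) * (fun y => c0 + F y))); last first.
    by apply/funext => y; rewrite /= -mulNr.
  congr (is_derive _ _ _ _); rewrite (cE t)// /= mulNr.
  have -> : N t = expR (- (lam * t)) * f t by rewrite /f mulrA -expRD addNr expR0 mul1r.
  by ring.
apply: near_eq_is_derive dE.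
near=> y; rewrite cE//; apply/andP; split; near: y; [exact: lt_nbhsr|exact: lt_nbhsl].
Unshelve. all: by end_near. Qed.

End VariationOfConstants.

Section MildCoefficients.
Variables (R : realType) (d : nat).
Local Notation E := 'rV[R]_d.
Local Notation K := 'rV[int]_d.
Local Notation ctorus := (@ctorus R d).
Local Notation mu := (@lebesgue_measure R).
Variables (nu T : R) (h0 : E -> R) (h : R -> E -> R).
Hypotheses (nu0 : 0 < nu) (T0 : 0 < T) (mh : mild_solution nu h0 T h).

Lemma tcontW t (u : R -> E -> R) : t <= T -> tcont T u -> tcont t u.
Proof.
move=> tT [cu hu]; split=> [r /andP[r0 rt]|r /andP[r0 rt] e e0].
  by apply: cu; rewrite r0 (le_trans rt).
have [|del del0 hdel] := hu r _ e e0; first by rewrite r0 (le_trans rt).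
by exists del => // s /andP[s0 st]; apply: hdel; rewrite s0 (le_trans st).
Qed.

Lemma mild_ctorus t : 0 <= t <= T -> ctorus (h t).
Proof. by move=> /(mild_C1 mh)[p c]; have [] := C1_ctorus p c. Qed.

Lemma ctorus_bilap (f : E -> R) t : 0 < t -> ctorus f -> ctorus (bilap_semigroup nu t f).
Proof.
move=> t0 cf; rewrite bilapE//.
have [M hM] := ctorus_bounded cf.
have [C C0 [h1 h2]] := heat_coef_bound nu0 d t0 cf hM.
have h1' k : `|heat nu t k * cos_coef f k| <= C * weight R d k.
  apply: le_trans (h1 k) _; apply: ler_wpM2l => //.
  by rewrite -(weight_succ R d) ler_peMl ?lerDl ?freq_sq_ge0// ltW// weight_gt0.
have h2' k : `|heat nu t k * sin_coef f k| <= C * weight R d k.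
  apply: le_trans (h2 k) _; apply: ler_wpM2l => //.
  by rewrite -(weight_succ R d) ler_peMl ?lerDl ?freq_sq_ge0// ltW// weight_gt0.
exact: ctorus_trig_series (csummable_weight_mul d C) h1' h2'.
Qed.

Lemma coef_bilap (f : E -> R) t k : 0 < t -> ctorus f ->
  cos_coef (bilap_semigroup nu t f) k = heat nu t k * cos_coef f k /\
  sin_coef (bilap_semigroup nu t f) k = heat nu t k * sin_coef f k.
Proof.
move=> t0 cf; rewrite bilapE//.
have [M hM] := ctorus_bounded cf.
have [C C0 [h1 h2]] := heat_coef_bound nu0 d t0 cf hM.
have sw : csummable (fun k : K => C * weight R d.+1 k).
  by apply: csummableZ; exact: csummable_weight.
have hN : heat nu t (- k) = heat nu t k by rewrite /heat freq_sqN.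
split.
  by rewrite (cos_coef_trig_series k sw h1 h2) hN cos_coefN; field.
by rewrite (sin_coef_trig_series k sw h1 h2) hN sin_coefN// ; field.
Qed.

Definition flux_div_cos (u : E -> R) (k : K) : R := \sum_j (k ord0 j)%:~R * sin_coef (flux u j) k.
Definition flux_div_sin (u : E -> R) (k : K) : R := - \sum_j (k ord0 j)%:~R * cos_coef (flux u j) k.

Let mh_h0 : h 0 = h0. Proof. by case: mh => _ _ _ _ []. Qed.

Let flux_bound : exists2 C : R, 0 < C & forall j s, 0 < s <= T -> forall x,
  `|flux (h s) j x| <= C * root4 s ^- 3.
Proof.
have [C C0 hC] := mild_flux_bound mh; exists (C + 1); first by lra.
move=> j s sT x; apply: le_trans (hC s sT x j) _.
have := root4_ge0 s => r0; rewrite ler_wpM2r ?invr_ge0 ?exprn_ge0//; lra.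
Qed.

Section AtTime.
Variables (t : R) (g : E -> R).
Hypotheses (tT : 0 < t <= T) (cg : ctorus g).
Let t0 : 0 < t. Proof. by case/andP: tT. Qed.
Let tleT : t <= T. Proof. by case/andP: tT. Qed.
Let F j s := flux (h s) j.
Let cF j : tcont t (F j).
Proof. exact: tcontW tleT (mild_tcont_flux mh j). Qed.

Lemma measurable_duhamel x : measurable_fun (`]0, t[%classic : set (measurableTypeR R)) (fun s => duhamel nu t F s x).
Proof.
pose y : d.-tuple (measurableTypeR R) := [tuple x ord0 i | i < d].
have yE : row_of_tuple y = x by apply/rowP => i; rewrite mxE tnth_mktuple.
have m1 : measurable_fun [set: measurableTypeR R] (fun s => duhamel_cut nu t F s x).
  apply: measurable_sumr => j _; rewrite -yE.
  exact: (measurableT_comp (measurable_dheat_cut nu0 cF j) (measurable_pair2 y)).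
have mI : measurable (`]0, t[%classic : set (measurableTypeR R)) by exact: measurable_itv.
have := measurable_funS measurableT (@subsetT _ `]0, t[%classic) m1.
apply: eq_measurable_fun => s; rewrite inE/= in_itv/= => st.
by rewrite duhamel_cutE st.
Qed.

Lemma integrable_mild_duhamel :
  mu.-integrable `]0, t[ (fun s => (mean (fun x => duhamel nu t F s x * g x))%:E).
Proof.
have [C C0 hC] := flux_bound.
apply: (@integrable_mean_duhamel R d nu t C F) => // j s /andP[s0 st] x.
by apply: hC; rewrite s0 (le_trans (ltW st)).
Qed.

(** Pairing the mild formula with a test function. The integral over the closed segment
    in the definition equals the one over the open interval, where the integrand is
    known. *)
Lemma mean_mild : mean (fun x => h t x * g x) =
  mean (fun x => bilap_semigroup nu t h0 x * g x) +
  \int[mu]_(s in `]0, t[) mean (fun x => duhamel nu t F s x * g x).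
Proof.
have [C C0 hC] := flux_bound.
have ct0 : ctorus h0 by rewrite -mh_h0; apply: mild_ctorus; rewrite lexx ltW.
have cht : ctorus (h t) by apply: mild_ctorus; rewrite ltW.
have cb := ctorus_bilap t0 ct0.
pose I x := h t x - bilap_semigroup nu t h0 x.
have cI : ctorus I by exact: ctorusB.
have hI x : I x = \int[mu]_(s in `]0, t[) duhamel nu t F s x.
  case: mh => _ _ _ _ [_ /(_ t x)]; rewrite in_itv/= t0 tleT => /(_ isT) e.
  rewrite /I e addrC addKr.
  have divE s : s \in `]0%R, t[%classic ->
      divergence (fun j => bilap_semigroup nu (t - s) (flux (h s) j)) x = duhamel nu t F s x.
    rewrite inE/= in_itv/= => /andP[s0 st]; apply: eq_bigr => j _.
    rewrite partial_bilap ?subr_gt0//; apply: (cF j).1; by rewrite s0 ltW.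
  have mD : measurable_fun (`]0, t[%classic : set (measurableTypeR R))
     (fun s => divergence (fun j => bilap_semigroup nu (t - s) (flux (h s) j)) x).
    by apply: eq_measurable_fun (measurable_duhamel x) => s /divE.
  rewrite /Rintegral integral_itv_bndoo; last exact/measurable_EFinP.
  by congr fine; apply: eq_integral => s /divE ->.
rewrite -(mean_duhamel nu0 t0 C0 cF _ cg cI hI); last first.
  by move=> j s /andP[s0 st] x; apply: hC; rewrite s0 (le_trans (ltW st)).
rewrite -meanD; [|exact: ctorusM..].
by congr mean; apply/funext => x; rewrite /I; ring.
Qed.

Lemma mean_duhamel_cos s k : 0 < s < t ->
  mean (fun x => duhamel nu t F s x * cos (freq_dot k x)) = heat nu (t - s) k * flux_div_cos (h s) k.
Proof.
move=> /andP[s0 st]; have ts : 0 < t - s by rewrite subr_gt0.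
have cFs j : ctorus (F j s) by apply: (cF j).1; rewrite s0 ltW.
under [X in mean X]eq_fun do rewrite /duhamel mulr_suml.
rewrite mean_sum => [|j _]; last by apply: ctorusM; [exact: ctorus_dheat|exact: ctorus_cos0].
rewrite /flux_div_cos mulr_sumr; apply: eq_bigr => j _.
by rewrite -/(cos_coef _ _) cos_coef_dheat// mulrCA.
Qed.

Lemma mean_duhamel_sin s k : 0 < s < t ->
  mean (fun x => duhamel nu t F s x * sin (freq_dot k x)) = heat nu (t - s) k * flux_div_sin (h s) k.
Proof.
move=> /andP[s0 st]; have ts : 0 < t - s by rewrite subr_gt0.
have cFs j : ctorus (F j s) by apply: (cF j).1; rewrite s0 ltW.
under [X in mean X]eq_fun do rewrite /duhamel mulr_suml.
rewrite mean_sum => [|j _]; last by apply: ctorusM; [exact: ctorus_dheat|exact: ctorus_sin].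
rewrite /flux_div_sin mulrN mulr_sumr -sumrN; apply: eq_bigr => j _.
by rewrite -/(sin_coef _ _) sin_coef_dheat// mulrCA.
Qed.

End AtTime.

Lemma continuous_flux_div t k : 0 < t < T ->
  {for t, continuous (fun s => flux_div_cos (h s) k)} /\ {for t, continuous (fun s => flux_div_sin (h s) k)}.
Proof.
move=> tT; split.
  apply: continuous_sumr_at => j _; apply: continuousM; first exact: cst_continuous.
  have := tcont_mean (tcontM (mild_tcont_flux mh j) (tcont_cst T (ctorus_sin R k))) tT; exact.
apply: continuousN; apply: continuous_sumr_at => j _; apply: continuousM; first exact: cst_continuous.
have := tcont_mean (tcontM (mild_tcont_flux mh j) (tcont_cst T (ctorus_cos0 R k))) tT; exact.
Qed.

Lemma is_derive_mild_cos t k : 0 < t < T ->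
  is_derive t (1 : R) (fun s => cos_coef (h s) k)
    (- (nu * freq_sq R k ^+ 2 * cos_coef (h t) k) + flux_div_cos (h t) k).
Proof.
have hE s r : expR (- (nu * freq_sq R k ^+ 2 * (s - r))) = heat nu (s - r) k.
  by rewrite /heat; congr expR; ring.
apply: (@variation_of_constants R _ (cos_coef h0 k) T (fun s => flux_div_cos (h s) k)).
- by move=> s sT; have [] := continuous_flux_div k sT.
- move=> s /andP[s0 sT]; have sT' : 0 < s <= T by rewrite s0 ltW.
  have := integrable_mild_duhamel sT' (ctorus_cos0 R k).
  apply: eq_integrable => // r; rewrite inE/= in_itv/= => rs.
  by rewrite hE mean_duhamel_cos.
- move=> s /andP[s0 sT]; have sT' : 0 < s <= T by rewrite s0 ltW.
  have ct0 : ctorus h0 by rewrite -mh_h0; apply: mild_ctorus; rewrite lexx ltW.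
  rewrite /cos_coef (mean_mild sT' (ctorus_cos0 R k)); congr (_ + _).
    rewrite -/(cos_coef _ _) (coef_bilap k s0 ct0).1 /heat; congr (expR _ * _); ring.
  apply: eq_Rintegral => r; rewrite inE/= in_itv/= => rs.
  by rewrite hE mean_duhamel_cos.
Qed.

Lemma is_derive_mild_sin t k : 0 < t < T ->
  is_derive t (1 : R) (fun s => sin_coef (h s) k)
    (- (nu * freq_sq R k ^+ 2 * sin_coef (h t) k) + flux_div_sin (h t) k).
Proof.
have hE s r : expR (- (nu * freq_sq R k ^+ 2 * (s - r))) = heat nu (s - r) k.
  by rewrite /heat; congr expR; ring.
apply: (@variation_of_constants R _ (sin_coef h0 k) T (fun s => flux_div_sin (h s) k)).
- by move=> s sT; have [] := continuous_flux_div k sT.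
- move=> s /andP[s0 sT]; have sT' : 0 < s <= T by rewrite s0 ltW.
  have := integrable_mild_duhamel sT' (ctorus_sin R k).
  apply: eq_integrable => // r; rewrite inE/= in_itv/= => rs.
  by rewrite hE mean_duhamel_sin.
- move=> s /andP[s0 sT]; have sT' : 0 < s <= T by rewrite s0 ltW.
  have ct0 : ctorus h0 by rewrite -mh_h0; apply: mild_ctorus; rewrite lexx ltW.
  rewrite /sin_coef (mean_mild sT' (ctorus_sin R k)); congr (_ + _).
    rewrite -/(sin_coef _ _) (coef_bilap k s0 ct0).2 /heat; congr (expR _ * _); ring.
  apply: eq_Rintegral => r; rewrite inE/= in_itv/= => rs.
  by rewrite hE mean_duhamel_sin.
Qed.

End MildCoefficients.

(** * Compactness in time, Gronwall and monotonicity *)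

(** Compactness of the segment turns a property that holds locally in time, for large [n],
    into one that holds uniformly. *)
Lemma segment_uniform (R : realType) (a b : R) (P : nat -> R -> Prop) :
  (forall t, a <= t <= b -> exists2 del : R, 0 < del & exists n0, forall n, (n0 <= n)%N ->
     forall r, a <= r <= b -> `|r - t| < del -> P n r) ->
  exists n0, forall n, (n0 <= n)%N -> forall r, a <= r <= b -> P n r.
Proof.
move=> hP.
have /compact_near_coveringP/near_covering_withinP nc := @segment_compact R a b.
have hh : forall t, `[a, b]%classic t -> \forall t' \near t & n \near \oo,
    `[a, b]%classic t' -> P n t'.
  move=> t /=; rewrite in_itv/= => /hP[del del0 [n0 hn0]].
  exists ([set t' | `|t' - t| < del], [set n : nat | (n0 <= n)%N]).
    split => /=; last by exists n0.
    by apply/nbhs_ballP; exists del => //= y; rewrite /ball/= distrC.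
  by move=> [t' n] /= [t'd hn]; rewrite in_itv/= => t'ab; exact: (hn0 n hn t').
have [n0 _ h] := nc nat \oo _ _ hh.
by exists n0 => n hn r rab; apply: h => //=; rewrite in_itv.
Qed.

Lemma is_derive_sumr (R : realType) (I : Type) (r : seq I) (F dF : I -> R -> R) (t : R) :
  (forall i, is_derive t (1 : R) (F i) (dF i t)) ->
  is_derive t (1 : R) (fun s => \sum_(i <- r) F i s) (\sum_(i <- r) dF i t).
Proof.
move=> h; elim: r => [|i r IH].
  rewrite big_nil; under eq_fun do rewrite big_nil; exact: is_derive_cst.
rewrite big_cons; under eq_fun do rewrite big_cons.
exact: (@is_deriveD _ _ _ (F i) _ t 1 _ _ (h i) IH).
Qed.

(** The function [exp (- alpha t) (y t + rho / alpha)] is nonincreasing. Negative [alpha] is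
    allowed; the decay estimates for relaxation equations use that case. *)
Lemma gronwall (R : realType) (y dy : R -> R) (alpha rho t1 t2 : R) : alpha != 0 -> t1 < t2 ->
  (forall t, t1 <= t <= t2 -> is_derive t (1 : R) y (dy t)) ->
  (forall t, t1 <= t <= t2 -> dy t <= alpha * y t + rho) ->
  y t2 + rho / alpha <= expR (alpha * (t2 - t1)) * (y t1 + rho / alpha).
Proof.
move=> a0 t12 yd hy; pose phi t := expR (- alpha * t) * (y t + rho / alpha).
have dphi t : t1 <= t <= t2 -> is_derive t (1 : R) phi (expR (- alpha * t) * (dy t - alpha * y t - rho)).
  move=> tt.
  have d0 : is_derive t (1 : R) (fun y => - alpha * y) (- alpha).
    have := @is_deriveZ _ _ _ (@id R) (- alpha) t 1 _ (is_derive_id _ _).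
    by rewrite /GRing.scale/= mulr1.
  have d1 := @is_derive1_comp _ expR (fun y => - alpha * y) t _ _ (is_derive_expR _) d0.
  have d2 : is_derive t (1 : R) (fun s => y s + rho / alpha) (dy t).
    by have := @is_deriveD _ _ _ y (cst (rho / alpha)) t 1 _ _ (yd t tt) (is_derive_cst _ _ _); rewrite addr0.
  have := @is_deriveM _ _ _ _ t 1 _ _ d1 d2.
  rewrite /GRing.scale/=; congr (is_derive _ _ _ _).
  by field.
have dphi' t : t \in `]t1, t2[ -> is_derive t (1 : R) phi (expR (- alpha * t) * (dy t - alpha * y t - rho)).
  by rewrite in_itv/= => /andP[h1 h2]; apply: dphi; rewrite !ltW.
have cphi : {within `[t1, t2], continuous phi}.
  apply: derivable_within_continuous => t; rewrite in_itv/= => tt.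
  by have [] := dphi t tt.
have [c cin hc] := MVT t12 dphi' cphi.
have : phi t2 <= phi t1.
  rewrite -subr_le0 hc mulr_le0_ge0//; last by rewrite subr_ge0 ltW.
  have cc : t1 <= c <= t2 by move: cin; rewrite in_itv/= => /andP[h1 h2]; rewrite !ltW.
  by rewrite mulr_ge0_le0 ?expR_ge0//; have := hy c cc; lra.
rewrite /phi => h.
have -> : expR (alpha * (t2 - t1)) = expR (alpha * t2) * expR (- alpha * t1) by rewrite -expRD; congr expR; ring.
rewrite -mulrA; apply: le_trans (ler_wpM2l (expR_ge0 (alpha * t2)) h).
by rewrite mulrA -expRD mulNr subrr expR0 mul1r.
Qed.

Section TimeUniform.
Variables (R : realType) (d : nat).
Local Notation E := 'rV[R]_d.
Local Notation K := 'rV[int]_d.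
Local Notation ctorus := (@ctorus R d).
Implicit Types u : R -> E -> R.

Lemma tcont_bounded T t1 u : 0 < t1 -> tcont T u ->
  exists M : R, forall t, t1 <= t <= T -> forall x, `|u t x| <= M.
Proof.
move=> t10 [cu hu].
have [|n hn] := @segment_uniform R t1 T (fun n t => forall x, `|u t x| <= n%:R).
  move=> t /andP[t1t tT]; have t0T : 0 < t <= T by rewrite (lt_le_trans t10).
  have [del del0 hdel] := hu t t0T 1 ltr01; have [M hM] := ctorus_bounded (cu t t0T).
  exists del => //; exists (Num.trunc (M + 1)).+1 => n hn r /andP[t1r rT] rt x.
  have h1 := hdel r _ rt x; have {h1}h1 : `|u r x - u t x| <= 1 by apply: h1; rewrite (lt_le_trans t10).
  have h2 : M + 1 <= n%:R by apply: le_trans (ltW (truncnS_gt _)) _; rewrite ler_nat.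
  have := lerB_dist (u r x) (u t x); have := hM x; lra.
by exists n%:R => t tT x; exact: hn tT x.
Qed.

(** Nearby times share one modulus of continuity, and [fejer_error] depends on the
    modulus only. *)
Lemma tcont_fejer T t1 u (e : R) : 0 < t1 -> tcont T u -> 0 < e ->
  exists n0, forall n, (n0 <= n)%N -> forall t, t1 <= t <= T -> forall x,
    `|u t x - fejer n.+1 (u t) x| <= e.
Proof.
move=> t10 [cu hu] e0.
apply: (@segment_uniform R t1 T (fun n t => forall x, `|u t x - fejer n.+1 (u t) x| <= e)).
move=> t /andP[t1t tT]; have t0T : 0 < t <= T by rewrite (lt_le_trans t10).
have e4 : 0 < e / 4 by rewrite divr_gt0.
have [del del0 hdel] := hu t t0T _ e4; have [C C0 hC] := ctorus_modulus (cu t t0T) e4.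
exists del => //; exists (Num.trunc (C * d%:R / (e / 4))) => n hn r /andP[t1r rT] rt x.
have r0T : 0 < r <= T by rewrite (lt_le_trans t10).
have hm (y z : E) : `|u r y - u r z| <= e * 3 / 4 + C * \sum_j (1 - cos (y ord0 j - z ord0 j)).
  have := hdel r r0T rt y; have := hdel r r0T rt z; have := hC y z.
  rewrite !ler_norml; lra.
apply: le_trans (fejer_error n (cu r r0T) C0 hm x) _.
suff : C * d%:R / n.+1%:R <= e / 4 by move: (C * d%:R / n.+1%:R) => z; lra.
rewrite ler_pdivrMr// [leRHS]mulrC -ler_pdivrMr//; apply: le_trans (ltW (truncnS_gt _)) _.
by rewrite ler_nat.
Qed.

(** With [P] and [Q] the squared lengths, the cubic part of the pairing equals
    [(P + Q) / 2] times the squared distance plus [(P - Q)^2 / 2], hence is nonnegative;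
    only the linear part is left. *)
Lemma flux_monotone (p q : 'I_d -> R) :
  - (\sum_j (p j - q j) ^+ 2) <=
  \sum_j ((\sum_i p i ^+ 2 - 1) * p j - (\sum_i q i ^+ 2 - 1) * q j) * (p j - q j).
Proof.
set P := \sum_i p i ^+ 2; set Q := \sum_i q i ^+ 2.
have -> : \sum_j ((P - 1) * p j - (Q - 1) * q j) * (p j - q j) =
  ((P + Q) / 2 - 1) * (\sum_j (p j - q j) ^+ 2) + (P - Q) ^+ 2 / 2.
  have -> : (P - Q) ^+ 2 / 2 = \sum_j (P - Q) / 2 * (p j ^+ 2 - q j ^+ 2).
    by rewrite -mulr_sumr sumrB -/P -/Q; field.
  rewrite mulr_sumr -big_split/=; by apply: eq_bigr => j _; field.
have P0 : 0 <= P by apply: sumr_ge0 => i _; exact: sqr_ge0.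
have Q0 : 0 <= Q by apply: sumr_ge0 => i _; exact: sqr_ge0.
have S0 : 0 <= \sum_j (p j - q j) ^+ 2 by apply: sumr_ge0 => i _; exact: sqr_ge0.
have := mulr_ge0 (addr_ge0 P0 Q0) S0; have := sqr_ge0 (P - Q); lra.
Qed.

(** The mean of [|f|] vanishes since [|f| <= e + f^2 / e] for every [e > 0]. So all
    coefficients vanish, hence all Fejer means, which are dense. *)
Lemma ctorus_null (f : E -> R) : ctorus f -> mean (fun x => f x * f x) <= 0 -> forall x, f x = 0.
Proof.
move=> cf f0.
have small (e : R) : 0 < e -> mean (fun x => `|f x|) <= e.
  move=> e0; apply: le_trans (_ : mean (fun x => e + e^-1 * (f x * f x)) <= _).
    apply: le_mean => [||x]; first exact: ctorus_norm.
      by apply: ctorusD; [exact: ctorus_cst|apply: ctorusZ; exact: ctorusM].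
    have [h|h] := leP `|f x| e.
      apply: le_trans h _; rewrite lerDl mulr_ge0 ?invr_ge0 ?(ltW e0)//.
      by rewrite -expr2 sqr_ge0.
    have -> : f x * f x = `|f x| ^+ 2 by rewrite real_normK ?num_real// expr2.
    have : `|f x| <= e^-1 * `|f x| ^+ 2.
      by rewrite mulrC ler_pdivlMr// expr2 ler_wpM2l// ltW.
    by lra.
  rewrite meanD; [|exact: ctorus_cst|by apply: ctorusZ; exact: ctorusM].
  rewrite mean_cst meanZ; last exact: ctorusM.
  by rewrite gerDl; apply: mulr_ge0_le0 => //; rewrite invr_ge0 ltW.
have coef0 (g : E -> R) : ctorus g -> (forall x, `|g x| <= 1) -> mean (fun x => f x * g x) = 0.
  move=> cg g1; apply/eqP; rewrite -normr_le0; apply/ler_addgt0Pr => e e0; rewrite add0r.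
  apply: le_trans (small e e0).
  have cfg : ctorus (fun x => f x * g x) by exact: ctorusM.
  have b x : `|f x * g x| <= `|f x| by rewrite normrM ler_piMr.
  have := le_mean cfg (ctorus_norm cf) (fun x => le_trans (ler_norm _) (b x)).
  have hN x : - (f x * g x) <= `|f x| by apply: le_trans (ler_norm _) _; rewrite normrN.
  have := le_mean (ctorusN cfg) (ctorus_norm cf) hN.
  by rewrite meanN// => h1 h2; rewrite ler_norml h2 andbT lerNl.
have fejer0 n x : fejer n f x = 0.
  rewrite /fejer big1 ?mulr0// => a _; rewrite big1// => b _.
  rewrite /cos_coef /sin_coef !coef0 ?mul0r ?addr0//; [exact: ctorus_sin| |exact: ctorus_cos0|].
    by move=> y; rewrite ler_norml sin_geN1 sin_le1.
  by move=> y; rewrite ler_norml cos_geN1 cos_le1.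
move=> x; apply/eqP; rewrite -normr_le0; apply/ler_addgt0Pr => e e0; rewrite add0r.
by have [n /(_ x)] := fejer_dense cf e0; rewrite fejer0 subr0.
Qed.

End TimeUniform.

(** * Uniqueness of mild solutions *)

Section SobolevCoefficients.
Variables (R : realType) (d : nat).
Local Notation E := 'rV[R]_d.
Local Notation K := 'rV[int]_d.
Local Notation ctorus := (@ctorus R d).

Definition coef_sq (f : E -> R) (k : K) : R := cos_coef f k ^+ 2 + sin_coef f k ^+ 2.

Lemma coef_sq_ge0 f k : 0 <= coef_sq f k.
Proof. by rewrite addr_ge0 ?sqr_ge0. Qed.

Lemma fourier_coef_sq (f : E -> R) k : ctorus f ->
  complex.Re (fourier_coef f k) ^+ 2 + complex.Im (fourier_coef f k) ^+ 2 = coef_sq f k.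
Proof.
move=> cf; rewrite /fourier_coef /expi/=.
rewrite -[(2 * pi) ^- d * _]/(mean (fun y => f y * cos (- freq_dot k y))).
rewrite -[(2 * pi) ^- d * torus_integral (fun y => f y * sin (- freq_dot k y))]/(mean (fun y => f y * sin (- freq_dot k y))).
have -> : mean (fun y => f y * cos (- freq_dot k y)) = cos_coef f k.
  by congr mean; apply/funext => y; rewrite cosN.
have -> : mean (fun y => f y * sin (- freq_dot k y)) = - sin_coef f k.
  rewrite /sin_coef -meanN; last by apply: ctorusM => //; exact: ctorus_sin.
  by congr mean; apply/funext => y; rewrite sinN mulrN.
by rewrite sqrrN.
Qed.

Lemma sobolev_norm_csum (s e : R) (f : E -> R) N : ctorus f -> 0 <= s ->
  (sobolev_norm s f < e%:E)%E -> csum N (coef_sq f) <= e ^+ 2.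
Proof.
move=> cf s0 h.
have c0 : 0 <= csum N (coef_sq f) by apply: csum_ge0 => k; exact: coef_sq_ge0.
have q1 (k : K) : 1 <= 1 + freq_sq R k by rewrite lerDl freq_sq_ge0.
have le1 : ((csum N (coef_sq f))%:E <= \esum_(k in [set: K])
    ((1 + freq_sq R k) `^ s * (complex.Re (fourier_coef f k) ^+ 2 + complex.Im (fourier_coef f k) ^+ 2))%:E)%E.
  apply: esum_ge; exists (@freq_cube d N); first by split => //; exact: finite_freq_cube.
  rewrite fsumEFin; last exact: finite_freq_cube.
  rewrite lee_fin; apply: csum_le => k; rewrite fourier_coef_sq// ler_peMl ?coef_sq_ge0//.
  apply: le_trans (_ : 1 `^ s <= _); first by rewrite powR1.
  by rewrite ge0_ler_powR ?nnegrE// (le_trans _ (q1 k)).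
have le2 : ((Num.sqrt (csum N (coef_sq f)))%:E < e%:E)%E.
  apply: le_lt_trans h; rewrite -powR12_sqrt// -poweR_EFin.
  apply: gt0_ler_poweR => //.
  - by rewrite in_itv/= lee_fin c0 leey.
  - rewrite in_itv/= leey andbT; apply: le_trans le1; by rewrite lee_fin.
have e0 : 0 < e by move: le2; rewrite lte_fin; apply: le_lt_trans; exact: sqrtr_ge0.
rewrite -(sqr_sqrtr c0) lerXn2r ?nnegrE ?sqrtr_ge0 ?(ltW e0)//.
by move: le2; rewrite lte_fin => /ltW.
Qed.

(** The quadratic form of the Fejer mean as a positive linear functional of the
    coefficients: see [mean_mul_fejerE]. *)
Definition fejer_avg n (phi : K -> R) : R :=
  (@gridN R d n)^-1 * \sum_(a : grid d n) \sum_(b : grid d n) phi (grid_freq a - grid_freq b).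

Lemma fejer_avgD n phi psi : fejer_avg n (fun k => phi k + psi k) = fejer_avg n phi + fejer_avg n psi.
Proof.
rewrite /fejer_avg -mulrDr -big_split/=; congr (_ * _); apply: eq_bigr => a _.
by rewrite -big_split.
Qed.

Lemma fejer_avgZ n c phi : fejer_avg n (fun k => c * phi k) = c * fejer_avg n phi.
Proof.
rewrite /fejer_avg mulrCA; congr (_ * _); rewrite mulr_sumr; apply: eq_bigr => a _.
by rewrite mulr_sumr.
Qed.

Lemma fejer_avg_sum n (I : Type) (r : seq I) (phi : I -> K -> R) :
  fejer_avg n (fun k => \sum_(i <- r) phi i k) = \sum_(i <- r) fejer_avg n (phi i).
Proof.
rewrite /fejer_avg -mulr_sumr; congr (_ * _); rewrite [RHS]exchange_big/=; apply: eq_bigr => a _.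
by rewrite exchange_big.
Qed.

Lemma le_fejer_avg n phi psi : (forall k, phi k <= psi k) -> fejer_avg n phi <= fejer_avg n psi.
Proof.
move=> h; apply: ler_wpM2l; first by rewrite invr_ge0 ler0n.
by apply: ler_sum => a _; apply: ler_sum.
Qed.

(** For fixed first grid point the differences are distinct frequencies of the cube. *)
Lemma fejer_avg_le_csum n phi : (forall k, 0 <= phi k) -> fejer_avg n.+1 phi <= csum n.+1 phi.
Proof.
move=> p0; rewrite /fejer_avg mulrC ler_pdivrMr ?gridN_gt0// mulrC.
have -> : @gridN R d n.+1 * csum n.+1 phi = \sum_(a : grid d n.+1) csum n.+1 phi.
  by rewrite sumr_const card_grid mulr_natl.
apply: ler_sum => a _.
have inj : injective (fun b : grid d n.+1 => grid_freq a - grid_freq b).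
  by move=> b b' /addrI/oppr_inj; exact: grid_freq_inj.
have -> : \sum_(b : grid d n.+1) phi (grid_freq a - grid_freq b) =
    \sum_(k \in [set` map (fun b : grid d n.+1 => grid_freq a - grid_freq b) (enum (grid d n.+1))]) phi k.
  rewrite -fsbig_seq; last by rewrite map_inj_uniq ?enum_uniq.
  by rewrite big_map big_enum.
apply: csum_set_le => // k /= /mapP[b _ ->] j; rewrite !mxE.
move: (ltn_ord (a j)) (ltn_ord (b j)); move: (nat_of_ord (a j)) (nat_of_ord (b j)) => u v.
rewrite ler_norml; lia.
Qed.

Lemma mean_mul_fejerE n (f g : E -> R) : ctorus f -> ctorus g ->
  mean (fun x => g x * fejer n f x) =
  fejer_avg n (fun k => cos_coef f k * cos_coef g k + sin_coef f k * sin_coef g k).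
Proof. exact: mean_mul_fejer. Qed.

End SobolevCoefficients.

Section Uniqueness.
Variables (R : realType) (d : nat).
Local Notation E := 'rV[R]_d.
Local Notation K := 'rV[int]_d.
Local Notation ctorus := (@ctorus R d).
Variables (nu T : R) (h0 : E -> R) (h g : R -> E -> R).
Hypotheses (nu0 : 0 < nu) (T0 : 0 < T) (mh : mild_solution nu h0 T h)
  (mg : mild_solution nu h0 T g).

Let cw k t := cos_coef (h t) k - cos_coef (g t) k.
Let sw k t := sin_coef (h t) k - sin_coef (g t) k.
Let e k t := cw k t ^+ 2 + sw k t ^+ 2.
Let G j t x := flux (h t) j x - flux (g t) j x.
Let dw j t x := partial j (h t) x - partial j (g t) x.
Let lam (k : K) := nu * freq_sq R k ^+ 2.
Let pair j t k := cos_coef (dw j t) k * cos_coef (G j t) k + sin_coef (dw j t) k * sin_coef (G j t) k.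
Let de k t := - (2 * lam k * e k t) - 2 * \sum_j pair j t k.
Let En n t := fejer_avg n (fun k => e k t).
Let dEn n t := fejer_avg n (fun k => de k t).

Lemma cos_coefB (u v : E -> R) k : ctorus u -> ctorus v ->
  cos_coef (fun x => u x - v x) k = cos_coef u k - cos_coef v k.
Proof.
move=> cu cv; rewrite /cos_coef -meanB; [|by apply: ctorusM => //; exact: ctorus_cos0..].
by congr mean; apply/funext => x; rewrite mulrBl.
Qed.

Lemma sin_coefB (u v : E -> R) k : ctorus u -> ctorus v ->
  sin_coef (fun x => u x - v x) k = sin_coef u k - sin_coef v k.
Proof.
move=> cu cv; rewrite /sin_coef -meanB; [|by apply: ctorusM => //; exact: ctorus_sin..].
by congr mean; apply/funext => x; rewrite mulrBl.
Qed.

Let tG j : tcont T (G j).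
Proof. exact: tcontB (mild_tcont_flux mh j) (mild_tcont_flux mg j). Qed.

Let tdw j : tcont T (dw j).
Proof. exact: tcontB (mild_tcont_partial mh j) (mild_tcont_partial mg j). Qed.

Let coef_dw j t k : 0 < t <= T ->
  cos_coef (dw j t) k = (k ord0 j)%:~R * sw k t /\ sin_coef (dw j t) k = - ((k ord0 j)%:~R * cw k t).
Proof.
move=> /andP[t1 t2]; have tT : 0 <= t <= T by rewrite ltW.
have [ph c1h] := mild_C1 mh tT; have [pg c1g] := mild_C1 mg tT.
have ch := mild_ctorus_partial mh j tT; have cg := mild_ctorus_partial mg j tT.
rewrite cos_coefB// sin_coefB// !cos_coef_partial// !sin_coef_partial// /sw /cw.
by split; ring.
Qed.

Let is_derive_e k t : 0 < t < T -> is_derive t (1 : R) (e k) (de k t).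
Proof.
move=> tT; have tT' : 0 < t <= T by case/andP: tT => -> /ltW.
have cfh j : ctorus (flux (h t) j) by apply: (mild_tcont_flux mh j).1.
have cfg j : ctorus (flux (g t) j) by apply: (mild_tcont_flux mg j).1.
have dc : is_derive t (1 : R) (cw k) (- (lam k * cw k t) + \sum_j (k ord0 j)%:~R * sin_coef (G j t) k).
  have := @is_deriveB _ _ _ _ _ t 1 _ _ (is_derive_mild_cos nu0 T0 mh k tT) (is_derive_mild_cos nu0 T0 mg k tT).
  congr (is_derive _ _ _ _).
  have -> : \sum_j (k ord0 j)%:~R * sin_coef (G j t) k = flux_div_cos (h t) k - flux_div_cos (g t) k.
    by rewrite -sumrB; apply: eq_bigr => j _; rewrite sin_coefB// mulrBr.
  rewrite /cw /lam; move: (flux_div_cos (h t) k) (flux_div_cos (g t) k) (cos_coef (h t) k) (cos_coef (g t) k) (freq_sq R k) => a b c c' q.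
  by ring.
have ds : is_derive t (1 : R) (sw k) (- (lam k * sw k t) - \sum_j (k ord0 j)%:~R * cos_coef (G j t) k).
  have := @is_deriveB _ _ _ _ _ t 1 _ _ (is_derive_mild_sin nu0 T0 mh k tT) (is_derive_mild_sin nu0 T0 mg k tT).
  congr (is_derive _ _ _ _).
  have -> : \sum_j (k ord0 j)%:~R * cos_coef (G j t) k = - (flux_div_sin (h t) k - flux_div_sin (g t) k).
    by rewrite opprB opprK addrC -sumrB; apply: eq_bigr => j _; rewrite cos_coefB// mulrBr.
  rewrite /sw /lam; move: (flux_div_sin (h t) k) (flux_div_sin (g t) k) (sin_coef (h t) k) (sin_coef (g t) k) (freq_sq R k) => a b c c' q.
  by ring.
have d2 := @is_deriveD _ _ _ _ _ t 1 _ _ (@is_deriveM _ _ _ _ t 1 _ _ dc dc) (@is_deriveM _ _ _ _ t 1 _ _ ds ds).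
have -> : e k = (cw k * cw k) + (sw k * sw k) by apply/funext => s; rewrite /e !expr2.
move: d2; congr (is_derive _ _ _ _); rewrite /GRing.scale/= /de /pair.
have -> : \sum_j (cos_coef (dw j t) k * cos_coef (G j t) k + sin_coef (dw j t) k * sin_coef (G j t) k) =
  sw k t * (\sum_j (k ord0 j)%:~R * cos_coef (G j t) k) - cw k t * (\sum_j (k ord0 j)%:~R * sin_coef (G j t) k).
  rewrite !mulr_sumr -sumrB; apply: eq_bigr => j _.
  by have [-> ->] := coef_dw j k tT'; ring.
rewrite /e; ring.
Qed.

Let is_derive_En n t : 0 < t < T -> is_derive t (1 : R) (En n) (dEn n t).
Proof.
move=> tT.
have := @is_derive_sumr R _ (index_enum (grid d n)) _
  (fun a t => \sum_(b : grid d n) de (grid_freq a - grid_freq b) t) t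
  (fun a => @is_derive_sumr R _ (index_enum (grid d n)) _ (fun b t => de (grid_freq a - grid_freq b) t) t
    (fun b => is_derive_e (grid_freq a - grid_freq b) tT)).
by move=> /(@is_deriveZ _ _ _ _ (@gridN R d n)^-1 t 1 _).
Qed.

Let energy_ineq n t M eta : 0 < t <= T -> 0 <= M ->
  (forall j x, `|G j t x| <= M) -> (forall j x, `|dw j t x| <= M) ->
  (forall j x, `|dw j t x - fejer n (dw j t) x| <= eta) ->
  dEn n t <= (2 * nu)^-1 * En n t + 4 * d%:R * M * eta.
Proof.
move=> tT M0 hG hdw heta.
have cG j : ctorus (G j t) by apply: (tG j).1.
have cdw j : ctorus (dw j t) by apply: (tdw j).1.
have cF j : ctorus (fejer n (dw j t)) by exact: ctorus_fejer.
have MG j : mean (fun x => G j t x * dw j t x) - M * eta <= fejer_avg n (pair j t).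
  rewrite -mean_mul_fejerE// lerBlDr -lerBlDl -meanB; [|exact: ctorusM..].
  apply: le_trans (ler_norm _) _; apply: normr_mean_le => [|x].
    by apply: ctorusB; exact: ctorusM.
  by rewrite -mulrBr normrM; apply: ler_pM.
have MD j : mean (fun x => dw j t x ^+ 2) - M * eta <=
    fejer_avg n (fun k : K => (k ord0 j)%:~R ^+ 2 * e k t).
  have -> : (fun k : K => (k ord0 j)%:~R ^+ 2 * e k t) = (fun k : K => cos_coef (dw j t) k * cos_coef (dw j t) k + sin_coef (dw j t) k * sin_coef (dw j t) k).
    by apply/funext => k; have [-> ->] := coef_dw j k tT; rewrite /e; ring.
  rewrite -mean_mul_fejerE// lerBlDr -lerBlDl -meanB; [|exact: ctorusX|exact: ctorusM].
  apply: le_trans (ler_norm _) _; apply: normr_mean_le => [|x].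
    by apply: ctorusB; [exact: ctorusX|exact: ctorusM].
  by rewrite expr2 -mulrBr normrM; apply: ler_pM.
have mono : - (\sum_j mean (fun x => dw j t x ^+ 2)) <= \sum_j mean (fun x => G j t x * dw j t x).
  rewrite -!mean_sum; [|by move=> j _; apply: ctorusM|by move=> j _; apply: ctorusX].
  rewrite -meanN; last by apply: ctorus_sum => j _; exact: ctorusX.
  apply: le_mean => [||x]; first by apply: ctorusN; apply: ctorus_sum => j _; exact: ctorusX.
    by apply: ctorus_sum => j _; exact: ctorusM.
  have := flux_monotone (fun j => partial j (h t) x) (fun j => partial j (g t) x).
  congr (_ <= _); apply: eq_bigr => j _.
  by rewrite /G !fluxE.
have sumq : \sum_j fejer_avg n (fun k : K => (k ord0 j)%:~R ^+ 2 * e k t) = fejer_avg n (fun k => freq_sq R k * e k t).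
  rewrite -fejer_avg_sum; congr fejer_avg; apply/funext => k.
  by rewrite -mulr_suml.
have SG : \sum_j (mean (fun x => G j t x * dw j t x) - M * eta) <= \sum_j fejer_avg n (pair j t).
  by apply: ler_sum.
have SD : \sum_j (mean (fun x => dw j t x ^+ 2) - M * eta) <= fejer_avg n (fun k => freq_sq R k * e k t).
  by rewrite -sumq; apply: ler_sum.
have dE : dEn n t = - 2 * fejer_avg n (fun k => lam k * e k t) - 2 * \sum_j fejer_avg n (pair j t).
  rewrite -fejer_avg_sum -[- (2 * _)]mulNr -!fejer_avgZ -fejer_avgD.
  by congr fejer_avg; apply/funext => k; rewrite /de; ring.
have key : 2 * fejer_avg n (fun k => freq_sq R k * e k t) <=
   2 * fejer_avg n (fun k => lam k * e k t) + (2 * nu)^-1 * En n t.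
  rewrite -!fejer_avgZ -fejer_avgD; apply: le_fejer_avg => k.
  have e0 : 0 <= e k t by rewrite addr_ge0 ?sqr_ge0.
  rewrite /lam; set q := freq_sq R k.
  (* - 2 nu q^2 + 2 q <= 1 / (2 nu), by completing the square *)
  have : 0 <= 2 * nu * (q - (2 * nu)^-1) ^+ 2 * e k t.
    by rewrite mulr_ge0// mulr_ge0 ?sqr_ge0// mulr_ge0// ltW.
  have -> : 2 * nu * (q - (2 * nu)^-1) ^+ 2 = 2 * nu * q ^+ 2 - 2 * q + (2 * nu)^-1.
    by field; rewrite gt_eqF.
  by lra.
move: SG SD; rewrite !big_split/= !sumr_const !card_ord -mulr_natl => SG SD.
rewrite dE; lra.
Qed.

Let wE t : 0 <= t <= T -> ctorus (fun x => h t x - g t x) /\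
  forall k, cos_coef (fun x => h t x - g t x) k = cw k t /\ sin_coef (fun x => h t x - g t x) k = sw k t.
Proof.
move=> tT; have ch := mild_ctorus mh tT; have cg := mild_ctorus mg tT.
by split => [|k]; [exact: ctorusB|rewrite cos_coefB// sin_coefB].
Qed.

Let En_small (s eps : R) : 0 < s -> s <= T -> 0 < eps ->
  exists2 t1, 0 < t1 < s & forall n, En n.+1 t1 <= 4 * eps ^+ 2.
Proof.
move=> s0 sT eps0.
have sob (u : R -> E -> R) : mild_solution nu h0 T u ->
    exists2 del : R, 0 < del & forall r, 0 <= r <= T -> r < del ->
      forall N, csum N (coef_sq (fun x => u r x - h0 x)) <= eps ^+ 2.
  move=> mu; case: (mu) => _ hs _ _ [u0 _].
  have z0 : (0 : R) \in `[0, T] by rewrite in_itv/= lexx ltW.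
  have [_ hs0] := hs 0 z0.
  have FFw : Filter (within `[0, T]%classic (nbhs (0 : R))) by exact: within_filter.
  have hn := cvg0e_lt eps0 hs0; have := hn FFw; rewrite near_withinE => /nbhs_ballP[del /= del0 hdel].
  exists del => // r /andP[r0 rT] rd N.
  have h1 := hdel r; rewrite /ball/= sub0r normrN ger0_norm// in h1.
  have {}h1 := h1 rd; rewrite in_itv/= r0 rT in h1; have {}h1 := h1 isT.
  rewrite u0 in h1; apply: sobolev_norm_csum h1; last by rewrite divr_ge0.
  apply: ctorusB; first by apply: (mild_ctorus mu); rewrite r0.
  by rewrite -u0; apply: (mild_ctorus mu); rewrite lexx ltW.
have [d1 d10 hd1] := sob h mh; have [d2 d20 hd2] := sob g mg.
pose m := Num.min s (Num.min d1 d2).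
have m0 : 0 < m by rewrite !lt_min s0 d10.
exists (m / 2) => [|n].
  by rewrite divr_gt0//=; apply: lt_le_trans (_ : m <= s); [lra|rewrite ge_min lexx].
have mm : m / 2 < m by lra.
have ms : m <= s by rewrite ge_min lexx.
have [md1 md2] : m / 2 < d1 /\ m / 2 < d2.
  by split; apply: lt_le_trans mm _; rewrite !ge_min lexx ?orbT.
have rT : 0 <= m / 2 <= T by apply/andP; split; lra.
have ch0 : ctorus h0 by case: (mh) => _ _ _ _ [<- _]; apply: (mild_ctorus mh); rewrite lexx ltW.
have ch := mild_ctorus mh rT; have cg := mild_ctorus mg rT.
have e0 k : 0 <= e k (m / 2) by rewrite addr_ge0 ?sqr_ge0.
apply: le_trans (fejer_avg_le_csum n e0) _.
apply: le_trans (_ : csum n.+1 (fun k => 2 * (coef_sq (fun x => h (m / 2) x - h0 x) k + coef_sq (fun x => g (m / 2) x - h0 x) k)) <= _).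
  apply: csum_le => k; rewrite /e /coef_sq !cos_coefB// !sin_coefB// /cw /sw.
  move: (cos_coef (h _) k) (cos_coef (g _) k) (cos_coef h0 k) (sin_coef (h _) k) (sin_coef (g _) k) (sin_coef h0 k) => a b c a' b' c'.
  have := sqr_ge0 (a + b - 2 * c); have := sqr_ge0 (a' + b' - 2 * c').
  rewrite -subr_ge0 => h1; rewrite -subr_ge0 => h2; nra.
rewrite csumZ csumD; have := hd1 _ rT md1 n.+1; have := hd2 _ rT md2 n.+1; lra.
Qed.

(** The energy at [t1] is small because both solutions are close to the data in the
    Sobolev norm; [gronwall] propagates this to time [t] with an error that tends to 0 as
    the Fejer order grows. So the mean of the squared difference vanishes. *)
Theorem mild_unique t x : 0 < t < T -> h t x = g t x.
Proof.
move=> tT; have [t0 tlt] := andP tT; have tT' : 0 <= t <= T by rewrite !ltW.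
have [cw0 cwE] := wE tT'.
apply/eqP; rewrite -subr_eq0; apply/eqP; move: x.
apply: ctorus_null => //.
have EnE n : En n t = mean (fun x => (h t x - g t x) * fejer n (fun x => h t x - g t x) x).
  rewrite mean_mul_fejerE//; congr fejer_avg; apply/funext => k.
  by have [-> ->] := cwE k; rewrite /e !expr2.
have a0 : 0 < (2 * nu)^-1 by rewrite invr_gt0 mulr_gt0.
have small (eps : R) : 0 < eps -> exists n0, forall n, (n0 <= n)%N -> En n.+1 t <= expR ((2 * nu)^-1 * T) * (4 * eps ^+ 2 + eps).
  move=> eps0; have [t1 /andP[t10 t1t] ht1] := En_small t0 (ltW tlt) eps0.
  have [M M0 [hG hdw]] : exists2 M : R, 0 <= M &
     (forall r, t1 <= r <= T -> forall j x, `|G j r x| <= M) /\ (forall r, t1 <= r <= T -> forall j x, `|dw j r x| <= M).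
    have /choice[MG hMG] j := tcont_bounded t10 (tG j).
    have /choice[MD hMD] j := tcont_bounded t10 (tdw j).
    exists (\sum_j (`|MG j| + `|MD j|)); first by apply: sumr_ge0 => j _; rewrite addr_ge0.
    have S j : `|MG j| + `|MD j| <= \sum_j (`|MG j| + `|MD j|).
      by rewrite (bigD1 j)//= lerDl; apply: sumr_ge0 => i _; rewrite addr_ge0.
    split=> r rT j x; apply: le_trans (S j).
      by apply: le_trans (hMG j r rT x) _; rewrite (le_trans (ler_norm _))// lerDl.
    by apply: le_trans (hMD j r rT x) _; rewrite (le_trans (ler_norm _))// lerDr.
  (* makes the error 4 d M eta of the energy inequality at most eps / (2 nu) *)
  pose eta := eps * (2 * nu)^-1 / (4 * d%:R * M + 1).
  have D0 : 0 < 4 * d%:R * M + 1 by rewrite ltr_wpDl// mulr_ge0// mulr_ge0.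
  have eta0 : 0 < eta by rewrite divr_gt0// mulr_gt0.
  have /choice[n0 hn0] j := tcont_fejer t10 (tdw j) eta0.
  exists (\max_j n0 j) => n hn.
  have hF r : t1 <= r <= T -> forall j x, `|dw j r x - fejer n.+1 (dw j r) x| <= eta.
    move=> rT j x; apply: hn0 => //; apply: leq_trans hn.
    exact: (leq_bigmax (F := n0)).
  have dd r : t1 <= r <= t -> is_derive r (1 : R) (En n.+1) (dEn n.+1 r).
    by move=> /andP[h1 h2]; apply: is_derive_En; rewrite (lt_le_trans t10 h1) (le_lt_trans h2).
  have di r : t1 <= r <= t -> dEn n.+1 r <= (2 * nu)^-1 * En n.+1 r + eps * (2 * nu)^-1.
    move=> /andP[h1 h2]; have rT : t1 <= r <= T by rewrite h1 (le_trans h2)// ltW.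
    have rT' : 0 < r <= T by rewrite (lt_le_trans t10 h1) (le_trans h2)// ltW.
    apply: le_trans (energy_ineq rT' M0 (hG r rT) (hdw r rT) (hF r rT)) _.
    rewrite lerD2l /eta mulrA ler_pdivrMr// mulrC ler_pM2l; last by rewrite mulr_gt0.
    by rewrite lerDl.
  have := gronwall (lt0r_neq0 a0) t1t dd di; rewrite mulfK ?gt_eqF// => gr.
  have En1 := ht1 n.
  apply: le_trans (_ : expR ((2 * nu)^-1 * (t - t1)) * (En n.+1 t1 + eps) <= _); first by move: gr; lra.
  apply: ler_pM; rewrite ?expR_ge0//; last by rewrite lerD2r.
    apply: addr_ge0; last exact: ltW.
    rewrite /En /fejer_avg mulr_ge0 ?invr_ge0 ?ler0n//.
    by apply: sumr_ge0 => a _; apply: sumr_ge0 => b _; rewrite addr_ge0 ?sqr_ge0.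
  by rewrite ler_expR; apply: ler_wpM2l; [exact: ltW|lra].
have [M hM] := ctorus_bounded cw0.
have M0 : 0 <= M by apply: le_trans (hM 0).
apply/ler_addgt0Pr => del del0; rewrite add0r.
set A := expR ((2 * nu)^-1 * T) in small.
have A0 : 0 < A by exact: expR_gt0.
pose eps := Num.min 1 (del / (10 * A + 2 * M + 1)).
have D0 : 0 < 10 * A + 2 * M + 1 by lra.
have eps0 : 0 < eps by rewrite lt_min ltr01 divr_gt0.
have eps1 : eps <= 1 by rewrite ge_min lexx.
have epsd : eps * (10 * A + 2 * M + 1) <= del by rewrite -ler_pdivlMr// ge_min lexx orbT.
have [n1 hn1] := small eps eps0.
have tcw : tcont T (fun _ : R => fun x => h t x - g t x) by exact: tcont_cst.
have [n2 hn2] := tcont_fejer t0 tcw eps0.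
set n := maxn n1 n2.
have L1 := hn1 n (leq_maxl _ _).
have L2 : forall x, `|(h t x - g t x) - fejer n.+1 (fun x => h t x - g t x) x| <= eps.
  by move=> x; apply: (hn2 n (leq_maxr _ _) t); rewrite lexx ltW.
have L3 : mean (fun x => (h t x - g t x) * (h t x - g t x)) - En n.+1 t <= M * eps.
  have cF := ctorus_fejer n.+1 (fun x => h t x - g t x).
  rewrite EnE -meanB; [|exact: ctorusM..].
  apply: le_trans (ler_norm _) _; apply: normr_mean_le => [|x].
    by apply: ctorusB; exact: ctorusM.
  by rewrite -mulrBr normrM; apply: ler_pM.
have e2 : eps ^+ 2 <= eps by rewrite expr2 ler_piMr// ltW.
have L4 : A * (4 * eps ^+ 2 + eps) <= A * (5 * eps) by apply: ler_wpM2l; [exact: ltW|lra].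
nra.
Qed.

End Uniqueness.

(** * Weighted coefficients on a line of frequencies *)

Section LineWeight.
Variables (R : realType) (d : nat) (i0 : 'I_d) (n m : nat).
Local Notation E := 'rV[R]_d.
Local Notation K := 'rV[int]_d.
Local Notation ctorus := (@ctorus R d).
Local Notation N := (n.+1%:Z).

Definition line_pt (l : int) : K := \row_j (if j == i0 then N * l else 0).

Definition onL (k : K) : bool := k == line_pt (k ord0 i0 %/ N)%Z.

Lemma line_pt_on l : onL (line_pt l).
Proof. by rewrite /onL mxE eqxx mulKz. Qed.

Lemma onLP (k : K) : reflect (exists l, k = line_pt l) (onL k).
Proof.
apply: (iffP eqP) => [e|[l ->]]; first by exists (k ord0 i0 %/ N)%Z.
by apply/eqP; exact: line_pt_on.
Qed.

Lemma line_ptB l l' : line_pt l - line_pt l' = line_pt (l - l').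
Proof. by apply/rowP => j; rewrite !mxE; case: ifP; rewrite ?mulrBr ?subr0. Qed.

Lemma line_ptD l l' : line_pt l + line_pt l' = line_pt (l + l').
Proof. by apply/rowP => j; rewrite !mxE; case: ifP; rewrite ?mulrDr ?addr0. Qed.

Lemma line_ptN l : - line_pt l = line_pt (- l).
Proof. by apply/rowP => j; rewrite !mxE; case: ifP; rewrite ?mulrN ?oppr0. Qed.

(** The weight is scaled by the spacing [n + 1] of the line, so that its sum and its
    convolution constant do not depend on [n]. It vanishes off the line, which makes the
    support of all coefficients follow from the bounds. *)
Definition lw (k : K) : R := if onL k then (1 + ((k ord0 i0 %/ N)%Z)%:~R ^+ 2) ^- m else 0.

Lemma lw_line l : lw (line_pt l) = (1 + l%:~R ^+ 2) ^- m.
Proof. by rewrite /lw line_pt_on mxE eqxx mulKz. Qed.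

Let one_sq (x : R) : 0 < 1 + x ^+ 2.
Proof. by rewrite ltr_pwDl// sqr_ge0. Qed.

Lemma lw_ge0 k : 0 <= lw k.
Proof. by rewrite /lw; case: ifP => // _; rewrite invr_ge0 exprn_ge0// ltW. Qed.

Lemma lw_off k : ~~ onL k -> lw k = 0.
Proof. by rewrite /lw => /negbTE ->. Qed.

Lemma onLN k : onL (- k) = onL k.
Proof.
apply/onLP/onLP => -[l e]; exists (- l); last by rewrite e line_ptN.
by rewrite -line_ptN -e opprK.
Qed.

Lemma lwN k : lw (- k) = lw k.
Proof.
have [/onLP[l ->]|h] := boolP (onL k); first by rewrite line_ptN !lw_line mulrNz sqrrN.
by rewrite !lw_off// onLN.
Qed.

(** The larger of [p] and [q] is at least [r / 4]. *)
Lemma inv_pow_conv (p q r : R) : 1 <= p -> 1 <= q -> 1 <= r -> r <= 2 * p + 2 * q ->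
  p ^- m * q ^- m <= 4 ^+ m * r ^- m * (p ^- m + q ^- m).
Proof.
wlog pq : p q / p <= q.
  move=> h p1 q1 r1 hr; have [pq|qp] := leP p q; first exact: h.
  by rewrite [leLHS]mulrC [p ^- m + _]addrC; apply: h => //; [exact: ltW|lra].
move=> p1 q1 r1 hr.
have [p0 q0 r0] : [/\ 0 < p, 0 < q & 0 < r] by split; lra.
have P0 : 0 <= p ^- m by rewrite invr_ge0 exprn_ge0// ltW.
have Q0 : 0 <= q ^- m by rewrite invr_ge0 exprn_ge0// ltW.
have S0 : 0 <= 4 ^+ m * r ^- m by rewrite mulr_ge0 ?invr_ge0 ?exprn_ge0// ltW.
rewrite mulrDr; apply: le_trans (_ : 4 ^+ m * r ^- m * p ^- m <= _); last by rewrite lerDl mulr_ge0.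
rewrite mulrC; apply: ler_wpM2r => //.
rewrite ler_pdivlMr ?exprn_gt0// mulrC ler_pdivrMr ?exprn_gt0// -exprMn.
by apply: lerXn2r; rewrite ?nnegrE ?(ltW r0) ?mulr_ge0 ?(ltW q0)//; lra.
Qed.

Lemma lw_conv k l : lw l * lw (k - l) <= 4 ^+ m * lw k * (lw l + lw (k - l)).
Proof.
have R0 : 0 <= 4 ^+ m * lw k * (lw l + lw (k - l)).
  by rewrite !mulr_ge0 ?addr_ge0 ?lw_ge0// exprn_ge0.
have [/onLP[a la]|h] := boolP (onL l); last by rewrite (lw_off h) mul0r; rewrite (lw_off h) in R0.
have [/onLP[b lb]|h] := boolP (onL (k - l)); last by rewrite (lw_off h) mulr0; rewrite (lw_off h) in R0.
have -> : k = line_pt (a + b) by rewrite -line_ptD -la -lb addrC subrK.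
rewrite la line_ptB (addrC a) addrK !lw_line.
have q1 (z : int) : 1 <= 1 + z%:~R ^+ 2 :> R by rewrite lerDl sqr_ge0.
rewrite addrC; apply: inv_pow_conv => //.
rewrite intrD; move: (a%:~R : R) (b%:~R : R) => x y.
have := sqr_ge0 (x - y); lra.
Qed.

Hypothesis m1 : (0 < m)%N.

(** Reindexing the line by the integers, with majorant [1 / (1 + l^2)]. *)
Lemma csum_lw M : csum M lw <= 5.
Proof.
apply: le_trans (csum_mono lw_ge0 (_ : (M <= n.+1 * M)%N)) _; first by rewrite leq_pmull.
pose f (i : 'I_(2 * M).+1) := line_pt ((i : nat)%:Z - M%:Z).
have finj : injective f.
  have N0 : N != 0 by [].
  by move=> i j /rowP/(_ i0); rewrite !mxE eqxx => /(mulfI N0)/addIr[] /ord_inj.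
(* the cube is enlarged so that it contains the image of the whole range of l *)
have -> : csum (n.+1 * M) lw = \sum_(k \in [set` map f (enum 'I_(2 * M).+1)]) lw k.
  rewrite /csum; apply/esym/fsbig_widen.
    move=> k /= /mapP[i _ ->] j; rewrite !mxE; case: ifP => _; last by rewrite normr0.
    have := ltn_ord i; nia.
  move=> k [kM kA]; rewrite /= lw_off//; apply/negP => /onLP[l e]; apply: kA.
  have := kM i0; rewrite e !mxE eqxx => hl.
  have lM : `|l| <= M%:Z by move: hl; rewrite normrM PoszM gtr0_norm// ler_pM2l.
  have hi : (absz (l + M%:Z)%R < (2 * M).+1)%N by move: lM; rewrite ler_norml; lia.
  apply/mapP; exists (Ordinal hi); first by rewrite mem_enum.
  rewrite /f/=; congr line_pt; move: lM; rewrite ler_norml; lia.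
rewrite -fsbig_seq; last by rewrite map_inj_uniq ?enum_uniq.
rewrite big_map big_enum/=; apply: le_trans (sum_inv_sq_sym R M).
apply: ler_sum => i _; rewrite /f lw_line.
have x1 : 1 <= 1 + ((i : nat)%:Z - M%:Z)%:~R ^+ 2 :> R by rewrite lerDl sqr_ge0.
rewrite lef_pV2 ?posrE ?exprn_gt0 ?(lt_le_trans ltr01)//.
exact: ler_eXnr.
Qed.

Lemma csum_lw_shift M k : csum M (fun l => lw (k - l)) <= 5.
Proof.
have [M' hM'] := @finite_in_cube d ((fun l => k - l) @` @freq_cube d M) (finite_image _ (finite_freq_cube d M)).
apply: le_trans (csum_lw M').
rewrite /csum -(@fsbig_image _ _ _ _ _ _ (fun l => k - l) lw); last by move=> a b _ _ /addrI/oppr_inj.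
by apply: csum_set_le => //; exact: lw_ge0.
Qed.

Lemma csummable_lw : csummable lw.
Proof.
exists 5 => M; rewrite (_ : (fun k => `|lw k|) = lw) ?csum_lw//.
by apply/funext => k; rewrite ger0_norm// lw_ge0.
Qed.

Lemma lw_conv_sum k M : csum M (fun l => lw l * (2^-1 * (lw (k + l) + lw (k - l)))) <= 10 * 4 ^+ m * lw k.
Proof.
have c1 : csum M (fun l => lw l * lw (k - l)) <= 10 * 4 ^+ m * lw k.
  apply: le_trans (csum_le M (lw_conv k)) _; rewrite csumZ csumD.
  have := csum_lw M; have := csum_lw_shift M k => h1 h2.
  rewrite mulrC -mulrA ler_wpM2r//; first by rewrite mulr_ge0 ?exprn_ge0 ?lw_ge0.
  lra.
have c2 : csum M (fun l => lw l * lw (k + l)) <= 10 * 4 ^+ m * lw k.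
  apply: le_trans (_ : csum M (fun l => 4 ^+ m * lw k * (lw l + lw (- k - l))) <= _).
    apply: csum_le => l; have := lw_conv (- k) l.
    by rewrite -opprD !lwN.
  rewrite csumZ csumD; have := csum_lw M; have := csum_lw_shift M (- k) => h1 h2.
  rewrite mulrC -mulrA ler_wpM2r//; first by rewrite mulr_ge0 ?exprn_ge0 ?lw_ge0.
  lra.
have -> : (fun l => lw l * (2^-1 * (lw (k + l) + lw (k - l)))) =
   (fun l => 2^-1 * (lw l * lw (k + l)) + 2^-1 * (lw l * lw (k - l))).
  by apply/funext => l; ring.
by rewrite csumD !csumZ; lra.
Qed.

Definition cbound (B : R) (f : E -> R) := ctorus f /\ forall k, `|cos_coef f k| <= B * lw k.

Definition cos_series (A : K -> R) : E -> R := trig_series A (fun=> 0).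

Lemma csummable_Zlw B : csummable (fun k => B * lw k).
Proof. exact/csummableZ/csummable_lw. Qed.

(** The coefficients of the product are convolutions, and the weight is stable under
    convolution. *)
Lemma cbound_mul A a B f : (forall k, `|A k| <= a * lw k) -> 0 <= a -> 0 <= B -> cbound B f ->
  cbound (10 * 4 ^+ m * a * B) (fun x => cos_series A x * f x).
Proof.
move=> hA a0 B0 [cf hf].
have h0 k : `|(0 : R)| <= a * lw k by rewrite normr0 mulr_ge0 ?lw_ge0.
have cA : ctorus (cos_series A) := ctorus_trig_series (csummable_Zlw a) hA h0.
split=> [|k]; first exact: ctorusM.
have cfk : ctorus (fun x => f x * cos (freq_dot k x)) by apply: ctorusM => //; exact: ctorus_cos0.
have -> : cos_coef (fun x => cos_series A x * f x) k =
    climit (fun l => A l * (2^-1 * (cos_coef f (k + l) + cos_coef f (k - l)))).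
  rewrite /cos_coef (_ : (fun x => _) = fun x => (f x * cos (freq_dot k x)) * cos_series A x); last first.
    by apply/funext => x; ring.
  rewrite (mean_mul_trig_series (csummable_Zlw a) hA h0 cfk); congr climit; apply/funext => l.
  rewrite mul0r addr0; congr (_ * _); rewrite /cos_coef -meanD; last 2 first.
  - by apply: ctorusM => //; exact: ctorus_cos0.
  - by apply: ctorusM => //; exact: ctorus_cos0.
  rewrite -meanZ; last by apply: ctorusD; apply: ctorusM => //; exact: ctorus_cos0.
  by congr mean; apply/funext => x; rewrite freq_dotDl freq_dotBl cosD cosB; field.
apply: climit_norm_le => M.
apply: le_trans (_ : csum M (fun l => a * B * (lw l * (2^-1 * (lw (k + l) + lw (k - l))))) <= _).
  apply: csum_le => l; rewrite normrM.
  have -> : a * B * (lw l * (2^-1 * (lw (k + l) + lw (k - l)))) =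
    (a * lw l) * (2^-1 * (B * lw (k + l) + B * lw (k - l))) by ring.
  apply: ler_pM => //; rewrite normrM ger0_norm ?invr_ge0//; apply: ler_wpM2l; rewrite ?invr_ge0//.
  by apply: le_trans (ler_normD _ _) _; apply: lerD.
rewrite csumZ; apply: le_trans (ler_wpM2l _ (lw_conv_sum k M)) _; first exact: mulr_ge0.
by rewrite le_eqVlt; apply/orP; left; apply/eqP; ring.
Qed.

Lemma cbound_series A a : (forall k, `|A k| <= a * lw k) -> 0 <= a -> cbound a (cos_series A).
Proof.
move=> hA a0.
have h0 k : `|(0 : R)| <= a * lw k by rewrite normr0 mulr_ge0 ?lw_ge0.
split=> [|k]; first exact: ctorus_trig_series (csummable_Zlw a) hA h0.
rewrite (cos_coef_trig_series k (csummable_Zlw a) hA h0) normrM ger0_norm ?invr_ge0//.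
have := hA k; have := hA (- k); rewrite lwN => h1 h2; have := ler_normD (A k) (A (- k)); lra.
Qed.

Lemma cboundD B B' f g : cbound B f -> cbound B' g -> cbound (B + B') (fun x => f x + g x).
Proof.
move=> [cf hf] [cg hg]; split=> [|k]; first exact: ctorusD.
have -> : cos_coef (fun x => f x + g x) k = cos_coef f k + cos_coef g k.
  rewrite /cos_coef -meanD; [|by apply: ctorusM => //; exact: ctorus_cos0..].
  by congr mean; apply/funext => x; rewrite mulrDl.
by rewrite mulrDl; apply: le_trans (ler_normD _ _) _; apply: lerD.
Qed.

Lemma cboundN B f : cbound B f -> cbound B (fun x => - f x).
Proof.
move=> [cf hf]; split=> [|k]; first exact: ctorusN.
have -> : cos_coef (fun x => - f x) k = - cos_coef f k.
  rewrite /cos_coef -meanN; last by apply: ctorusM => //; exact: ctorus_cos0.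
  by congr mean; apply/funext => x; rewrite mulNr.
by rewrite normrN.
Qed.

(** For a function of one variable the flux [(v^2 - 1) v] of its slope [v]. *)
Definition cubic (A : K -> R) (x : E) : R := cos_series A x ^+ 3 - cos_series A x.

Local Notation c0 := (10 * 4 ^+ m : R).

Let c0_ge0 : 0 <= c0.
Proof. by rewrite mulr_ge0// exprn_ge0. Qed.

Lemma cbound_cubic A a : (forall k, `|A k| <= a * lw k) -> 0 <= a ->
  cbound (c0 ^+ 2 * a ^+ 3 + a) (cubic A).
Proof.
move=> hA a0; have b1 := cbound_series hA a0.
have b3 := cbound_mul hA a0 (mulr_ge0 (mulr_ge0 c0_ge0 a0) a0) (cbound_mul hA a0 a0 b1).
have := cboundD b3 (cboundN b1).
rewrite (_ : c0 * a * (c0 * a * a) = c0 ^+ 2 * a ^+ 3); last by ring.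
by congr cbound; apply/funext => x; rewrite /cubic; ring.
Qed.

Lemma cos_seriesB A A' a x : (forall k, `|A k| <= a * lw k) -> (forall k, `|A' k| <= a * lw k) -> 0 <= a ->
  cos_series (fun k => A k - A' k) x = cos_series A x - cos_series A' x.
Proof.
move=> hA hA' a0.
have h0 k : `|(0 : R)| <= a * lw k by rewrite normr0 mulr_ge0 ?lw_ge0.
rewrite /cos_series /trig_series -climitB.
- by congr climit; apply/funext => k; rewrite /trig_term; ring.
- exact: csummable_trig (csummable_Zlw a) hA h0 x.
- exact: csummable_trig (csummable_Zlw a) hA' h0 x.
Qed.

(** The difference of cubes is [v - v'] times [v^2 + v v' + v'^2]. *)
Lemma cbound_cubicB A A' a rho : (forall k, `|A k| <= a * lw k) -> (forall k, `|A' k| <= a * lw k) ->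
  (forall k, `|A k - A' k| <= rho * lw k) -> 0 <= a -> 0 <= rho ->
  cbound ((3 * c0 ^+ 2 * a ^+ 2 + 1) * rho) (fun x => cubic A x - cubic A' x).
Proof.
move=> hA hA' hB a0 r0.
have b := cbound_series hA a0; have b' := cbound_series hA' a0.
have s1 := cboundD (cbound_mul hA a0 a0 b) (cboundD (cbound_mul hA a0 a0 b') (cbound_mul hA' a0 a0 b')).
have B0 : 0 <= c0 * a * a by rewrite !mulr_ge0.
have s2 := cbound_mul hB r0 (addr_ge0 B0 (addr_ge0 B0 B0)) s1.
have := cboundD s2 (cboundN (cbound_series hB r0)).
rewrite (_ : c0 * rho * _ + rho = (3 * c0 ^+ 2 * a ^+ 2 + 1) * rho); last by ring.
congr cbound; apply/funext => x; rewrite /cubic (cos_seriesB x hA hA' a0); ring.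
Qed.

End LineWeight.

(** * Linear relaxation equations and dominated limits *)

Section LinearODE.
Variable R : realType.
Local Notation mu := (@lebesgue_measure R).

(** Solution of [y' = - lam y + f]. The integral starts at -1 so that the derivative at 0 is
    two-sided. *)
Definition relax (lam y0 : R) (f : R -> R) (t : R) : R :=
  let F y := \int[mu]_(s in `[- 1, y]) (expR (lam * s) * f s) in
  expR (- lam * t) * (y0 + (F t - F 0)).

Lemma relax0 lam y0 f : relax lam y0 f 0 = y0.
Proof. by rewrite /relax mulr0 expR0 mul1r subrr addr0. Qed.

Lemma is_derive_relax (lam y0 : R) (f : R -> R) (t : R) : continuous f -> 0 <= t ->
  is_derive t (1 : R) (relax lam y0 f) (- (lam * relax lam y0 f t) + f t).
Proof.
move=> cf t0; pose g s := expR (lam * s) * f s.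
have cg : continuous g.
  move=> s; suff: {for s, continuous g} by [].
  apply: continuousM; last exact: cf.
  apply: (@continuous_comp _ _ _ (fun s => lam * s) expR); last exact: continuous_expR.
  by apply: continuousM; [exact: cst_continuous|exact: cvg_id].
pose F y := \int[mu]_(s in `[- 1, y]) g s.
have dF : is_derive t (1 : R) F (g t).
  have tt : t < t + 1 by rewrite ltrDl.
  have ig : mu.-integrable `[- 1, t + 1] (EFin \o g).
    apply: continuous_compact_integrable; first exact: segment_compact.
    exact: continuous_subspaceT.
  have t1 : -1 < t by apply: lt_le_trans t0; rewrite oppr_lt0.
  have [dF1 dF2] := @continuous_FTC1_closed R g (-1) t (t + 1) tt ig t1 (cg t).
  have dF2' : 'D_1 F t = g t by rewrite -derive1E; exact: dF2.
  exact: DeriveDef dF1 dF2'.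
have d0 : is_derive t (1 : R) (fun y => - lam * y) (- lam).
  have := @is_deriveZ _ _ _ (@id R) (- lam) t 1 _ (is_derive_id _ _).
  by rewrite /GRing.scale/= mulr1.
have d1 := @is_derive1_comp _ expR (fun y => - lam * y) t _ _ (is_derive_expR _) d0.
have d2 : is_derive t (1 : R) (fun y => y0 + (F y - F 0)) (g t).
  have := @is_deriveD _ _ _ (cst y0) _ t 1 _ _ (is_derive_cst _ _ _)
    (@is_deriveB _ _ _ F (cst (F 0)) t 1 _ _ dF (is_derive_cst _ _ _)).
  by rewrite add0r subr0.
have := @is_deriveM _ _ _ _ t 1 _ _ d1 d2.
rewrite /GRing.scale/=; congr (is_derive _ _ _ _).
have -> : f t = expR (- lam * t) * g t by rewrite /g mulrA -expRD mulNr addNr expR0 mul1r.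
by rewrite /relax -/(F t) -/(F 0); move: (F t) (F 0) (expR _) (g t) => a b c e; ring.
Qed.

Lemma ode_le (lam M : R) (y f : R -> R) : 0 < lam ->
  (forall t : R, 0 <= t -> is_derive t (1 : R) y (- (lam * y t) + f t)) ->
  (forall t : R, 0 <= t -> f t <= M) -> 0 <= M ->
  forall t : R, 0 <= t -> y t - expR (- (lam * t)) * y 0 <= M / lam.
Proof.
move=> l0 dy fM M0 t; rewrite le_eqVlt => /predU1P[<-|t0].
  by rewrite mulr0 oppr0 expR0 mul1r subrr divr_ge0// ltW.
have nl : - lam != 0 by rewrite oppr_eq0 gt_eqF.
have h1 (r : R) : 0 <= r <= t -> is_derive r (1 : R) y (- (lam * y r) + f r) by case/andP=> r0 _; exact: dy.
have h2 r : 0 <= r <= t -> - (lam * y r) + f r <= - lam * y r + M.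
  by case/andP=> r0 _; rewrite mulNr lerD2l fM.
have := gronwall nl t0 h1 h2; rewrite subr0 invrN mulrN mulNr.
have := expR_ge0 (- (lam * t)); move: (expR _) => E E0.
have : 0 <= M / lam by rewrite divr_ge0// ltW.
move: (M / lam) => D D0 h3.
have := mulr_ge0 E0 D0; lra.
Qed.

(** Forcing of size [M] moves the solution by at most [M / lam] from the free decay,
    uniformly in time. *)
Lemma ode_bound (lam M : R) (y f : R -> R) : 0 < lam ->
  (forall t : R, 0 <= t -> is_derive t (1 : R) y (- (lam * y t) + f t)) ->
  (forall t : R, 0 <= t -> `|f t| <= M) ->
  forall t : R, 0 <= t -> `|y t - expR (- (lam * t)) * y 0| <= M / lam.
Proof.
move=> l0 dy fM t t0; have M0 : 0 <= M by apply: le_trans (fM 0 _).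
rewrite ler_norml; apply/andP; split; last first.
  by apply: (ode_le l0 dy) => // r /fM; rewrite ler_norml => /andP[].
rewrite lerNl.
have dN (r : R) : 0 <= r -> is_derive r (1 : R) (fun s => - y s) (- (lam * - y r) + - f r).
  move=> /dy d; have := @is_deriveN _ _ _ y r 1 _ d.
  by congr (is_derive _ _ _ _); ring.
have := ode_le l0 dN _ M0 t0; rewrite mulrN opprB [in X in _ -> X]addrC opprK; apply.
by move=> r /fM; rewrite ler_norml lerNl => /andP[].
Qed.

(** The limit is the supremum of the lower ends of the nested intervals. *)
Lemma geometric_limit (x : nat -> R) (C : R) : (forall p q, (p <= q)%N -> `|x q - x p| <= C / 2 ^+ p) ->
  exists l, forall p, `|l - x p| <= C / 2 ^+ p.
Proof.
move=> h; pose S := [set x p - C / 2 ^+ p | p in [set: nat]].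
have hS p q : x p - C / 2 ^+ p <= x q + C / 2 ^+ q.
  have [pq|qp] := leqP p q.
    have := h p q pq; have := le_trans (normr_ge0 _) (h q q (leqnn q)); rewrite ler_norml; lra.
  have := h q p (ltnW qp); have := le_trans (normr_ge0 _) (h p p (leqnn p)); rewrite ler_norml; lra.
have hs : has_sup S.
  split; first by exists (x 0%N - C / 2 ^+ 0); exists 0%N.
  by exists (x 0%N + C / 2 ^+ 0) => _ [p _ <-]; exact: hS.
exists (sup S) => p; rewrite ler_distl; apply/andP; split.
  by apply: sup_upper_bound => //; exists p.
by apply: ge_sup; [by case: hs|move=> _ [q _ <-]; exact: hS].
Qed.

Lemma geometric_le0 (x C : R) : 0 <= C -> (forall p : nat, x <= C / 2 ^+ p) -> x <= 0.
Proof.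
move=> C0 h; rewrite leNgt; apply/negP => x0.
have := h (Num.trunc (C / x)).+1; apply/negP; rewrite -ltNge ltr_pdivrMr ?exprn_gt0//.
rewrite mulrC -ltr_pdivrMr//; apply: lt_trans (truncnS_gt _) _.
by rewrite -natrX ltr_nat ltn_expl.
Qed.

End LinearODE.

Section DominatedTime.
Variables (R : realType) (d : nat).
Local Notation E := 'rV[R]_d.
Local Notation K := 'rV[int]_d.
Local Notation ctorus := (@ctorus R d).

(** Dominated convergence for series that depend on time. It yields continuity of the
    solution in every norm of the definition. *)
Lemma dominated_csum (phi : R -> K -> R) (G : K -> R) (s : R) : csummable G ->
  (forall r k, `|phi r k| <= G k) -> (forall k, {for s, continuous (phi^~ k)}) ->
  (forall k, phi s k = 0) ->
  forall e : R, 0 < e -> exists2 del : R, 0 < del &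
    forall r, `|r - s| < del -> forall N, csum N (fun k => `|phi r k|) <= e.
Proof.
move=> sG hG cphi phi0 e e0.
have G0 k : 0 <= G k by apply: le_trans (hG s k).
have e4 : 0 < e / 4 by rewrite divr_gt0.
have [N0 hN0] := climit_uniform sG e4.
have GG k : `|G k| <= G k by rewrite ger0_norm.
have cS : {for s, continuous (fun r => csum N0 (fun k => `|phi r k|))}.
  under [X in {for s, continuous X}]eq_fun do rewrite csumE.
  apply: continuous_sumr_at => a _.
  by apply: (@continuous_comp _ _ _ (phi^~ (cube_pt a)) (fun x => `|x|)); [exact: cphi|exact: norm_continuous].
have /cvgrPdist_le/(_ _ e4)/nbhs_ballP[del /= del0 hdel] := cS.
exists del => // r rs N.
have h1 : csum N0 (fun k => `|phi r k|) <= e / 4.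
  have := hdel r; rewrite /ball/= distrC => /(_ rs).
  have -> : csum N0 (fun k => `|phi s k|) = 0.
    by rewrite csumE big1// => a _; rewrite phi0 normr0.
  by rewrite sub0r normrN; apply: le_trans; exact: ler_norm.
have [NN0|N0N] := leqP N N0.
  apply: le_trans (csum_mono (fun k => normr_ge0 _) NN0) _; lra.
have h2 := csum_diff_le (F := fun k => `|phi r k|) (G := G) (fun k => _) (ltnW N0N).
have {}h2 : `|csum N (fun k => `|phi r k|) - csum N0 (fun k => `|phi r k|)| <= csum N G - csum N0 G.
  by apply: h2 => k; rewrite normr_id.
have h3 := hN0 N0 (leqnn _) G GG; have h4 := hN0 N (ltnW N0N) G GG.
move: h2 h3 h4; rewrite !ler_norml; lra.
Qed.

End DominatedTime.

(** * The fixed point for the slope coefficients *)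

Section Picard.
Variables (R : realType) (d : nat) (i0 : 'I_d) (n m : nat).
Local Notation E := 'rV[R]_d.
Local Notation K := 'rV[int]_d.
Local Notation ctorus := (@ctorus R d).
Local Notation lw := (@lw R d i0 n m).
Local Notation c0 := (10 * 4 ^+ m : R).
Hypothesis m1 : (0 < m)%N.
Variables (nu a : R) (a0 : K -> R).
Hypotheses (nu0 : 0 < nu) (apos : 0 < a) (ha0 : forall k, `|a0 k| <= a * lw k)
  (a0N : forall k, a0 (- k) = a0 k).

Local Notation q k := (freq_sq R (k : K)).
Definition rate (k : K) : R := nu * q k ^+ 2.

Definition cubic_bound : R := c0 ^+ 2 * (4 * a) ^+ 3 + 4 * a.
Definition cubic_lip : R := 3 * c0 ^+ 2 * (4 * a) ^+ 2 + 1.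
(** Size of the response to the second-order part of the equation, small for large [n]. *)
Definition gain : R := (nu * n.+1%:R ^+ 2)^-1.
Hypotheses (small_bound : gain * cubic_bound <= a) (small_lip : gain * cubic_lip <= 2^-1).

Lemma freq_sq_on (k : K) : k != 0 -> onL i0 n k -> n.+1%:R ^+ 2 <= q k.
Proof.
move=> k0 /onLP[l e]; apply: le_trans (freq_le_sq R k i0).
have l0 : l != 0.
  apply: contra_neq k0 => l0; rewrite e l0; apply/rowP => j; rewrite !mxE mulr0.
  by case: ifP.
rewrite e mxE eqxx intrM exprMn; apply: ler_peMr; first exact: sqr_ge0.
rewrite -[_ ^+ 2]real_normK ?num_real// -intr_norm -[leLHS](expr1n _ 2).
by rewrite lerXn2r ?nnegrE// ler1z -gtz0_ge1 normr_gt0.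
Qed.

Lemma freq_sq_gt0 (k : K) : k != 0 -> 0 < q k.
Proof.
move=> k0; have [j kj] : exists j, k ord0 j != 0.
  apply/existsP; move: k0; apply: contraR; rewrite negb_exists => /forallP h.
  by apply/eqP/rowP => j; rewrite !mxE; apply/eqP; have := h j; rewrite negbK.
apply: lt_le_trans (freq_le_sq R k j).
by rewrite lt_neqAle sqr_ge0 andbT eq_sym expf_eq0/= intr_eq0.
Qed.

Lemma rate_gt0 (k : K) : k != 0 -> 0 < rate k.
Proof. by move=> /freq_sq_gt0 h; rewrite mulr_gt0// exprn_gt0. Qed.

(** The factor [|k|^2] of the nonlinearity against the rate [nu |k|^4] leaves
    [1 / (nu |k|^2)], and nonzero frequencies of the line have length at least [n + 1]. *)
Lemma rate_gain (k : K) (B : R) : k != 0 -> 0 <= B ->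
  q k * (B * lw k) / rate k <= gain * B * lw k.
Proof.
move=> k0 B0; have [h|h] := boolP (onL i0 n k); last by rewrite lw_off// !mulr0 mul0r.
have q0 := freq_sq_gt0 k0; have hq := freq_sq_on k0 h.
have -> : q k * (B * lw k) / rate k = (nu * q k)^-1 * (B * lw k).
  by rewrite /rate; field; rewrite !gt_eqF.
rewrite -mulrA; apply: ler_wpM2r; first by rewrite mulr_ge0 ?lw_ge0.
by rewrite /gain lef_pV2 ?posrE ?mulr_gt0 ?exprn_gt0// ler_pM2l.
Qed.

Definition good (u : K -> R -> R) :=
  (forall k, continuous (u k)) /\ forall k t, `|u k t| <= 4 * a * lw k.

Definition cubic_coef (u : K -> R -> R) (k : K) (s : R) : R := cos_coef (cubic (u^~ s)) k.

Let a4 : 0 <= 4 * a. Proof. by rewrite mulr_ge0// ltW. Qed.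
Let zb k : `|(0 : R)| <= 4 * a * lw k. Proof. by rewrite normr0 mulr_ge0 ?lw_ge0. Qed.

Lemma cubic_bound_ge0 : 0 <= cubic_bound.
Proof. by rewrite addr_ge0// mulr_ge0 ?exprn_ge0// sqr_ge0. Qed.

Lemma good_modulus u s : good u -> forall e : R, 0 < e -> exists2 del : R, 0 < del &
  forall r, `|r - s| < del -> forall x : E, `|cos_series (u^~ r) x - cos_series (u^~ s) x| <= e.
Proof.
move=> [cu hu] e e0.
pose phi r k := u k r - u k s.
have hphi r k : `|phi r k| <= 8 * a * lw k.
  by apply: le_trans (ler_normB _ _) _; have := hu k r; have := hu k s; lra.
have cphi k : {for s, continuous (phi^~ k)}.
  by apply: continuousB; [exact: cu|exact: cst_continuous].
have [|del del0 hdel] := dominated_csum (csummable_Zlw i0 n m1 (8 * a)) hphi cphi _ e0.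
  by move=> k; rewrite /phi subrr.
exists del => // r rs x.
rewrite -(cos_seriesB m1 x (fun k => hu k r) (fun k => hu k s) a4).
apply: climit_norm_le => N; apply: le_trans (hdel r rs N).
apply: csum_le => k; rewrite /trig_term mul0r addr0 normrM ler_piMr//.
by rewrite ler_norml cos_geN1 cos_le1.
Qed.

Lemma good_tcont u c T : good u -> tcont T (fun r => @cos_series R d (u^~ (r + c))).
Proof.
move=> gu; split=> [t _|t _ e e0].
  exact: ctorus_trig_series (csummable_Zlw i0 n m1 _) (fun k => gu.2 k _) zb.
have [del del0 hdel] := good_modulus (t + c) gu e0.
exists del => // r _ rt x; apply: hdel.
by rewrite opprD addrACA subrr addr0.
Qed.

Lemma good_tcont_cubic u c T : good u -> tcont T (fun r => @cubic R d (u^~ (r + c))).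
Proof.
move=> gu; have t1 := good_tcont c T gu.
have := tcontB (tcontM t1 (tcontM t1 t1)) t1.
by congr tcont; apply/funext => r; apply/funext => x; rewrite /cubic; ring.
Qed.

(** Shifting time by [s - 1] moves the point [s] to 1, inside the range of [tcont_mean]. *)
Lemma continuous_cubic_coef u k : good u -> continuous (cubic_coef u k).
Proof.
move=> gu s; suff : {for s, continuous (cubic_coef u k)} by [].
have tt := tcontM (good_tcont_cubic (s - 1) 2 gu) (tcont_cst 2 (ctorus_cos0 R k)).
have one : 0 < (1 : R) < 2 by rewrite ltr01 ltr1n.
have h := tcont_mean tt one.
pose F r := mean (fun x : E => cubic (u^~ (r + (s - 1))) x * cos (freq_dot k x)).
have cB : {for s, continuous (fun r : R => r - (s - 1))}.
  by apply: continuousB; [exact: cvg_id|exact: cst_continuous].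
have h' : {for s - (s - 1), continuous F} by rewrite (_ : s - (s - 1) = 1); [exact: h|ring].
have -> : cubic_coef u k = F \o (fun r => r - (s - 1)).
  by apply/funext => r; rewrite /F /= subrK.
exact: (continuous_comp cB h').
Qed.

Lemma cubic_coef_bound u k s : good u -> `|cubic_coef u k s| <= cubic_bound * lw k.
Proof. move=> gu; exact: (cbound_cubic m1 (fun k => gu.2 k s) a4).2. Qed.

Lemma cubic_coef_lip u u' rho k s : good u -> good u' -> 0 <= rho ->
  (forall k s, `|u k s - u' k s| <= rho * lw k) ->
  `|cubic_coef u k s - cubic_coef u' k s| <= cubic_lip * rho * lw k.
Proof.
move=> gu gu' r0 hr.
have cc := (cbound_cubic m1 (fun k => gu.2 k s) a4).1.
have cc' := (cbound_cubic m1 (fun k => gu'.2 k s) a4).1.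
rewrite /cubic_coef -cos_coefB//.
exact: (cbound_cubicB m1 (fun k => gu.2 k s) (fun k => gu'.2 k s) (fun k => hr k s) a4 r0).2.
Qed.

Definition picard_ode u (k : K) : R -> R := relax (rate k) (a0 k) (fun s => - (q k * cubic_coef u k s)).

(** Time is clamped at 0, so that coefficients are continuous functions on the whole line. *)
Definition picard u (k : K) (t : R) : R := if k == 0 then 0 else picard_ode u k (Num.max t 0).

Lemma picard_ode0 u k : picard_ode u k 0 = a0 k.
Proof. exact: relax0. Qed.

Lemma is_derive_picard_ode u k (t : R) : good u -> 0 <= t ->
  is_derive t (1 : R) (picard_ode u k) (- (rate k * picard_ode u k t) + - (q k * cubic_coef u k t)).
Proof.
move=> gu t0; apply: is_derive_relax => // s.
suff : {for s, continuous (fun s => - (q k * cubic_coef u k s))} by [].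
apply: continuousN; apply: continuousM; first exact: cst_continuous.
exact: (@continuous_cubic_coef u k gu s).
Qed.

Let max0 (t : R) : 0 <= Num.max t 0. Proof. by rewrite le_max lexx orbT. Qed.

Lemma picard_linear u k (t : R) : good u -> 0 <= t ->
  `|picard u k t - expR (- (rate k * t)) * (if k == 0 then 0 else a0 k)| <= gain * cubic_bound * lw k.
Proof.
have g0 : 0 <= gain by rewrite invr_ge0 mulr_ge0 ?(ltW nu0)// sqr_ge0.
move=> gu t0; rewrite /picard; case: eqVneq => [_|k0].
  by rewrite mulr0 subrr normr0 !mulr_ge0 ?cubic_bound_ge0 ?lw_ge0.
rewrite (max_idPl t0); apply: le_trans (rate_gain k0 cubic_bound_ge0).
have -> : a0 k = picard_ode u k 0 by rewrite picard_ode0.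
apply: (ode_bound (rate_gt0 k0) (fun r r0 => is_derive_picard_ode k gu r0)) => // r _.
rewrite normrN normrM ger0_norm ?freq_sq_ge0//.
by apply: ler_wpM2l; [exact: freq_sq_ge0|exact: cubic_coef_bound].
Qed.

Lemma picard_good u : good u -> good (picard u).
Proof.
move=> gu; split=> [k|k t].
  move=> s; suff : {for s, continuous (picard u k)} by [].
  rewrite /picard; case: eqVneq => [_|k0]; first exact: cst_continuous.
  apply: (@continuous_comp _ _ _ (fun t : R => Num.max t 0) (picard_ode u k)).
    by apply: continuous_max; [exact: cvg_id|exact: cst_continuous].
  have d1 := is_derive_picard_ode k gu (max0 s).
  by apply/differentiable_continuous/derivable1_diffP; case: d1.
have -> : picard u k t = picard u k (Num.max t 0).
  by rewrite /picard (max_idPl (max0 t)).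
have h := picard_linear k gu (max0 t).
have h2 : `|expR (- (rate k * Num.max t 0)) * (if k == 0 then 0 else a0 k)| <= a * lw k.
  rewrite normrM ger0_norm ?expR_ge0//; apply: le_trans (_ : 1 * (a * lw k) <= _); last by rewrite mul1r.
  apply: ler_pM; rewrite ?expR_ge0//.
    by rewrite -[leRHS]expR0 ler_expR oppr_le0 mulr_ge0// mulr_ge0 ?sqr_ge0// ltW.
  by case: ifP => _; [rewrite normr0 mulr_ge0 ?lw_ge0// ltW|exact: ha0].
have h3 := ler_wpM2r (lw_ge0 R i0 n m k) small_bound.
have al : 0 <= a * lw k by rewrite mulr_ge0 ?lw_ge0// ltW.
rewrite -[X in `|X|](subrK (expR (- (rate k * Num.max t 0)) * (if k == 0 then 0 else a0 k))).
apply: le_trans (ler_normD _ _) _; lra.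
Qed.

(** The difference of two images relaxes from 0 under a forcing that is Lipschitz in the
    coefficients; the gain makes the constant 1/2. *)
Lemma picard_lip u u' rho : good u -> good u' -> 0 <= rho ->
  (forall k s, `|u k s - u' k s| <= rho * lw k) ->
  forall k s, `|picard u k s - picard u' k s| <= rho / 2 * lw k.
Proof.
move=> gu gu' r0 hr k s; rewrite /picard; case: eqVneq => [_|k0].
  by rewrite subrr normr0 !mulr_ge0 ?lw_ge0 ?invr_ge0.
have L0 : 0 <= cubic_lip by rewrite /cubic_lip addr_ge0// mulr_ge0 ?sqr_ge0// mulr_ge0 ?sqr_ge0.
have dd (t : R) : 0 <= t -> is_derive t (1 : R) (fun t => picard_ode u k t - picard_ode u' k t)
    (- (rate k * (picard_ode u k t - picard_ode u' k t)) + - (q k * (cubic_coef u k t - cubic_coef u' k t))).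
  move=> t0; have := @is_deriveB _ _ _ _ _ t 1 _ _ (is_derive_picard_ode k gu t0) (is_derive_picard_ode k gu' t0).
  congr (is_derive _ _ _ _); move: (picard_ode u k t) (picard_ode u' k t) (cubic_coef u k t) (cubic_coef u' k t) => x y z w.
  by ring.
have bb (t : R) : 0 <= t -> `|- (q k * (cubic_coef u k t - cubic_coef u' k t))| <= q k * (cubic_lip * rho * lw k).
  move=> _; rewrite normrN normrM ger0_norm ?freq_sq_ge0//.
  by apply: ler_wpM2l; [exact: freq_sq_ge0|exact: cubic_coef_lip].
have := ode_bound (rate_gt0 k0) dd bb (max0 s).
move: (Num.max s 0) => r.
rewrite !picard_ode0; move: (picard_ode u k r) (picard_ode u' k r) => y y'.
rewrite subrr mulr0 subr0 => h; apply: le_trans h _.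
apply: le_trans (rate_gain k0 (mulr_ge0 L0 r0)) _.
apply: ler_wpM2r; first exact: lw_ge0.
rewrite mulrA mulrC; apply: ler_wpM2l => //.
Qed.

Lemma picard_even u k t : picard u (- k) t = picard u k t.
Proof.
rewrite /picard oppr_eq0; case: eqVneq => [//|_].
have e1 : rate (- k) = rate k by rewrite /rate freq_sqN.
have e2 : (fun s => - (q (- k) * cubic_coef u (- k) s)) = (fun s => - (q k * cubic_coef u k s)).
  by apply/funext => s; rewrite freq_sqN /cubic_coef cos_coefN.
by rewrite /picard_ode e1 e2 a0N.
Qed.

Fixpoint picard_iter p : K -> R -> R := if p is p'.+1 then picard (picard_iter p') else fun _ _ => 0.

Lemma picard_iterS p : picard_iter p.+1 = picard (picard_iter p).
Proof. by []. Qed.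

Lemma picard_iter_good p : good (picard_iter p).
Proof.
elim: p => [|p IH]; last exact: picard_good.
by split=> [k|k t]; [exact: cst_continuous|exact: zb].
Qed.

Lemma picard_iter_step p k t : `|picard_iter p.+1 k t - picard_iter p k t| <= 4 * a / 2 ^+ p * lw k.
Proof.
elim: p k t => [|p IH] k t.
  by rewrite subr0 expr0 divr1; exact: (picard_iter_good 1).2.
have r0 : 0 <= 4 * a / 2 ^+ p by rewrite divr_ge0.
have := picard_lip (picard_iter_good p.+1) (picard_iter_good p) r0 IH k t.
by rewrite exprSr invfM mulrA.
Qed.

Lemma picard_iter_cauchy k t p r : (p <= r)%N ->
  `|picard_iter r k t - picard_iter p k t| <= 8 * a * lw k / 2 ^+ p.
Proof.
move=> pr; rewrite -(subnK pr); move: (r - p)%N => j {r pr}.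
suff h : `|picard_iter (j + p) k t - picard_iter p k t| <= 8 * a * lw k / 2 ^+ p - 8 * a * lw k / 2 ^+ (j + p).
  by apply: le_trans h _; rewrite gerBl divr_ge0// !mulr_ge0 ?lw_ge0// ltW.
elim: j => [|j IH]; first by rewrite !subrr normr0.
have := picard_iter_step (j + p) k t.
have -> : 8 * a * lw k / 2 ^+ (j.+1 + p) = 4 * a / 2 ^+ (j + p) * lw k.
  by rewrite addSn exprS; field; rewrite expf_neq0.
have e8 : 8 * a * lw k / 2 ^+ (j + p) = 2 * (4 * a / 2 ^+ (j + p) * lw k).
  by field; rewrite expf_neq0.
rewrite e8 in IH.
rewrite addSn; move: IH; set D := 4 * a / _ * _ => IH h.
have -> : picard_iter (j + p).+1 k t - picard_iter p k t =
  (picard_iter (j + p).+1 k t - picard_iter (j + p) k t) + (picard_iter (j + p) k t - picard_iter p k t).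
  by rewrite addrA subrK.
apply: le_trans (ler_normD _ _) _; lra.
Qed.

Lemma picard_fixed : exists2 u : K -> R -> R, good u & picard u = u.
Proof.
have [w hw] : exists w : K * R -> R, forall kt p,
    `|w kt - picard_iter p kt.1 kt.2| <= 8 * a * lw kt.1 / 2 ^+ p.
  suff /choice[w hw] : forall kt : K * R, exists l : R, forall p,
    `|l - picard_iter p kt.1 kt.2| <= 8 * a * lw kt.1 / 2 ^+ p by exists w.
  move=> [k t] /=; exact: geometric_limit (fun p q pq => picard_iter_cauchy k t pq).
pose u k t := w (k, t).
have hu k t p : `|u k t - picard_iter p k t| <= 8 * a * lw k / 2 ^+ p := hw (k, t) p.
have b8 k : 0 <= 8 * a * lw k by rewrite !mulr_ge0 ?lw_ge0// ltW.
have cu k : continuous (u k).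
  move=> s; apply/cvgrPdist_le => e e0.
  have [p hp] : exists p : nat, 8 * a * lw k / 2 ^+ p <= e / 3.
    apply: contrapT => h; have : e / 3 <= 0.
      apply: (geometric_le0 (b8 k)) => p; rewrite leNgt; apply/negP => hl.
      by apply: h; exists p; exact: ltW.
    by move=> h'; lra.
  have e3 : 0 < e / 3 by rewrite divr_gt0.
  have /cvgrPdist_le/(_ _ e3) := (picard_iter_good p).1 k s.
  apply: filterS => r hr; have := hu k s p; have := hu k r p.
  move: hp hr; rewrite !ler_norml; lra.
have gu : good u.
  split=> // k t; rewrite -subr_le0; apply: (geometric_le0 (b8 k)) => p.
  have := hu k t p; have := (picard_iter_good p).2 k t.
  have := ler_normD (u k t - picard_iter p k t) (picard_iter p k t); rewrite subrK; lra.
exists u => //.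
apply/funext => k; apply/funext => t; apply/eqP; rewrite -subr_eq0 -normr_le0.
apply: (geometric_le0 (b8 k)) => p.
have r0 : 0 <= 8 * a / 2 ^+ p by rewrite divr_ge0// mulr_ge0// ltW.
have hr k' s : `|u k' s - picard_iter p k' s| <= 8 * a / 2 ^+ p * lw k'.
  by apply: le_trans (hu k' s p) _; rewrite mulrAC.
have h1 := picard_lip gu (picard_iter_good p) r0 hr k t.
have h2 := hu k t p.+1.
have -> : picard u k t - u k t = (picard u k t - picard_iter p.+1 k t) - (u k t - picard_iter p.+1 k t).
  by rewrite opprB addrA subrK.
apply: le_trans (ler_normB _ _) _.
rewrite -picard_iterS in h1; move: h1 h2; move: (picard_iter p.+1 k t) (picard u k t) => x y.
have -> : 8 * a * lw k / 2 ^+ p.+1 = 8 * a * lw k / 2 ^+ p / 2 by rewrite exprSr invfM mulrA.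
have -> : 8 * a / 2 ^+ p / 2 * lw k = 8 * a * lw k / 2 ^+ p / 2 by ring.
lra.
Qed.

(** Last comes the distance to the linear flow, which decides the size of the slope at
    the time of growth. *)
Lemma picard_solution : exists u : K -> R -> R,
  [/\ good u, forall k t, u (- k) t = u k t,
      forall k, k != 0 -> u k 0 = a0 k,
      forall k (t : R), 0 < t -> is_derive t (1 : R) (u k) (- (rate k * u k t) - q k * cubic_coef u k t) &
      (forall t, u 0 t = 0) /\ forall k (t : R), k != 0 -> 0 <= t ->
        `|u k t - expR (- (rate k * t)) * a0 k| <= gain * cubic_bound * lw k].
Proof.
have [u gu fu] := picard_fixed.
have u0 t : u 0 t = 0 by rewrite -fu /picard eqxx.
exists u; split=> //.
- by move=> k t; rewrite -fu picard_even.
- move=> k k0; rewrite -[in LHS]fu /picard (negbTE k0) (max_idPl (lexx 0)).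
  by rewrite picard_ode0.
- move=> k t t0; have [->|k0] := eqVneq k 0.
    have -> : u 0 = cst 0 by apply/funext => s; exact: u0.
    have -> : q 0 = 0 by rewrite /freq_sq big1// => j _; rewrite mxE expr0n.
    by rewrite /= mulr0 oppr0 mul0r subr0; exact: is_derive_cst.
  have pE (s : R) : 0 <= s -> u k s = picard_ode u k s.
    by move=> s0; rewrite -[in LHS]fu /picard (negbTE k0) (max_idPl s0).
  have := is_derive_picard_ode k gu (ltW t0); rewrite -(pE t (ltW t0)).
  apply: near_eq_is_derive; near=> s; rewrite pE//; apply: ltW; near: s; exact: lt_nbhsr.
- split=> // k t k0 t0; have := picard_linear k gu t0; by rewrite fu (negbTE k0).
Unshelve. all: by end_near. Qed.

End Picard.

(** * Tools for the mild formulation: integrals on segments and Sobolev norms *)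

Section SegmentIntegral.
Variable R : realType.
Local Notation mu := (@lebesgue_measure R).

Lemma integral_segment_ftc_open (f F : R -> R) (a b : R) : a < b -> continuous f -> continuous F ->
  (forall x : R, a < x < b -> is_derive x (1 : R) F (f x)) ->
  \int[mu]_(y in `[a, b]) f y = F b - F a.
Proof.
move=> ab cf cF dF; rewrite /Rintegral (@continuous_FTC2 R f F)//.
- exact: continuous_subspaceT.
- split; first by move=> x; rewrite in_itv/= => /dF [].
    exact/cvg_at_right_filter/cF.
  exact/cvg_at_left_filter/cF.
- by move=> x; rewrite in_itv/= => /dF ?; rewrite derive1E derive_val.
Qed.

Lemma integrable_segment (f : R -> R) (a b : R) : continuous f -> mu.-integrable `[a, b] (EFin \o f).
Proof.
move=> cf; apply: continuous_compact_integrable; first exact: segment_compact.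
exact: continuous_subspaceT.
Qed.

Lemma integral_segment_close (f g : R -> R) (a b e : R) : a < b -> continuous f -> continuous g ->
  (forall s, a <= s <= b -> `|f s - g s| <= e) ->
  `|\int[mu]_(s in `[a, b]) f s - \int[mu]_(s in `[a, b]) g s| <= e * (b - a).
Proof.
move=> ab cf cg h.
have mI : measurable (`[a, b]%classic : set (measurableTypeR R)) by exact: measurable_itv.
have i1 := integrable_segment a b cf; have i2 := integrable_segment a b cg.
have cfg : continuous (fun s => f s - g s) by move=> s; apply: continuousB; [exact: cf|exact: cg].
have i3 := integrable_segment a b cfg.
have cn : continuous (fun s => `|f s - g s|).
  by move=> s; apply: (@continuous_comp _ _ _ (fun s => f s - g s) (fun x => `|x|)); [exact: cfg|exact: norm_continuous].
have ce : continuous (fun _ : R => e) by exact: cst_continuous.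
rewrite -RintegralB//; apply: le_trans (le_normr_Rintegral mI i3) _.
apply: le_trans (_ : \int[mu]_(s in `[a, b]) e <= _).
  apply: (le_Rintegral mI (integrable_segment a b cn) (integrable_segment a b ce)).
  by move=> s; rewrite /= in_itv/= => /h.
have cl : continuous (fun x : R => e * x).
  by move=> x; apply: continuousM; [exact: cst_continuous|exact: cvg_id].
have dl (x : R) : a < x < b -> is_derive x (1 : R) (fun x => e * x) e.
  have := @is_deriveZ _ _ _ (@id R) e x 1 _ (is_derive_id _ _).
  by rewrite /GRing.scale/= mulr1.
by rewrite (integral_segment_ftc_open ab ce cl dl) mulrBr.
Qed.

(** Concavity of the fourth root, from [(x + y)^4 >= x^4 + y^4]. *)
Lemma root4_sub (s t : R) : 0 <= t -> t <= s -> root4 s - root4 t <= root4 (s - t).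
Proof.
move=> t0 ts; rewrite lerBlDl.
have h1 := root4_ge0 t; have h2 := root4_ge0 (s - t).
rewrite -(@ler_pXn2r _ 4)// ?nnegrE ?root4_ge0// ?addr_ge0//.
have e1 := root4X t0; have e2 : root4 (s - t) ^+ 4 = s - t by rewrite root4X// subr_ge0.
rewrite root4X ?(le_trans t0)//.
rewrite [leLHS](_ : _ = root4 t ^+ 4 + root4 (s - t) ^+ 4); last by rewrite e1 e2 addrC subrK.
move: (root4 t) (root4 (s - t)) h1 h2 => x y x0 y0.
have -> : (x + y) ^+ 4 = x ^+ 4 + y ^+ 4 + x * y * (4 * x ^+ 2 + 6 * x * y + 4 * y ^+ 2) by ring.
by rewrite lerDl !mulr_ge0// !addr_ge0 ?mulr_ge0 ?sqr_ge0.
Qed.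

Lemma root4_small (e : R) : 0 < e -> exists2 del : R, 0 < del &
  forall s t, 0 <= s -> 0 <= t -> `|s - t| < del -> `|root4 s - root4 t| <= e.
Proof.
move=> e0; exists (e ^+ 4); first by rewrite exprn_gt0.
have sm r : 0 <= r -> r < e ^+ 4 -> root4 r <= e.
  move=> r0 re; rewrite -(@ler_pXn2r _ 4)// ?nnegrE ?root4_ge0 ?(ltW e0)//.
  by rewrite root4X// ltW.
have key s t : 0 <= t -> t <= s -> `|s - t| < e ^+ 4 -> `|root4 s - root4 t| <= e.
  move=> t0 ts; rewrite ger0_norm ?subr_ge0// => h.
  rewrite ger0_norm ?subr_ge0 ?root4_le//; apply: le_trans (root4_sub t0 ts) _.
  by apply: sm => //; rewrite subr_ge0.
move=> s t s0 t0 h; have [ts|/ltW st] := leP t s; first exact: key.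
by rewrite distrC; apply: key => //; rewrite distrC.
Qed.

Lemma cvg0e (F : set_system R) {FF : Filter F} (g : R -> \bar R) :
  (forall e : R, 0 < e -> \forall r \near F, (0 <= g r <= e%:E)%E) -> g @ F --> 0%E.
Proof.
move=> h A; rewrite /nbhs/= => -[e /= e0 hA].
have e2 : 0 < e / 2 by rewrite divr_gt0.
apply: filterS (h _ e2) => r /= /andP[]; case: (g r) => [x| |]//=.
rewrite !lee_fin => x0 xe; apply: hA; rewrite /= sub0r normrN ger0_norm//; lra.
Qed.

End SegmentIntegral.

Section SobolevUpper.
Variables (R : realType) (d : nat).
Local Notation E := 'rV[R]_d.
Local Notation K := 'rV[int]_d.
Local Notation ctorus := (@ctorus R d).

Lemma sobolev_norm_le (s e : R) (f : E -> R) : ctorus f -> 0 <= e ->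
  (forall N, csum N (fun k => (1 + freq_sq R k) `^ s * coef_sq f k) <= e ^+ 2) ->
  (sobolev_norm s f <= e%:E)%E.
Proof.
move=> cf e0 h.
have le1 : ((\esum_(k in [set: K])
    ((1 + freq_sq R k) `^ s * (complex.Re (fourier_coef f k) ^+ 2 + complex.Im (fourier_coef f k) ^+ 2))%:E) <= (e ^+ 2)%:E)%E.
  apply: ge_ereal_sup => _ [A [fA _] <-].
  have [N hN] := finite_in_cube fA.
  rewrite fsumEFin// lee_fin; apply: le_trans (h N).
  under eq_fsbigr do rewrite fourier_coef_sq//.
  by apply: csum_set_le => // k; rewrite mulr_ge0 ?powR_ge0 ?coef_sq_ge0.
have g0 : (0 <= \esum_(k in [set: K])
    ((1 + freq_sq R k) `^ s * (complex.Re (fourier_coef f k) ^+ 2 + complex.Im (fourier_coef f k) ^+ 2))%:E)%E.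
  by apply: esum_ge0 => k _; rewrite lee_fin mulr_ge0 ?powR_ge0// addr_ge0 ?sqr_ge0.
apply: le_trans (_ : ((e ^+ 2)%:E `^ 2^-1 <= _)%E).
  apply: gt0_ler_poweR => //; rewrite in_itv/= ?leey ?andbT//.
  by rewrite lee_fin sqr_ge0.
by rewrite poweR_EFin powR12_sqrt ?sqr_ge0// sqrtr_sqr ger0_norm.
Qed.

Lemma sobolev_norm_ge0 (s : R) (f : E -> R) : (0 <= sobolev_norm s f)%E.
Proof. exact: poweR_ge0. Qed.

Variables (b : K -> R -> R) (B s : R).
Hypotheses (cb : forall k, continuous (b k)) (B0 : 0 <= B)
  (hb : forall k t, `|b k t| <= B * weight R d.+1 k) (s1 : s <= d.+1%:R).

Definition sin_series (A : K -> R) : E -> R := trig_series (fun=> 0) A.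

Lemma csummable_Zweight C p : (d <= p)%N -> csummable (fun k : K => C * weight R p k).
Proof. by move=> dp; apply: csummableZ; exact: csummable_weight. Qed.

Lemma ctorus_sin_series (A : K -> R) C p : (d <= p)%N -> 0 <= C -> (forall k, `|A k| <= C * weight R p k) ->
  ctorus (sin_series A).
Proof.
move=> dp C0 hA; apply: (ctorus_trig_series (csummable_Zweight C dp) _ hA) => k.
by rewrite normr0 mulr_ge0// ltW// weight_gt0.
Qed.

Lemma coef_sq_sin_series (A : K -> R) C k : 0 <= C -> (forall k, `|A k| <= C * weight R d.+1 k) ->
  coef_sq (sin_series A) k <= 2^-1 * (A k ^+ 2 + A (- k) ^+ 2).
Proof.
move=> C0 hA.
have h0 (l : K) : `|(0 : R)| <= C * weight R d.+1 l by rewrite normr0 mulr_ge0// ltW// weight_gt0.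
have sC := csummable_Zweight C (leqnSn d).
rewrite /coef_sq (cos_coef_trig_series k sC h0 hA) (sin_coef_trig_series k sC h0 hA).
rewrite addr0 mulr0; move: (A k) (A (- k)) => x y.
have := sqr_ge0 (x + y); lra.
Qed.

Lemma sin_seriesB (A A' : K -> R) C x : 0 <= C -> (forall k, `|A k| <= C * weight R d.+1 k) ->
  (forall k, `|A' k| <= C * weight R d.+1 k) ->
  sin_series (fun k => A k - A' k) x = sin_series A x - sin_series A' x.
Proof.
move=> C0 hA hA'.
have h0 (l : K) : `|(0 : R)| <= C * weight R d.+1 l by rewrite normr0 mulr_ge0// ltW// weight_gt0.
have sC := csummable_Zweight C (leqnSn d).
rewrite /sin_series /trig_series -climitB.
- by congr climit; apply/funext => k; rewrite /trig_term; ring.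
- exact: csummable_trig sC h0 hA x.
- exact: csummable_trig sC h0 hA' x.
Qed.

Let q1 (k : K) : 1 <= 1 + freq_sq R k. Proof. by rewrite lerDl freq_sq_ge0. Qed.

Let sob_term (A : K -> R) (C : R) k : 0 <= C -> (forall k, `|A k| <= C * weight R d.+1 k) ->
  (1 + freq_sq R k) `^ s * (2^-1 * (A k ^+ 2 + A (- k) ^+ 2)) <= C ^+ 2 * weight R d.+1 k.
Proof.
move=> C0 hA.
have hp : (1 + freq_sq R k) `^ s <= (1 + freq_sq R k) ^+ d.+1.
  by rewrite -powR_mulrn ?(le_trans ler01)// ler_powR.
have sq (l : K) : freq_sq R l = freq_sq R k -> A l ^+ 2 <= (C * weight R d.+1 k) ^+ 2.
  have w0 : 0 <= C * weight R d.+1 k by rewrite mulr_ge0// ltW// weight_gt0.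
  move=> e; rewrite -[A l ^+ 2]real_normK ?num_real// lerXn2r ?nnegrE//.
  by have := hA l; rewrite /weight e.
have h2 : 2^-1 * (A k ^+ 2 + A (- k) ^+ 2) <= (C * weight R d.+1 k) ^+ 2.
  have := sq k erefl; have := sq (- k) (freq_sqN R k); lra.
have e : (1 + freq_sq R k) ^+ d.+1 * (C * weight R d.+1 k) ^+ 2 = C ^+ 2 * weight R d.+1 k.
  rewrite exprMn mulrCA; congr (_ * _); rewrite expr2 mulrA /weight mulfV ?mul1r//.
  by rewrite expf_neq0// gt_eqF// (lt_le_trans ltr01).
rewrite -e; apply: ler_pM => //; first exact: powR_ge0.
by rewrite mulr_ge0// addr_ge0// sqr_ge0.
Qed.

Lemma sobolev_series_finite t : exists e : R, (sobolev_norm s (sin_series (b^~ t)) <= e%:E)%E.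
Proof.
have [M hM] := csummable_Zweight (B ^+ 2) (leqnSn d).
exists (Num.sqrt M); apply: sobolev_norm_le; [|exact: sqrtr_ge0|move=> N].
  exact: (ctorus_sin_series (leqnSn d) B0 (fun k => hb k t)).
have M0 : 0 <= M by apply: le_trans (hM 0%N); exact: csum_ge0.
rewrite sqr_sqrtr//; apply: le_trans (hM N); apply: csum_le => k.
apply: le_trans (ler_norm _).
apply: le_trans (sob_term k B0 (fun k => hb k t)).
by apply: ler_wpM2l; [exact: powR_ge0|exact: coef_sq_sin_series B0 (fun k => hb k t)].
Qed.

(** Domination with [s <= d + 1]: the squared weights of order [d + 1] absorb the Sobolev
    factor and leave one summable weight. *)
Lemma sobolev_series_continuous t (e : R) : 0 < e -> exists2 del : R, 0 < del &
  forall r, `|r - t| < del ->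
    (sobolev_norm s (sin_series (b^~ r) \- sin_series (b^~ t))%R <= e%:E)%E.
Proof.
move=> e0.
pose A r k := b k r - b k t.
have hA r k : `|A r k| <= 2 * B * weight R d.+1 k.
  by apply: le_trans (ler_normB _ _) _; have := hb k r; have := hb k t; lra.
have B20 : 0 <= 2 * B by rewrite mulr_ge0.
pose phi r (k : K) := (1 + freq_sq R k) `^ s * (2^-1 * (A r k ^+ 2 + A r (- k) ^+ 2)).
have phi0 r k : 0 <= phi r k by rewrite mulr_ge0 ?powR_ge0// mulr_ge0// addr_ge0 ?sqr_ge0.
have hphi r k : `|phi r k| <= (2 * B) ^+ 2 * weight R d.+1 k.
  by rewrite ger0_norm//; exact: (sob_term k B20 (hA r)).
have cA k : {for t, continuous (A^~ k)}.
  by apply: continuousB; [exact: cb|exact: cst_continuous].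
have cphi k : {for t, continuous (phi^~ k)}.
  apply: continuousM; first exact: cst_continuous.
  apply: continuousM; first exact: cst_continuous.
  by apply: continuousD; apply: continuous_exprn_at; exact: cA.
have [|del del0 hdel] := dominated_csum (csummable_Zweight _ (leqnSn d)) hphi cphi _ (exprn_gt0 2 e0).
  by move=> k; rewrite /phi /A !subrr expr0n/= addr0 !mulr0.
exists del => // r rt.
have -> : (sin_series (b^~ r) \- sin_series (b^~ t))%R = sin_series (A r).
  apply/funext => x; exact: (esym (sin_seriesB x B0 (fun k => hb k r) (fun k => hb k t))).
apply: sobolev_norm_le; [exact: (ctorus_sin_series (leqnSn d) B20 (hA r))|exact: ltW|move=> N].
apply: le_trans (hdel r rt N); apply: csum_le => k; rewrite ger0_norm//.
by apply: ler_wpM2l; [exact: powR_ge0|exact: coef_sq_sin_series B20 (hA r)].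
Qed.

Lemma continuous_in_sobolev_series T (h : R -> E -> R) :
  (forall t, 0 <= t <= T -> h t = sin_series (b^~ t)) -> continuous_in_sobolev s T h.
Proof.
move=> hE t; rewrite in_itv/= => tT; split.
  have [e he] := sobolev_series_finite t; rewrite hE//.
  by apply: le_lt_trans he _; rewrite ltry.
have FFw : Filter (within `[0, T]%classic (nbhs t)) by exact: within_filter.
apply: cvg0e => e e0; have [del del0 hdel] := sobolev_series_continuous t e0.
rewrite near_withinE; apply/nbhs_ballP; exists del => //= r; rewrite /ball/= distrC => rt.
by rewrite in_itv/= => rT; rewrite sobolev_norm_ge0 !hE//=; exact: hdel.
Qed.

End SobolevUpper.

(** * The solution carried by a line of frequencies *)

Section LineSolution.
Variables (R : realType) (d : nat) (i0 : 'I_d) (n : nat).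
Local Notation E := 'rV[R]_d.
Local Notation K := 'rV[int]_d.
Local Notation ctorus := (@ctorus R d).
Local Notation lw := (@lw R d i0 n d.+1).
Local Notation q k := (freq_sq R (k : K)).
Local Notation k0 k := ((k : K) ord0 i0)%:~R.

Lemma freq_sq_line l : q (line_pt i0 n l) = (n.+1%:R * l%:~R) ^+ 2.
Proof.
rewrite /freq_sq (bigD1 i0)//= mxE eqxx intrM big1 ?addr0// => j ji.
by rewrite mxE (negbTE ji) expr0n.
Qed.

Lemma onL_freq_sq k : onL i0 n k -> q k = (k0 k) ^+ 2.
Proof. by move=> /onLP[l ->]; rewrite freq_sq_line mxE eqxx intrM. Qed.

(** Price of passing from the scaled weight to the isotropic one. *)
Definition line_cst : R := n.+1%:R ^+ 2 ^+ d.+1.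

Lemma line_cst_ge0 : 0 <= line_cst.
Proof. by rewrite !exprn_ge0. Qed.

Lemma lw_le_weight k : lw k <= line_cst * weight R d.+1 k.
Proof.
have w0 := ltW (weight_gt0 R d.+1 k).
have [/onLP[l e]|h] := boolP (onL i0 n k); last by rewrite lw_off// mulr_ge0 ?line_cst_ge0.
have q0 : 0 < 1 + q k by rewrite ltr_pwDl// freq_sq_ge0.
rewrite /weight ler_pdivlMr ?exprn_gt0// {1}e lw_line mulrC ler_pdivrMr; last first.
  by rewrite exprn_gt0// ltr_pwDl// sqr_ge0.
rewrite -exprMn lerXn2r ?nnegrE ?mulr_ge0 ?(ltW q0) ?sqr_ge0 ?addr_ge0 ?sqr_ge0//.
rewrite e freq_sq_line exprMn mulrDr mulr1 lerD2r.
by rewrite exprn_ege1// ler1n.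
Qed.

Lemma intr_inv_le1 (z : int) : `|(z%:~R : R)^-1| <= 1.
Proof.
have [->|z0] := eqVneq z 0; first by rewrite invr0 normr0.
rewrite normfV invf_le1 ?normr_gt0 ?intr_eq0// -intr_norm ler1z -gtz0_ge1 normr_gt0.
exact: z0.
Qed.

Variables (nu a : R) (u : K -> R -> R).
Hypotheses (nu0 : 0 < nu) (apos : 0 < a) (gu : good i0 n d.+1 a u)
  (uN : forall k t, u (- k) t = u k t) (u00 : forall t, u 0 t = 0)
  (du : forall k (t : R), 0 < t ->
     is_derive t (1 : R) (u k) (- (rate nu k * u k t) - q k * cubic_coef u k t)).

Let m1 : (0 < d.+1)%N. Proof. by []. Qed.
Let cu k : continuous (u k). Proof. exact: gu.1. Qed.
Let hu k t : `|u k t| <= 4 * a * lw k. Proof. exact: gu.2. Qed.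
Let a4 : 0 <= 4 * a. Proof. by rewrite mulr_ge0// ltW. Qed.

(** Dividing the slope coefficient by the frequency integrates it. On the excluded
    frequencies, where the divisor is 0, the numerator vanishes. *)
Definition line_coef k t : R := u k t / k0 k.
Definition line_sol t : E -> R := sin_series (line_coef^~ t).

Let B := 4 * a * line_cst.
Let B0 : 0 <= B. Proof. by rewrite mulr_ge0// line_cst_ge0. Qed.

Lemma u_weight k t : `|u k t| <= B * weight R d.+1 k.
Proof. apply: le_trans (hu k t) _; have -> : B * weight R d.+1 k = 4 * a * (line_cst * weight R d.+1 k) by rewrite mulrA.
by apply: ler_wpM2l => //; exact: lw_le_weight. Qed.

Lemma line_coef_bound k t : `|line_coef k t| <= B * weight R d.+1 k.
Proof.
rewrite normrM; apply: le_trans (_ : B * weight R d.+1 k * 1 <= _); last by rewrite mulr1.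
by apply: ler_pM => //; [exact: u_weight|exact: intr_inv_le1].
Qed.

Lemma u_off k t : ~~ onL i0 n k -> u k t = 0.
Proof. by move=> h; apply/eqP; rewrite -normr_le0; have := hu k t; rewrite lw_off// mulr0. Qed.

Lemma onL_other k j : onL i0 n k -> j != i0 -> k ord0 j = 0.
Proof. by move=> /onLP[l ->] ji; rewrite mxE (negbTE ji). Qed.

Lemma onL_zero k : onL i0 n k -> k ord0 i0 = 0 -> k = 0.
Proof.
move=> /onLP[l ->]; rewrite mxE eqxx => e; apply/rowP => j; rewrite !mxE.
by case: ifP.
Qed.

Lemma line_coefK k t : k0 k * line_coef k t = u k t.
Proof.
have [h|h] := boolP (onL i0 n k); last by rewrite /line_coef u_off// mul0r mulr0.
have [e|k00] := eqVneq (k ord0 i0) 0; first by rewrite /line_coef (onL_zero h e) u00 mul0r mulr0.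
by rewrite /line_coef mulrC divfK// intr_eq0.
Qed.

Lemma continuous_line_coef k : continuous (line_coef k).
Proof.
move=> t; suff : {for t, continuous (line_coef k)} by [].
by apply: continuousM; [exact: cu|exact: cst_continuous].
Qed.

Lemma ctorus_line_sol t : ctorus (line_sol t).
Proof. exact: (ctorus_sin_series (leqnSn d) B0 (line_coef_bound^~ t)). Qed.

Let z0 (C : R) (k : K) : 0 <= C -> `|(0 : R)| <= C * weight R d.+1 k.
Proof. by move=> C0; rewrite normr0 mulr_ge0// ltW// weight_gt0. Qed.

Lemma is_derive_line_sol t j x : is_derive x (basis_vec R j) (line_sol t)
  (if j == i0 then cos_series (u^~ t) x else 0).
Proof.
have := is_derive_trig_series j x (leqnn d) (fun k => z0 k B0) (line_coef_bound^~ t).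
congr (is_derive _ _ _ _).
case: eqVneq => [->|ji].
  congr climit; apply/funext => k; rewrite /trig_term line_coefK.
  by rewrite !(mulr0, oppr0).
rewrite -[RHS](climit_delta (fun=> 0) (0 : K)); congr climit; apply/funext => k.
rewrite /trig_term !(mulr0, oppr0, mul0r) addr0.
have [h|h] := boolP (onL i0 n k); first by rewrite (onL_other h ji) !mul0r.
by rewrite /line_coef u_off// mul0r mulr0 mul0r.
Qed.

Lemma partial_line_sol t j x : partial j (line_sol t) x = if j == i0 then cos_series (u^~ t) x else 0.
Proof. by have := is_derive_line_sol t j x => h; rewrite /partial derive_val. Qed.

Lemma ctorus_cos_line t : ctorus (cos_series (u^~ t)).
Proof. exact: (cbound_series m1 (fun k => hu k t) a4).1. Qed.

Lemma C1_line_sol t : torus_periodic (line_sol t) /\ C1 (line_sol t).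
Proof.
have [cH pH] := ctorus_line_sol t; split=> //; split=> // [x j|j].
  by have [] := is_derive_line_sol t j x.
have -> : partial j (line_sol t) = if j == i0 then cos_series (u^~ t) else cst 0.
  by apply/funext => x; rewrite partial_line_sol; case: ifP.
by case: ifP => _; [have [] := ctorus_cos_line t|exact: cst_continuous].
Qed.

Lemma gradient_line_sol t x : gradient (line_sol t) x = cos_series (u^~ t) x *: basis_vec R i0.
Proof.
apply/rowP => j; rewrite !mxE partial_line_sol eqxx/= eq_sym.
by case: ifP; rewrite ?mulr1 ?mulr0.
Qed.

Lemma eucl_norm_basis (c : R) : eucl_norm (c *: basis_vec R i0) = `|c|.
Proof.
rewrite /eucl_norm (bigD1 i0)//= big1 ?addr0 => [|j ji]; last first.
  by rewrite !mxE eqxx (negbTE ji) mulr0 expr0n.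
by rewrite !mxE !eqxx mulr1 sqrtr_sqr.
Qed.

Lemma flux_line_sol t j x : flux (line_sol t) j x = if j == i0 then cubic (u^~ t) x else 0.
Proof.
rewrite /flux gradient_line_sol eucl_norm_basis real_normK ?num_real// partial_line_sol.
by case: ifP => _; rewrite ?mulr0// /cubic; ring.
Qed.

(** At time 0 the factor [t^(1/4)] is continuous by [root4_small], and the slope itself is
    continuous in time up to 0. *)
Lemma line_sol_cC0 T : 0 < T -> continuous_in_C0 T (fun t x => t `^ 4^-1 *: gradient (line_sol t) x).
Proof.
move=> T0 t; rewrite in_itv/= => /andP[t0 tT].
have gE r x : r `^ 4^-1 *: gradient (line_sol r) x = (root4 r * cos_series (u^~ r) x) *: basis_vec R i0.
  by rewrite gradient_line_sol scalerA.
split.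
  have -> : (fun x => t `^ 4^-1 *: gradient (line_sol t) x) =
      (fun x : E => (root4 t * cos_series (u^~ t) x) *: basis_vec R i0).
    by apply/funext => x; rewrite gE.
  move=> x; apply: (@continuousZr_tmp R _ _ _ _ x); last first.
    by have [h _] := ctorusZ (root4 t) (ctorus_cos_line t); exact: h.
have FFw : Filter (within `[0, T]%classic (nbhs t)) by exact: within_filter.
apply: cvg0e => e e0; rewrite near_withinE.
have [M hM] := ctorus_bounded (ctorus_cos_line t).
have M0 : 0 <= M by apply: le_trans (hM 0).
have D1 : 0 < root4 T + 1 by rewrite ltr_pwDr// root4_ge0.
have e1 : 0 < e / 2 / (root4 T + 1) by rewrite !divr_gt0.
have e2 : 0 < e / 2 / (M + 1) by rewrite !divr_gt0//; lra.
have [d1 d10 h1] := good_modulus m1 apos t gu e1.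
have [d2 d20 h2] := root4_small e2.
apply/nbhs_ballP; exists (Num.min d1 d2); first by rewrite /= lt_min d10.
move=> r; rewrite /ball/= distrC lt_min => /andP[r1 r2]; rewrite in_itv/= => /andP[r0 rT].
apply/andP; split.
  apply: ereal_sup_ge; exists (eucl_norm ((fun x => r `^ 4^-1 *: gradient (line_sol r) x) 0 - (fun x => t `^ 4^-1 *: gradient (line_sol t) x) 0))%:E.
    by exists 0.
  by rewrite lee_fin sqrtr_ge0.
apply: ge_ereal_sup => _ [x _ <-]; rewrite lee_fin.
have -> : ((fun x => r `^ 4^-1 *: gradient (line_sol r) x) \- (fun x => t `^ 4^-1 *: gradient (line_sol t) x)) x =
   (root4 r * cos_series (u^~ r) x - root4 t * cos_series (u^~ t) x) *: basis_vec R i0.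
  by rewrite /= !gE -scalerBl.
rewrite eucl_norm_basis.
have -> : root4 r * cos_series (u^~ r) x - root4 t * cos_series (u^~ t) x =
  root4 r * (cos_series (u^~ r) x - cos_series (u^~ t) x) + (root4 r - root4 t) * cos_series (u^~ t) x by ring.
apply: le_trans (ler_normD _ _) _; rewrite !normrM.
have a1 : `|root4 r| * `|cos_series (u^~ r) x - cos_series (u^~ t) x| <= e / 2.
  apply: le_trans (_ : (root4 T + 1) * (e / 2 / (root4 T + 1)) <= _); last by rewrite mulrC divfK// gt_eqF.
  apply: ler_pM => //; last exact: h1.
  by rewrite ger0_norm ?root4_ge0//; apply: le_trans (root4_le r0 rT) _; rewrite lerDl.
have a2 : `|root4 r - root4 t| * `|cos_series (u^~ t) x| <= e / 2.
  apply: le_trans (_ : (e / 2 / (M + 1)) * (M + 1) <= _); last by rewrite divfK// gt_eqF//; lra.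
  apply: ler_pM => //; first exact: h2.
  by apply: le_trans (hM x) _; rewrite lerDl.
by move: a1 a2; move: (_ * `|_|) (_ * `|_|) => y z; lra.
Qed.

Lemma line_sol_sobolev T s : s <= d.+1%:R -> continuous_in_sobolev s T line_sol.
Proof.
move=> s1; by apply: (continuous_in_sobolev_series continuous_line_coef B0 line_coef_bound s1).
Qed.

(** The factor [t^(1/4)] is frozen outside [0, T], so that the weighted coefficients are
    bounded and continuous for all times. *)
Lemma line_sol_sobolev_weighted T s : 0 < T -> s <= d.+1%:R ->
  continuous_in_sobolev s T (fun t x => t `^ 4^-1 * line_sol t x).
Proof.
move=> T0 s1.
pose c t := root4 (Num.min (Num.max t 0) T).
have cl t : 0 <= Num.min (Num.max t 0) T <= T.
  by rewrite le_min le_max lexx orbT ltW//= ge_min lexx orbT.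
have cc : continuous c.
  move=> t; apply/cvgrPdist_le => e e0; have [del del0 hdel] := root4_small e0.
  have ct : {for t, continuous (fun t : R => Num.min (Num.max t 0) T)}.
    apply: continuous_min; last exact: cst_continuous.
    by apply: continuous_max; [exact: cvg_id|exact: cst_continuous].
  have /cvgrPdist_lt/(_ _ del0) := ct; apply: filterS => r hr.
  by apply: hdel => //; have /andP[] := cl t; have /andP[] := cl r.
pose b k t := c t * line_coef k t.
have cb k : continuous (b k).
  move=> t; suff : {for t, continuous (b k)} by [].
  by apply: continuousM; [exact: cc|exact: continuous_line_coef].
have D0 : 0 <= root4 T * B by rewrite mulr_ge0 ?root4_ge0.
have hb k t : `|b k t| <= root4 T * B * weight R d.+1 k.
  rewrite normrM -mulrA; apply: ler_pM => //; last exact: line_coef_bound.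
  by rewrite ger0_norm ?root4_ge0// root4_le//; have /andP[] := cl t.
apply: (continuous_in_sobolev_series cb D0 hb s1) => t /andP[t0 tT].
apply/funext => x.
have ct : c t = t `^ 4^-1 by rewrite /c (max_idPl t0) (min_idPl tT).
rewrite -ct /line_sol /sin_series /trig_series -climitZ; last first.
  exact: (csummable_trig (csummable_Zweight B (leqnSn d)) (fun k => z0 k B0) (line_coef_bound^~ t)).
by congr climit; apply/funext => k; rewrite /trig_term /b; ring.
Qed.

(** Products of even functions are even; on coefficients, a convolution of zeros. *)
Lemma sin_coef_mul_series (A : K -> R) (C : R) (f : E -> R) : (forall k, `|A k| <= C * lw k) -> 0 <= C ->
  ctorus f -> (forall k, sin_coef f k = 0) -> forall k, sin_coef (fun x => cos_series A x * f x) k = 0.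
Proof.
move=> hA C0 cf f0 k.
have h0 l : `|(0 : R)| <= C * lw l by rewrite normr0 mulr_ge0 ?lw_ge0.
have cfk : ctorus (fun x => f x * sin (freq_dot k x)) by apply: ctorusM => //; exact: ctorus_sin.
rewrite /sin_coef (_ : (fun x => _) = fun x => (f x * sin (freq_dot k x)) * cos_series A x); last first.
  by apply/funext => x; ring.
rewrite (mean_mul_trig_series (csummable_Zlw i0 n m1 C) hA h0 cfk) -[RHS](climit_delta (fun=> 0) (0 : K)).
congr climit; apply/funext => l; rewrite !mul0r addr0.
rewrite (_ : cos_coef _ _ = 2^-1 * (sin_coef f (k + l) + sin_coef f (k - l))); first by rewrite !f0 addr0 !mulr0.
rewrite /cos_coef /sin_coef -meanD; last 2 first.
- by apply: ctorusM => //; exact: ctorus_sin.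
- by apply: ctorusM => //; exact: ctorus_sin.
rewrite -meanZ; last by apply: ctorusD; apply: ctorusM => //; exact: ctorus_sin.
by congr mean; apply/funext => x; rewrite freq_dotDl freq_dotBl sinD sinB; field.
Qed.

Lemma sin_coef_cubic t k : sin_coef (cubic (u^~ t)) k = 0.
Proof.
have hA := hu^~ t; have h0 l : `|(0 : R)| <= 4 * a * lw l by rewrite normr0 mulr_ge0 ?lw_ge0.
have cv := ctorus_cos_line t.
have s1 l : sin_coef (cos_series (u^~ t)) l = 0.
  by rewrite (sin_coef_trig_series l (csummable_Zlw i0 n m1 _) hA h0) subrr mulr0.
have s2 := sin_coef_mul_series hA a4 cv s1.
have cv2 := ctorusM cv cv.
have s3 := sin_coef_mul_series hA a4 cv2 s2.
have -> : cubic (u^~ t) = (fun x => cos_series (u^~ t) x * (cos_series (u^~ t) x * cos_series (u^~ t) x) - cos_series (u^~ t) x).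
  by apply/funext => x; rewrite /cubic; ring.
by rewrite sin_coefB ?s3 ?s1 ?subrr//; exact: ctorusM.
Qed.

Lemma line_coefN k t : line_coef (- k) t = - line_coef k t.
Proof. by rewrite /line_coef uN mxE mulrNz invrN mulrN. Qed.

Lemma coef_line_sol t k : cos_coef (line_sol t) k = 0 /\ sin_coef (line_sol t) k = line_coef k t.
Proof.
have sB := csummable_Zweight B (leqnSn d).
have hl := line_coef_bound^~ t.
split; first by rewrite (cos_coef_trig_series k sB (fun k => z0 k B0) hl) addr0 mulr0.
rewrite (sin_coef_trig_series k sB (fun k => z0 k B0) hl) line_coefN.
by move: (line_coef k t) => y; rewrite opprK; field.
Qed.

Lemma bilap_line_sol t : bilap_semigroup nu t (line_sol 0) =
  sin_series (fun k => heat nu t k * line_coef k 0).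
Proof.
have eA : (fun k : K => heat nu t k * cos_coef (line_sol 0) k) = (fun=> 0).
  by apply/funext => k; rewrite (coef_line_sol 0 k).1 mulr0.
have eB : (fun k : K => heat nu t k * sin_coef (line_sol 0) k) = (fun k => heat nu t k * line_coef k 0).
  by apply/funext => k; rewrite (coef_line_sol 0 k).2.
by rewrite (bilapE nu t (ctorus_line_sol 0)) eA eB.
Qed.

Let F k s := cubic_coef u k s.

Let hF k s : `|F k s| <= cubic_bound d.+1 a * lw k.
Proof. exact: cubic_coef_bound. Qed.

Let CB := cubic_bound d.+1 a * line_cst.
Let CB0 : 0 <= CB.
Proof. by rewrite mulr_ge0 ?line_cst_ge0// (cubic_bound_ge0 d.+1 apos). Qed.

(** The absolute value extends the integrand to times [s > t], where the semigroup is not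
    defined, as a continuous function. *)
Definition duhamel_coef t k s : R := - (k0 k * (heat nu `|t - s| k * F k s)).

Lemma duhamel_coef_bound t k s : `|duhamel_coef t k s| <= CB * weight R d k.
Proof.
rewrite normrN 2!normrM; have h1 := freq_norm_le R k i0.
have h2 : `|heat nu `|t - s| k| <= 1.
  rewrite ger0_norm ?expR_ge0// -[leRHS]expR0 ler_expR oppr_le0.
  by rewrite mulr_ge0 ?sqr_ge0// mulr_ge0// ltW.
have h3 : `|F k s| <= CB * weight R d.+1 k.
  apply: le_trans (hF k s) _; have -> : CB * weight R d.+1 k = cubic_bound d.+1 a * (line_cst * weight R d.+1 k) by rewrite mulrA.
  by apply: ler_wpM2l; [exact: cubic_bound_ge0|exact: lw_le_weight].
rewrite -(weight_succ R d) [leRHS]mulrCA; apply: ler_pM => //.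
by rewrite -[leRHS]mul1r; apply: ler_pM.
Qed.

Lemma continuous_duhamel_coef t k : continuous (duhamel_coef t k).
Proof.
move=> s; suff : {for s, continuous (duhamel_coef t k)} by [].
apply: continuousN; apply: continuousM; first exact: cst_continuous.
apply: continuousM; last exact: (continuous_cubic_coef m1 apos gu).
apply: (@continuous_comp _ _ _ (fun s : R => - (nu * `|t - s| * q k ^+ 2)) expR); last exact: continuous_expR.
apply: continuousN; apply: continuousM; last exact: cst_continuous.
apply: continuousM; first exact: cst_continuous.
apply: (@continuous_comp _ _ _ (fun s : R => t - s) (fun x => `|x|)); last exact: norm_continuous.
by apply: continuousB; [exact: cst_continuous|exact: cvg_id].
Qed.

Let zd (k : K) : `|(0 : R)| <= CB * weight R d k.
Proof. by rewrite normr0 mulr_ge0// ltW// weight_gt0. Qed.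

Let Dser t x s : R := sin_series (duhamel_coef t ^~ s) x.
Let Dsum N t x s : R := csum N (fun k => duhamel_coef t k s * sin (freq_dot k x)).

Let sin_le1' (y : R) : `|sin y| <= 1.
Proof. by rewrite ler_norml sin_geN1 sin_le1. Qed.

Let continuous_Dser t x : continuous (Dser t x).
Proof.
move=> s; apply/cvgrPdist_le => e e0.
pose phi r k := duhamel_coef t k r - duhamel_coef t k s.
have hphi r k : `|phi r k| <= 2 * CB * weight R d k.
  apply: le_trans (ler_normB _ _) _; have := duhamel_coef_bound t k s; have := duhamel_coef_bound t k r.
  by move: (duhamel_coef t k r) (duhamel_coef t k s) (weight R d k) CB => y z w c; lra.
have cphi k : {for s, continuous (phi^~ k)}.
  by apply: continuousB; [exact: continuous_duhamel_coef|exact: cst_continuous].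
have [|del del0 hdel] := dominated_csum (csummable_Zweight (2 * CB) (leqnn d)) hphi cphi _ e0.
  by move=> k; rewrite /phi subrr.
apply/nbhs_ballP; exists del => //= r; rewrite /ball/= distrC => rs.
rewrite distrC.
have -> : Dser t x r - Dser t x s = climit (fun k => phi r k * sin (freq_dot k x)).
  rewrite /Dser /sin_series /trig_series -climitB.
  - by congr climit; apply/funext => k; rewrite /trig_term /phi; move: (duhamel_coef t k r) (duhamel_coef t k s) => y z; ring.
  - exact: (csummable_trig (csummable_Zweight CB (leqnn d)) zd (duhamel_coef_bound t ^~ r)).
  - exact: (csummable_trig (csummable_Zweight CB (leqnn d)) zd (duhamel_coef_bound t ^~ s)).
apply: climit_norm_le => N; apply: le_trans (hdel r rs N).
by apply: csum_le => k; rewrite normrM ler_piMr.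
Qed.

Let continuous_Dsum N t x : continuous (Dsum N t x).
Proof.
have -> : Dsum N t x = fun s => \sum_(c : grid d (2 * N).+1) duhamel_coef t (cube_pt c) s * sin (freq_dot (cube_pt c) x).
  by apply/funext => s; rewrite /Dsum csumE.
apply: continuous_sumr => c _ s; apply: continuousM; [exact: continuous_duhamel_coef|exact: cst_continuous].
Qed.

Let Psum N t x s : R := csum N (fun k => heat nu (t - s) k * line_coef k s * sin (freq_dot k x)).

Let continuous_Psum N t x : continuous (Psum N t x).
Proof.
have -> : Psum N t x = fun s => \sum_(c : grid d (2 * N).+1) heat nu (t - s) (cube_pt c) * line_coef (cube_pt c) s * sin (freq_dot (cube_pt c) x).
  by apply/funext => s; rewrite /Psum csumE.
apply: continuous_sumr => c _ s.
suff : {for s, continuous (fun s => heat nu (t - s) (cube_pt c) * line_coef (cube_pt c) s * sin (freq_dot (cube_pt c) x))} by [].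
apply: continuousM; last exact: cst_continuous.
apply: continuousM; [exact: continuous_heat|exact: continuous_line_coef].
Qed.

Let is_derive_Psum_term t k (s : R) : 0 < s -> s < t ->
  is_derive s (1 : R) (fun s => heat nu (t - s) k * line_coef k s) (duhamel_coef t k s).
Proof.
move=> s0 st.
have d0 : is_derive s (1 : R) (fun s => rate nu k * s - rate nu k * t) (rate nu k).
  have := @is_deriveB _ _ _ _ (cst (rate nu k * t)) s 1 _ _ (@is_deriveZ _ _ _ (@id R) (rate nu k) s 1 _ (is_derive_id _ _)) (is_derive_cst _ _ _).
  by rewrite /GRing.scale/= mulr1 subr0.
have d1 := @is_derive1_comp _ expR (fun s => rate nu k * s - rate nu k * t) s _ _ (is_derive_expR _) d0.
have d2 : is_derive s (1 : R) (line_coef k) ((- (rate nu k * u k s) - q k * cubic_coef u k s) / k0 k).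
  have := @is_deriveZ _ _ _ (u k) (k0 k)^-1 s 1 _ (du k s0).
  rewrite /GRing.scale/= [X in is_derive _ _ _ X]mulrC; congr (is_derive _ _ _ _).
  by apply/funext => r; rewrite /line_coef mulrC.
have := @is_deriveM _ _ _ _ s 1 _ _ d1 d2.
rewrite /GRing.scale/=.
have -> : ((expR \o (fun s => rate nu k * s - rate nu k * t)) * line_coef k) =
    (fun s => heat nu (t - s) k * line_coef k s).
  by apply/funext => r /=; congr (expR _ * _); rewrite /rate; ring.
have hE : expR (rate nu k * s - rate nu k * t) = heat nu (t - s) k by rewrite /heat /rate; congr expR; ring.
congr (is_derive _ _ _ _); rewrite hE /duhamel_coef gtr0_norm ?subr_gt0// -/(F k s) /line_coef.
move: (heat nu (t - s) k) (rate nu k) => e r.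
have [h|h] := boolP (onL i0 n k); last first.
  rewrite u_off// !mul0r; have -> : F k s = 0.
    by apply/eqP; rewrite -normr_le0; have := hF k s; rewrite lw_off// mulr0.
  by rewrite !(mulr0, mul0r, oppr0, subr0, addr0).
have [e0|k00] := eqVneq (k ord0 i0) 0.
  by rewrite e0 invr0 !(mulr0, mul0r, oppr0, subr0, addr0).
rewrite (onL_freq_sq h); move: (u k s) (F k s) => y z.
by field; rewrite intr_eq0.
Qed.

(** Each truncated integrand has the primitive [exp (- nu (t - s) |k|^4) u_k (s) / k], by the
    equation for the coefficients, and the truncations converge uniformly on [0, t]. *)
Lemma line_sol_duhamel t x : 0 < t ->
  line_sol t x = bilap_semigroup nu t (line_sol 0) x + \int[lebesgue_measure]_(s in `[0, t]) Dser t x s.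
Proof.
move=> t0; rewrite bilap_line_sol.
have dP N (s : R) : 0 < s < t -> is_derive s (1 : R) (Psum N t x) (Dsum N t x s).
  move=> /andP[s0 st].
  rewrite (_ : Psum N t x = fun s => \sum_(c : grid d (2 * N).+1) (fun c s => heat nu (t - s) (cube_pt c) * line_coef (cube_pt c) s * sin (freq_dot (cube_pt c) x)) c s); last first.
    by apply/funext => r; rewrite /Psum csumE.
  rewrite /Dsum csumE.
  apply: (@is_derive_sumr R _ _ _ (fun c s => duhamel_coef t (cube_pt c) s * sin (freq_dot (cube_pt c) x))) => c.
  have := @is_deriveZ _ _ _ _ (sin (freq_dot (cube_pt c) x)) s 1 _ (is_derive_Psum_term (cube_pt c) s0 st).
  rewrite /GRing.scale/= [X in is_derive _ _ _ X]mulrC; congr (is_derive _ _ _ _).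
  by apply/funext => r; exact: mulrC.
have IP N : \int[lebesgue_measure]_(s in `[0, t]) Dsum N t x s = Psum N t x t - Psum N t x 0.
  have := integral_segment_ftc_open t0 (@continuous_Dsum N t x) (@continuous_Psum N t x) (dP N); exact.
have sB := csummable_Zweight B (leqnSn d).
have hh k : `|heat nu t k * line_coef k 0| <= B * weight R d.+1 k.
  rewrite normrM -[leRHS]mul1r; apply: ler_pM => //; last exact: line_coef_bound.
  by rewrite ger0_norm ?expR_ge0// -[leRHS]expR0 ler_expR oppr_le0 mulr_ge0 ?sqr_ge0// mulr_ge0// ltW.
have c1 : (fun N => Psum N t x t) @ \oo --> line_sol t x.
  have -> : (fun N => Psum N t x t) = (fun N => csum N (trig_term (fun=> 0) (line_coef^~ t) x)).
    apply/funext => N; congr csum; apply/funext => k.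
    rewrite /trig_term /heat subrr mulr0 mul0r oppr0 expR0; move: (line_coef k t) => y; ring.
  exact: csummable_cvg (csummable_trig sB (fun k => z0 k B0) (line_coef_bound^~ t) x).
have c2 : (fun N => Psum N t x 0) @ \oo --> sin_series (fun k => heat nu t k * line_coef k 0) x.
  have -> : (fun N => Psum N t x 0) = (fun N => csum N (trig_term (fun=> 0) (fun k => heat nu t k * line_coef k 0) x)).
    apply/funext => N; congr csum; apply/funext => k.
    rewrite /trig_term subr0; move: (line_coef k 0) (heat nu t k) => y z; ring.
  exact: csummable_cvg (csummable_trig sB (fun k => z0 k B0) hh x).
have c3 : (fun N => \int[lebesgue_measure]_(s in `[0, t]) Dsum N t x s) @ \oo -->
    \int[lebesgue_measure]_(s in `[0, t]) Dser t x s.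
  apply/cvgrPdist_le => e e0.
  have et : 0 < e / t by rewrite divr_gt0.
  have [N1 hN1] := climit_uniform (csummable_Zweight (2 * CB) (leqnn d)) et.
  have ee : e = e / t * (t - 0) by rewrite subr0 divfK// gt_eqF.
  exists N1 => // N /= hN; rewrite [leRHS]ee.
  apply: integral_segment_close => // s _.
  have hb k : `|trig_term (fun=> 0) (duhamel_coef t ^~ s) x k| <= 2 * CB * weight R d k.
    have := trig_term_le x k zd (duhamel_coef_bound t ^~ s); lra.
  have := hN1 N hN _ hb.
  have -> : csum N (trig_term (fun=> 0) (duhamel_coef t ^~ s) x) = Dsum N t x s.
    by congr csum; apply/funext => k; rewrite /trig_term mul0r add0r.
  by [].
have c4 : (fun N => \int[lebesgue_measure]_(s in `[0, t]) Dsum N t x s) @ \oo -->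
   line_sol t x - sin_series (fun k => heat nu t k * line_coef k 0) x.
  under eq_fun do rewrite IP.
  exact: cvgB.
have := cvg_unique _ c3 c4 => ->//.
by rewrite addrC subrK.
Qed.

(** Only the direction [i0] contributes to the divergence, and there the semigroup acts on
    an even function, so that its derivative is a sine series. *)
Lemma line_sol_mild T : 0 < T -> mild_solution nu (line_sol 0) T line_sol.
Proof.
move=> T0; split.
- by move=> t _; exact: C1_line_sol.
- apply: line_sol_sobolev; rewrite ler_pdivrMr// -natrM ler_nat; lia.
- exact: line_sol_cC0.
- apply: line_sol_sobolev_weighted => //.
  by rewrite -[d.+1]addn1 natrD lerD2r ler_pdivrMr// -natrM ler_nat; lia.
split=> // t x; rewrite in_itv/= => /andP[t0 tT].
rewrite line_sol_duhamel//; congr (_ + _).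
have mD : measurable_fun (`]0, t[%classic : set (measurableTypeR R)) (Dser t x).
  apply: open_continuous_measurable_fun; first exact: interval_open.
  by move=> s _; exact: continuous_Dser.
have DE s : s \in `]0, t[%classic ->
    divergence (fun j => bilap_semigroup nu (t - s) (flux (line_sol s) j)) x = Dser t x s.
  rewrite inE/= in_itv/= => /andP[s0 st]; have ts : 0 < t - s by rewrite subr_gt0.
  have fE j : flux (line_sol s) j = if j == i0 then cubic (u^~ s) else cst 0.
    by apply/funext => y; rewrite flux_line_sol; case: ifP.
  have cc : ctorus (cubic (u^~ s)) := (cbound_cubic m1 (fun k => hu k s) a4).1.
  rewrite /divergence (bigD1 i0)//= big1 ?addr0 => [|j ji]; last first.
    rewrite fE (negbTE ji) partial_bilap//; last exact: ctorus_cst.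
    rewrite -[RHS](climit_delta (fun=> 0) (0 : K)); congr climit; apply/funext => k.
    have e1 : cos_coef (cst (0 : R) : E -> R) k = 0.
      rewrite /cos_coef -[RHS](mean_cst d (0 : R)); congr mean; apply/funext => y; exact: mul0r.
    have e2 : sin_coef (cst (0 : R) : E -> R) k = 0.
      rewrite /sin_coef -[RHS](mean_cst d (0 : R)); congr mean; apply/funext => y; exact: mul0r.
    by rewrite /trig_term e1 e2 !(mulr0, mul0r, oppr0, addr0).
  rewrite fE eqxx partial_bilap//; congr climit; apply/funext => k.
  rewrite /trig_term sin_coef_cubic !mulr0 !mul0r /duhamel_coef gtr0_norm//.
have mdiv : measurable_fun (`]0, t[%classic : set (measurableTypeR R))
    (fun s => divergence (fun j => bilap_semigroup nu (t - s) (flux (line_sol s) j)) x).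
  by apply: eq_measurable_fun mD => s /DE.
pose f s := divergence (fun j => bilap_semigroup nu (t - s) (flux (line_sol s) j)) x.
have {mdiv}mf : measurable_fun (`]0, t[%classic : set (measurableTypeR R)) f := mdiv.
have {DE}fg s : s \in `]0, t[%classic -> f s = Dser t x s := DE s.
rewrite -[RHS]/(\int[lebesgue_measure]_(s in `[0, t]) f s).
move: f (Dser t x) mD mf fg => f g mg mf fg.
rewrite /Rintegral; congr fine.
rewrite (@integral_itv_bndoo R 0 t (EFin \o f) true false); last exact/measurable_EFinP.
rewrite (@integral_itv_bndoo R 0 t (EFin \o g) true false); last exact/measurable_EFinP.
by apply: eq_integral => s /fg /= ->.
Qed.

End LineSolution.

(** * The initial data and the sup norm of gradients *)

Section SupNorm.
Variables (R : realType) (d : nat).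
Local Notation E := 'rV[R]_d.
Local Notation K := 'rV[int]_d.
Local Notation ctorus := (@ctorus R d).
Local Notation mu := (torus_measure R d).

Lemma torus_measure_gt0 : (0 < mu [set: d.-tuple (measurableTypeR R)])%E.
Proof.
have := integral_torus (ctorus_cst d (1 : R)); rewrite mean_cst mulr1 /=.
rewrite integral_cst// mul1e => ->.
by rewrite lte_fin exprn_gt0// mulr_gt0// pi_gt0.
Qed.

Lemma grad_LinftyE (f : E -> R) :
  grad_Linfty f = ess_sup mu (fun y => (eucl_norm (gradient f (row_of_tuple y)))%:E).
Proof.
rewrite /grad_Linfty unlock torus_measure_gt0; congr ess_sup.
apply/funext => y /=; rewrite ger0_norm//; exact: sqrtr_ge0.
Qed.

Lemma grad_Linfty_le (f : E -> R) (M : R) : (forall x, eucl_norm (gradient f x) <= M) ->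
  (grad_Linfty f <= M%:E)%E.
Proof.
move=> h; rewrite grad_LinftyE; apply/ess_supP; apply: aeW => y.
by rewrite lee_fin.
Qed.

(** An almost everywhere bound says that the positive part of the excess has null square
    mean; for a continuous function this forces the excess to be nonpositive everywhere. *)
Lemma le_grad_Linfty (f : E -> R) (M : R) : ctorus (fun x => eucl_norm (gradient f x)) ->
  (grad_Linfty f <= M%:E)%E -> forall x, eucl_norm (gradient f x) <= M.
Proof.
move=> cg; rewrite grad_LinftyE => /ess_supP hae.
pose g x := eucl_norm (gradient f x) - M.
pose phi x := (g x + `|g x|) / 2.
have cgM : ctorus g by apply: ctorusB => //; exact: ctorus_cst.
have cphi : ctorus phi.
  have := ctorusZ 2^-1 (ctorusD cgM (ctorus_norm cgM)).
  by congr ctorus; apply/funext => x; rewrite /phi mulrC.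
have phi0 x : g x <= 0 -> phi x = 0 by move=> gx; rewrite /phi ler0_norm// subrr mul0r.
have cpp := ctorusM cphi cphi.
have m0 : mean (fun x => phi x * phi x) = 0.
  have e : (\int[mu]_y (phi (row_of_tuple y) * phi (row_of_tuple y))%:E = \int[mu]_y 0%:E)%E.
    apply: ae_eq_integral => //.
    - by apply/measurable_EFinP; apply: (measurable_row_of_tuple (f := fun x => phi x * phi x)); case: cpp.
    - apply: filterS hae => y; rewrite lee_fin => h _.
      by rewrite phi0 ?mul0r// subr_le0.
  have := integral_torus cpp; rewrite e integral0 => -[/esym/eqP].
  rewrite mulf_eq0 => /orP[|/eqP//].
  by rewrite expf_eq0 mulf_eq0 pnatr_eq0/= gt_eqF ?pi_gt0// andbF.
have m1 : mean (fun x => phi x * phi x) <= 0 by rewrite m0.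
have z := ctorus_null cphi m1.
move=> x; have := z x; rewrite /phi => /eqP; rewrite mulf_eq0 invr_eq0 pnatr_eq0 orbF => /eqP e.
rewrite -[_ <= M]subr_le0 -/(g x).
by have := normr_ge0 (g x); move: e; move: (g x) (`|g x|) => a b; lra.
Qed.

(** Finite sums of waves given by amplitude, frequency and phase. This class is closed
    under partial derivatives, which gives smoothness at once. *)
Definition wave_sum (s : seq (R * K * R)) (x : E) : R :=
  \sum_(i <- s) i.1.1 * cos (freq_dot i.1.2 x + i.2).

Definition wave_partial (j : 'I_d) (s : seq (R * K * R)) : seq (R * K * R) :=
  map (fun i : R * K * R => (i.1.1 * (i.1.2 ord0 j)%:~R, i.1.2, i.2 + pi / 2)) s.

Lemma is_derive_wave_sum s j x : is_derive x (basis_vec R j) (wave_sum s)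
  (wave_sum (wave_partial j s) x).
Proof.
rewrite /wave_sum /wave_partial big_map; elim: s => [|i s IH].
  rewrite big_nil; under eq_fun do rewrite big_nil; exact: is_derive_cst.
rewrite big_cons; under [X in is_derive _ _ X]eq_fun do rewrite big_cons.
apply: (@is_deriveD _ _ _ (fun x => i.1.1 * cos (freq_dot i.1.2 x + i.2)) _ x) => //.
have := @is_deriveZ _ _ _ _ i.1.1 x _ _ (is_derive_cos_dot i.1.2 i.2 j x).
congr (is_derive _ _ _ _).
by rewrite /GRing.scale/= addrA cos_addpihalf !mulrN mulrA.
Qed.

Lemma C1_wave_sum s : C1 (wave_sum s).
Proof.
have cw s' : continuous (wave_sum s').
  by have [] : ctorus (wave_sum s') by apply: ctorus_sum => i _; apply: ctorusZ; exact: ctorus_cos.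
split=> //; first by move=> x j; have [] := is_derive_wave_sum s j x.
move=> j; have -> : partial j (wave_sum s) = wave_sum (wave_partial j s).
  by apply/funext => x; have h := is_derive_wave_sum s j x; rewrite /partial derive_val.
exact: cw.
Qed.

Lemma smooth_wave_sum s : smooth (wave_sum s).
Proof.
move=> l; suff [s' ->] : exists s', foldr (@partial R d) (wave_sum s) l = wave_sum s' by exact: C1_wave_sum.
elim: l => [|j l [s' IH]] /=; first by exists s.
rewrite IH; eexists; apply/funext => x; have h := is_derive_wave_sum s' j x.
by rewrite /partial derive_val; reflexivity.
Qed.

End SupNorm.

Section InitialData.
Variables (R : realType) (d : nat) (i0 : 'I_d) (n : nat).
Local Notation E := 'rV[R]_d.
Local Notation K := 'rV[int]_d.
Local Notation lw := (@lw R d i0 n d.+1).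
Local Notation pt := (@line_pt d i0 n).
Local Notation N := (n.+1%:R : R).

Definition pair_delta (l : int) (k : K) : R := (k == pt l)%:R + (k == pt (- l))%:R.

Definition init_coef (k : K) : R := 5 / 9 * pair_delta 1 k - 5 / 81 * pair_delta 3 k.

(** The antiderivative of the slope described at the top, with [N = n + 1]. *)
Definition init_data (x : E) : R :=
  10 / 9 / N * sin (N * x ord0 i0) - 10 / 243 / N * sin (3 * N * x ord0 i0).

Lemma line_pt_inj : injective pt.
Proof.
by move=> l l' /rowP/(_ i0); rewrite !mxE eqxx => /mulfI; apply.
Qed.

Lemma pair_deltaN l k : pair_delta l (- k) = pair_delta l k.
Proof.
have e l' : (- k == pt l') = (k == pt (- l')) by rewrite -line_ptN -eqr_oppLR.
by rewrite /pair_delta !e opprK addrC.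
Qed.

Lemma init_coefN k : init_coef (- k) = init_coef k.
Proof. by rewrite /init_coef !pair_deltaN. Qed.

Lemma lw_pt_ge l : (l%:~R ^+ 2 <= 9 :> R) -> 1 <= 10 ^+ d.+1 * lw (pt l).
Proof.
move=> l9; rewrite lw_line ler_pdivlMr ?mul1r; last by rewrite exprn_gt0// ltr_pwDl// sqr_ge0.
apply: lerXn2r; rewrite ?nnegrE ?addr_ge0 ?sqr_ge0//; lra.
Qed.

Lemma init_coef_bound k : `|init_coef k| <= 10 ^+ d.+1 * lw k.
Proof.
have w0 : 0 <= 10 ^+ d.+1 * lw k by rewrite mulr_ge0 ?lw_ge0// exprn_ge0.
rewrite /init_coef /pair_delta.
have step l : k = pt l -> l%:~R ^+ 2 <= 9 :> R -> 1 <= 10 ^+ d.+1 * lw k.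
  by move=> ->; exact: lw_pt_ge.
case: (eqVneq k (pt 1)) => [e|_].
  have := step 1 e ltac:(by rewrite expr1n; lra); rewrite e !(inj_eq line_pt_inj)/= => h.
  by rewrite ger0_norm; lra.
case: (eqVneq k (pt (- 1))) => [e|_].
  have := step (-1) e ltac:(by rewrite mulrN1z sqrrN expr1n; lra); rewrite e !(inj_eq line_pt_inj)/= => h.
  by rewrite ger0_norm; lra.
case: (eqVneq k (pt 3)) => [e|_].
  have := step 3 e ltac:(by rewrite -[3%:~R]/(3 : R); lra); rewrite e !(inj_eq line_pt_inj)/= => h.
  by rewrite ler0_norm; lra.
case: (eqVneq k (pt (- 3))) => [e|_].
  have := step (-3) e ltac:(by rewrite -[(-3)%:~R]/(- 3 : R); lra) => h; rewrite /=.
  by rewrite ler0_norm; lra.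
by rewrite /= addr0 !mulr0 subr0 normr0.
Qed.

Lemma freq_dot_pt l x : freq_dot (pt l) x = l%:~R * (N * x ord0 i0) :> R.
Proof.
rewrite freq_dotE (bigD1 i0)//= mxE eqxx big1 ?addr0 => [|j ji].
  by rewrite intrM; move: (l%:~R : R) => z; rewrite -pmulrn; ring.
by rewrite mxE (negbTE ji) mul0r.
Qed.

Lemma csummable_pair (c : K -> R) l : csummable (fun k => c k * pair_delta l k).
Proof.
have := csummableD (csummable_delta c (pt l)) (csummable_delta c (pt (- l))).
by congr csummable; apply/funext => k; rewrite mulrDr.
Qed.

Lemma climit_pair (c : K -> R) l : climit (fun k => c k * pair_delta l k) = c (pt l) + c (pt (- l)).
Proof.
rewrite -(climit_delta c (pt l)) -(climit_delta c (pt (- l))) -climitD; try exact: csummable_delta.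
by congr climit; apply/funext => k; rewrite mulrDr.
Qed.

Lemma climit_init (c : K -> R) (e1 e3 : R) :
  climit (fun k => c k * (e1 * pair_delta 1 k - e3 * pair_delta 3 k)) =
  e1 * (c (pt 1) + c (pt (- 1))) - e3 * (c (pt 3) + c (pt (- 3))).
Proof.
rewrite -!climit_pair -!climitZ; try exact: csummable_pair.
rewrite -climitB; try exact/csummableZ/csummable_pair.
by congr climit; apply/funext => k; ring.
Qed.

Lemma init_data_wave : init_data = @wave_sum R d
  [:: (10 / 9 / N, pt 1, - (pi / 2)); (- (10 / 243 / N), pt 3, - (pi / 2))].
Proof.
apply/funext => x; rewrite /wave_sum !big_cons big_nil /= !cos_subpihalf !freq_dot_pt addr0.
by rewrite mul1r mulNr mulrA.
Qed.

Lemma init_data_series : sin_series (fun k => init_coef k / (k ord0 i0)%:~R) = init_data.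
Proof.
apply/funext => x; rewrite /sin_series /trig_series.
rewrite [LHS](_ : _ = climit (fun k => (sin (freq_dot k x) / (k ord0 i0)%:~R) * init_coef k)); last first.
  by congr climit; apply/funext => k; rewrite /trig_term; ring.
rewrite climit_init !freq_dot_pt !mxE eqxx !intrM -[(n.+1%:Z)%:~R]/N.
rewrite /init_data -[1%:~R]/(1 : R) -[3%:~R]/(3 : R) -[(-1)%:~R]/(- 1 : R) -[(-3)%:~R]/(- 3 : R).
rewrite !mulNr !mul1r !sinN mulrA.
move: (sin (3 * N * x ord0 i0)) (sin (N * x ord0 i0)) => s3 s1.
have N0 : N != 0 by rewrite pnatr_eq0.
by move: N N0 => z z0; field.
Qed.

Lemma cos_triple (y : R) : cos (3 * y) = 4 * cos y ^+ 3 - 3 * cos y.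
Proof.
have -> : 3 * y = y + (y + y) by ring.
rewrite cosD [cos (y + y)]cosD [sin (y + y)]sinD.
have := cos2Dsin2 y; move: (cos y) (sin y) => c s h.
have -> : c * (c * c - s * s) - s * (s * c + c * s) = c ^+ 3 - 3 * c * s ^+ 2 by ring.
have -> : s ^+ 2 = 1 - c ^+ 2 by lra.
by ring.
Qed.

(** [e1] and [e3] are the factors by which the linear flow has damped the two modes; the
    value 1 of both gives the slope of the data. *)
Lemma damped_series (e1 e3 : R) x :
  cos_series (fun k => e1 * (5 / 9) * pair_delta 1 k - e3 * (5 / 81) * pair_delta 3 k) x =
  10 / 9 * (e1 * cos (N * x ord0 i0) - e3 / 9 * cos (3 * (N * x ord0 i0))).
Proof.
rewrite /cos_series /trig_series.
rewrite [LHS](_ : _ = climit (fun k => cos (freq_dot k x) *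
   (e1 * (5 / 9) * pair_delta 1 k - e3 * (5 / 81) * pair_delta 3 k))); last first.
  by congr climit; apply/funext => k; rewrite /trig_term; ring.
rewrite climit_init !freq_dot_pt.
rewrite -[1%:~R]/(1 : R) -[3%:~R]/(3 : R) -[(-1)%:~R]/(- 1 : R) -[(-3)%:~R]/(- 3 : R).
by rewrite !mulNr !mul1r !cosN; field.
Qed.

(** With [c = cos y] the slope is [(40/81) (3 c - c^3)], and [2 - 3 c + c^3 = (1 - c)^2 (2 + c)]. *)
Lemma init_series_bound x : `|cos_series init_coef x : R| <= 80 / 81.
Proof.
have -> : init_coef = (fun k => 1 * (5 / 9) * pair_delta 1 k - 1 * (5 / 81) * pair_delta 3 k).
  by apply/funext => k; rewrite /init_coef !mul1r.
rewrite damped_series cos_triple.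
have := cos_le1 (N * x ord0 i0); have := cos_geN1 (N * x ord0 i0).
move: (cos _) => c c1 c2; rewrite ler_norml.
have e : 10 / 9 * (1 * c - 1 / 9 * (4 * c ^+ 3 - 3 * c)) = 40 / 81 * (3 * c - c ^+ 3) by field.
rewrite e.
have h1 : 0 <= (1 - c) ^+ 2 * (2 + c) by rewrite mulr_ge0 ?sqr_ge0//; lra.
have h2 : 0 <= (1 + c) ^+ 2 * (2 - c) by rewrite mulr_ge0 ?sqr_ge0//; lra.
have e1 : (1 - c) ^+ 2 * (2 + c) = 2 - (3 * c - c ^+ 3) by ring.
have e2 : (1 + c) ^+ 2 * (2 - c) = 2 + (3 * c - c ^+ 3) by ring.
by rewrite e1 in h1; rewrite e2 in h2; apply/andP; split; lra.
Qed.

End InitialData.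

(** * Growth of the gradient *)

Section GradientGrowth.
Variables (R : realType) (d : nat) (i0 : 'I_d) (nu : R).
Hypothesis nu0 : 0 < nu.
Local Notation E := 'rV[R]_d.
Local Notation K := 'rV[int]_d.

Let al : R := 10 ^+ d.+1.
Let al1 : 1 <= al. Proof. by rewrite exprn_ege1// ler1n. Qed.
Let al0 : 0 < al. Proof. exact: lt_le_trans al1. Qed.

(** The multiples 500 and 2 make the nonlinear correction at most 5/500 = 1/100 at the
    origin and the contraction constant 1/2. *)
Lemma small_gain : exists n, gain n nu * (500 * cubic_bound d.+1 al + 2 * cubic_lip d.+1 al) <= 1.
Proof.
set C := 500 * _ + _.
exists (Num.trunc (C / nu)); set n := Num.trunc _.
have nn : C / nu <= n.+1%:R by exact/ltW/truncnS_gt.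
have N0 : 0 < n.+1%:R :> R by [].
have N1 : 1 <= n.+1%:R :> R by rewrite ler1n.
rewrite /gain mulrC ler_pdivrMr ?mul1r; last by rewrite mulr_gt0// exprn_gt0.
rewrite ler_pdivrMr// mulrC in nn; apply: le_trans nn _.
by rewrite ler_pM2l// expr2 ler_peMl// ltW.
Qed.

Variable n : nat.
Hypothesis hn : gain n nu * (500 * cubic_bound d.+1 al + 2 * cubic_lip d.+1 al) <= 1.
Local Notation N := (n.+1%:R : R).
Local Notation lw := (@lw R d i0 n d.+1).

Let g0 : 0 <= gain n nu.
Proof. by rewrite invr_ge0 mulr_ge0 ?(ltW nu0)// sqr_ge0. Qed.

Let cb0 : 0 <= gain n nu * cubic_bound d.+1 al.
Proof. by rewrite mulr_ge0// (cubic_bound_ge0 d.+1 al0). Qed.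

Let cl0 : 0 <= gain n nu * cubic_lip d.+1 al.
Proof. by rewrite mulr_ge0// /cubic_lip addr_ge0// mulr_ge0 ?sqr_ge0// mulr_ge0 ?sqr_ge0. Qed.

Let hn1 : gain n nu * cubic_bound d.+1 al <= 500^-1.
Proof. by have := hn; have := cl0; lra. Qed.

Let hn2 : gain n nu * cubic_lip d.+1 al <= 2^-1.
Proof. by have := hn; have := cb0; lra. Qed.

(** At this time the two modes have decayed by [exp (-1/27)] and [exp (-3)]. *)
Definition growth_time : R := (27 * nu * N ^+ 4)^-1.

Lemma growth_time_gt0 : 0 < growth_time.
Proof. by rewrite invr_gt0 !mulr_gt0// exprn_gt0. Qed.

Lemma global_solution : exists H : R -> E -> R,
  [/\ H 0 = init_data i0 n,
      forall T, 0 < T -> mild_solution nu (H 0) T H,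
      forall x, eucl_norm (gradient (H 0) x) <= 80 / 81,
      ctorus (fun x => eucl_norm (gradient (H growth_time) x)) &
      1 < eucl_norm (gradient (H growth_time) 0)].
Proof.
have hb1 : gain n nu * cubic_bound d.+1 al <= al by have := hn1; have := al1; lra.
have [u [gu uN u0 du [u00 ul]]] := @picard_solution R d i0 n d.+1 isT nu al (@init_coef R d i0 n) nu0 al0
  (@init_coef_bound R d i0 n) (@init_coefN R d i0 n) hb1 hn2.
have ui k : u k 0 = init_coef R i0 n k.
  have [->|k0] := eqVneq k 0; last exact: u0.
  rewrite u00 /init_coef /pair_delta.
  have pt0 l : l != 0 -> (0 == line_pt i0 n l :> K) = false.
    move=> l0; apply/negbTE; apply: contra_neq l0 => /rowP/(_ i0); rewrite !mxE eqxx.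
    by move/esym/eqP; rewrite mulf_eq0 => /orP[//|/eqP].
  by rewrite !pt0//= !addr0 !mulr0 subrr.
have gE t x : eucl_norm (gradient (line_sol i0 u t) x) = `|cos_series (u^~ t) x|.
  by rewrite (gradient_line_sol al0 gu u00) eucl_norm_basis.
have cv t : ctorus (cos_series (u^~ t)) := ctorus_cos_line al0 gu t.
exists (line_sol i0 u); split.
- rewrite -init_data_series /line_sol; congr sin_series; apply/funext => k.
  by rewrite /line_coef ui.
- by move=> T T0; exact: (line_sol_mild nu0 al0 gu uN u00 du T0).
- move=> x; rewrite gE (_ : u^~ 0 = init_coef R i0 n); last exact/funext.
  exact: init_series_bound.
- have := ctorus_norm (cv growth_time).
  by congr ctorus; apply/funext => x; rewrite gE.
rewrite gE; set t := growth_time.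
have t0 : 0 < t := growth_time_gt0.
pose e1 := expR (- 27^-1 : R); pose e3 := expR (- 3 : R).
pose L k := e1 * (5 / 9) * pair_delta R i0 n 1 k - e3 * (5 / 81) * pair_delta R i0 n 3 k.
have NN : N != 0 by rewrite pnatr_eq0.
have rateE l : rate nu (line_pt i0 n l) * t = (l%:~R) ^+ 4 / 27.
  rewrite /rate freq_sq_line /t /growth_time.
  by move: N NN (l%:~R : R) => z z0 y; field; rewrite z0 gt_eqF.
have LE k : expR (- (rate nu k * t)) * init_coef R i0 n k = L k.
  set ex := expR _.
  have damp (e : R) l z : l%:~R ^+ 4 = z -> expR (- (z / 27)) = e ->
      ex * (k == line_pt i0 n l)%:R = e * (k == line_pt i0 n l)%:R.
    move=> lz ze; rewrite /ex; case: eqVneq => [->|_]; last by rewrite !mulr0.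
    by rewrite rateE lz ze.
  have P1 : ex * pair_delta R i0 n 1 k = e1 * pair_delta R i0 n 1 k.
    have E1 : expR (- (1 / 27) : R) = e1 by rewrite mul1r.
    rewrite /pair_delta !mulrDr (damp e1 1 1) ?expr1n// (damp e1 (- 1) 1)//.
    by rewrite -[(-1)%:~R]/(- 1 : R); ring.
  have P3 : ex * pair_delta R i0 n 3 k = e3 * pair_delta R i0 n 3 k.
    have E3 : expR (- (81 / 27) : R) = e3 by congr expR; field.
    rewrite /pair_delta !mulrDr (damp e3 3 81)// ?(damp e3 (- 3) 81)//.
    - by rewrite -[(-3)%:~R]/(- 3 : R); ring.
    - by rewrite -[3%:~R]/(3 : R); ring.
  rewrite /init_coef mulrBr mulrCA P1 [ex * (5 / 81 * _)]mulrCA P3 /L.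
  by ring.
have c500 : 0 <= 500^-1 :> R by rewrite invr_ge0 ler0n.
have close k : `|u k t - L k| <= 500^-1 * lw k.
  have [->|k0] := eqVneq k 0.
    have L0 : L 0 = 0 by rewrite -LE -ui u00 mulr0.
    rewrite u00 L0 subrr normr0; apply: mulr_ge0; last exact: lw_ge0.
    exact: c500.
  rewrite -LE; apply: le_trans (ul k t k0 (ltW t0)) _.
  by apply: ler_wpM2r; [exact: lw_ge0|exact: hn1].
have bu k : `|u k t| <= (4 * al + 500^-1) * lw k.
  apply: le_trans (gu.2 k t) _; apply: ler_wpM2r; first exact: lw_ge0.
  by rewrite lerDl; exact: c500.
have bL k : `|L k| <= (4 * al + 500^-1) * lw k.
  have := gu.2 k t; have := close k; have := ler_normB (u k t) (u k t - L k).
  by rewrite opprB addrC subrK => h1 h2 h3; rewrite mulrDl; lra.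
have C0 : 0 <= 4 * al + 500^-1 by have := al1; lra.
have near : `|cos_series (u^~ t) 0 - cos_series L 0 : R| <= 100^-1.
  rewrite -(cos_seriesB (i0 := i0) (n := n) (m := d.+1) isT (0 : E) bu bL C0).
  apply: climit_norm_le => M; apply: le_trans (_ : csum M (fun k => 500^-1 * lw k) <= _).
    apply: csum_le => k; apply: le_trans (close k).
    rewrite /trig_term mul0r addr0 normrM ler_piMr//.
    by rewrite ler_norml cos_geN1 cos_le1.
  by rewrite csumZ; have := csum_lw R i0 n (m := d.+1) isT M; lra.
have lin : cos_series L 0 = 10 / 9 * (e1 - e3 / 9).
  by rewrite damped_series !mxE !mulr0 cos0 !mulr1.
have h1 : 26 / 27 <= e1.
  by have := expR_ge1Dx (- 27^-1 : R); rewrite -/e1; lra.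
have h3 : e3 <= 4^-1.
  rewrite /e3 expRN lef_pV2 ?posrE ?expR_gt0//.
  by have := expR_ge1Dx (3 : R); lra.
apply: lt_le_trans (ler_norm _).
move: near; rewrite lin ler_norml; move: (cos_series _ _) => v; lra.
Qed.

End GradientGrowth.

Theorem corollary1p3 (R : realType) (d : nat) (nu : R)
    (d_ge1 : (1 <= d)%N) (nu_gt0 : 0 < nu) :
  exists A : set ('rV[R]_d -> R),
    [/\ A !=set0,
        forall h0, A h0 -> torus_periodic h0 /\ smooth h0,
        forall h0, A h0 ->
          torus_integral h0 = 0 /\ (grad_Linfty h0 < 1)%E &
        forall h0, A h0 ->
          exists t0 : R,
            [/\ 0 < t0,
                (t0%:E < lifespan nu h0)%E,
                exists h, maximal_solution nu h0 h &
                forall h, maximal_solution nu h0 h ->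
                  (1 < grad_Linfty (h t0))%E]].
Proof.
pose i0 : 'I_d := Ordinal d_ge1.
have [n hn] := small_gain d nu_gt0.
have [H [H0 mH gH cH big]] := global_solution i0 nu_gt0 hn.
set t0 := growth_time nu n in cH big.
have t0p : 0 < t0 := growth_time_gt0 nu_gt0 n.
have life (T : R) : 0 < T -> (T%:E < lifespan nu (H 0%R))%E.
  move=> T0; apply: lt_le_trans (_ : ((T + 1)%:E <= _)%E); first by rewrite lte_fin ltrDl.
  have T1 : 0 < T + 1 by rewrite addr_gt0.
  by apply: ereal_sup_ubound; exists (T + 1) => //; split=> //; exists H; exact: mH.
exists [set init_data i0 n]; split.
- by exists (init_data i0 n).
- move=> _ ->; rewrite init_data_wave; split; last exact: smooth_wave_sum.
  by have [] : ctorus (wave_sum [:: (10 / 9 / n.+1%:R, line_pt i0 n 1, - (pi / 2)); (- (10 / 243 / n.+1%:R), line_pt i0 n 3, - (pi / 2))] : 'rV[R]_d -> R)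
    by apply: ctorus_sum => i _; apply: ctorusZ; exact: ctorus_cos.
- move=> _ ->; split; last first.
    rewrite -H0; apply: le_lt_trans (grad_Linfty_le gH) _.
    by rewrite lte_fin; lra.
  have m0 : mean (init_data (R := R) i0 n) = 0.
    rewrite init_data_wave /wave_sum mean_sum => [|i _]; last by apply: ctorusZ; exact: ctorus_cos.
    rewrite !big_cons big_nil !meanZ; try exact: ctorus_cos.
    have cs k : mean (fun x : 'rV[R]_d => cos (freq_dot k x + - (pi / 2))) = 0.
      by under [X in mean X]eq_fun do rewrite cos_subpihalf; exact: mean_sin.
    by rewrite !cs !mulr0 !addr0.
  move: m0; rewrite /mean => /eqP; rewrite mulf_eq0 invr_eq0 expf_eq0 mulf_eq0 pnatr_eq0/=.
  by rewrite gt_eqF ?pi_gt0// andbF/= => /eqP.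
- move=> _ ->; rewrite -H0; exists t0; split=> //; [exact: life|by exists H => T T0 _; exact: mH|].
  move=> h mh.
  have T1 : 0 < t0 + 1 by rewrite addr_gt0.
  have hH : h t0 = H t0.
    apply/funext => x.
    apply: (mild_unique nu_gt0 T1 (mh _ T1 (life _ T1)) (mH _ T1)).
    by rewrite t0p ltrDl ltr01.
  rewrite hH ltNge; apply/negP => /(le_grad_Linfty cH)/(_ 0).
  by rewrite leNgt big.
Qed.
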